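(* For each $n>0$, there exists $\epsilon_n$ such that for all $\epsilon\le\epsilon_n$ all closed orbits $\gamma$ of $R_\epsilon$ of word length $\le n$ are hyperbolic, with $$\mathrm{CZ}_2(\gamma)=\sum_{k}\left(\mathrm{rot}_{j_k,j_{k+1}}+\delta_{1,c^+_{j_k}}\right)\in\mathbb{Z}/2\mathbb{Z},$$ where $r_{j_1}r_{j_2}\cdots$ is the cyclic word of $\gamma$ and the sum is over its letters (indices cyclic). Moreover, if either $\Lambda^+=\emptyset$ or $\Lambda^-=\emptyset$, then all closed orbits of $R_\epsilon$ are hyperbolic for all $\epsilon<\min\{\frac12,\epsilon_0\}$.
   Context: Surgery setup. $I_\epsilon=[-\epsilon,\epsilon]$, $S^1=\mathbb{R}/\mathbb{Z}$, $\alpha_{std}=dz-y\,dx$, $\xi_{std}=\ker\alpha_{std}$ on $\mathbb{R}^3$, $\pi_{xy}$ the projection to the $xy$-plane. $\Lambda^\pm=\Lambda^+\cup\Lambda^-\subset(\mathbb{R}^3,\xi_{std})$ is an oriented Legendrian link with components $\Lambda_i$; $c_i=\pm1$ means $\Lambda_i\subset\Lambda^{\pm}$ respectively (surgery coefficient). The chords $r_j$ are the $\partial_z$-directed segments with both endpoints on $\Lambda^\pm$; $r_j$ begins (tail) on $\Lambda_{l_j^-}$ and ends (tip) on $\Lambda_{l_j^+}$; $c_j^\pm=c_{l_j^\pm}$. Standing assumptions: chords are non-degenerate (double points of $\pi_{xy}(\Lambda^\pm)$ are transverse) and pairwise disjoint; each component has length $1$ for the metric on $\xi_{std}$ making $\partial_x+y\partial_z,\partial_y$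 orthonormal; good position: near each double point $(x_0,y_0)$ the upper strand projects to $\{(x_0+s,y_0-s)\}$ and the lower one to $\{(x_0+s,y_0+s)\}$. For small $\epsilon_0>0$ fix disjoint embeddings $\Phi_i:I_{\epsilon_0}\times I_{\epsilon_0}\times S^1\to\mathbb{R}^3$, coordinates $(z,p,q)$, with $\Phi_i^*\alpha_{std}=dz+p\,dq$, $\Phi_i(z,p,q)=\Phi_i(0,p,q)+(0,0,z)$, $\Phi_i(0,0,q)$ an oriented unit-speed parameterization of $\Lambda_i$, and near a chord endpoint with parameter $q_0$ over $(x_0,y_0)$: $\pi_{xy}\Phi_i(z,p,q)=(x_0,y_0)+(q-q_0)v-p\,J_0v$, $v$ the unit tangent of $\pi_{xy}(\Lambda_i)$ there and $J_0$ rotation by $\pi/2$. $N_{\epsilon,i}=\Phi_i(I_\epsilon\times I_\epsilon\times S^1)$, $N_\epsilon=\bigcup_iN_{\epsilon,i}$; the projections of the strands of $N_\epsilon$ overlap only in one rectangle $\mathcal{D}_j$ around the double point of each $r_j$. Fix smooth $f:\mathbb{R}\to S^1$ with $f=0$ for $p\le-1$, $f'$ even, $0\le f'\le1$, $\mathrm{supp} f'\subset[-1,1]$, $\int f'=1$, and $f'=1$ on $I_{(1-\delta)/2}$, where $\delta=\delta(\epsilon)>0$ is so small that all points flowing through a surgery handle from its bottom over a rectangle $\mathcal{D}_j$ to its top over a rectangle $\mathcal{D}_{j'}$, $j'\ne j$, have $p$ in the interval where $f_\epsilon(p)=f(p/\epsilon)$ is affine. Let $H_\epsilon(p)=\int_{-\infty}^pPf_\epsilon'(P)\,dP$.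 For $\epsilon<\epsilon_0$, $(\mathbb{R}^3_{\Lambda^\pm},\xi_{\Lambda^\pm})$ with contact form $\alpha_\epsilon$ (Reeb field $R_\epsilon$) is obtained by removing each $N_{\epsilon,i}$ and regluing a copy of it with the form $dz+p\,dq$, inside coordinates being sent to outside coordinates by $(z,p,q)\mapsto(z-c_iH_\epsilon(p),p,q+c_if_\epsilon(p))$ near the top $\{z=\epsilon\}$ and by the identity near the sides $\{|p|=\epsilon\}$ and bottom $\{z=-\epsilon\}$; $\alpha_\epsilon=\alpha_{std}$ elsewhere. Words. Cyclic words of chords are products $r_{j_1}\cdots r_{j_n}$ with $l^+_{j_k}=l^-_{j_{k+1}}$ cyclically, up to cyclic permutation; closed orbits of $R_\epsilon$ correspond bijectively to cyclic words, the word listing in order the chords $r_j$ along which (over $\mathcal{D}_j$) the vertical segments of the orbit outside $N_\epsilon$ run. Word length is the number of letters. Rotation. For $l_a^+=l_b^-$, $\eta_{a,b}$ is the embedded arc of $\Lambda_{l_a^+}$ following its orientation from the tip of $r_a$ to the tail of $r_b$, $\theta_{a,b}$ is the total rotation angle of the oriented unit tangent of its $xy$-projection, $\mathrm{rot}_{a,b}=\lfloor\theta_{a,b}/\pi\rfloor$. $\delta_{\cdot,\cdot}$ with two subscripts is the Kronecker delta. Indices. For a closed Reeb orbit $\gamma$ with linearized return map $\mathrm{Ret}_\gamma\in SL(2,\mathbb{R})$, $\gamma$ is hyperbolic if $|\mathrm{tr}\,\mathrm{Ret}_\gamma|>2$; the mod $2$ Conley–Zehnder index $\mathrm{CZ}_2(\gamma)\in\mathbb{Z}/2\mathbb{Z}$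 is determined by $\mathrm{sgn}\det(\mathrm{Ret}_\gamma-\mathrm{Id})=(-1)^{\mathrm{CZ}_2(\gamma)+1}$.
   Formalization: The smallness condition on δ is also required for flow from the tip to the tail of one chord (j'=j, both ends on one component); with j'≠j only, a one-chord knot with large δ can have a non-hyperbolic orbit. *)

(* Defs.v *)
From HB Require Import structures.
From mathcomp Require Import all_boot all_order all_algebra.
From mathcomp Require Import all_classical all_reals all_analysis.
Set Implicit Arguments.
Unset Strict Implicit.
Unset Printing Implicit Defensive.
Import Order.TTheory GRing.Theory Num.Theory.
Import numFieldNormedType.Exports.
Local Open Scope classical_set_scope.
Local Open Scope ring_scope.

(* A triple is written (x, y, z) in the ambient R^3 and (z, p, q) in the
   coordinates near a component of the link, where q is a real lift of a
   coordinate on S^1 = R/Z.  Maps into S^1 are likewise given by real lifts. *)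
Notation triple R := (R * R * R)%type.

Section Calculus.
Variable R : realType.

Fixpoint Ck (U V : normedModType R) (k : nat) (A : set U) (g : U -> V) : Prop :=
  if k is k'.+1 then
    (forall x, A x -> differentiable g x) /\
    (forall v, Ck k' A (fun x => 'D_v g x))
  else forall x, A x -> {for x, continuous g}.

Definition smooth_on (U V : normedModType R) (A : set U) (g : U -> V) : Prop :=
  forall k, Ck k A g.

(* A 1-form on an open subset of R^3 is given by alpha x v, its value at the
   point x on the tangent vector v. *)
Definition one_form := triple R -> triple R -> R.

(* d alpha (u, v) = u(alpha(v)) - v(alpha(u)) for constant fields u and v *)
Definition ext_deriv (alpha : one_form) (x u v : triple R) : R :=
  'D_u (fun x' => alpha x' v) x - 'D_v (fun x' => alpha x' u) x.

Definition reeb_vector (alpha : one_form) (x v : triple R) : Prop :=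
  alpha x v = 1 /\ forall w, ext_deriv alpha x v w = 0.

(* dz - y dx in coordinates (x, y, z) *)
Definition alpha_std : one_form := fun x v => v.2 - x.1.2 * v.1.1.

(* dz + p dq in coordinates (z, p, q) *)
Definition alpha_nbhd : one_form := fun w v => v.1.1 + w.1.2 * v.2.

Definition xy (P : triple R) : R * R := P.1.

Definition J0 (v : R * R) : R * R := (- v.2, v.1).

Definition box (e : R) : set (triple R) :=
  [set w | `|w.1.1| <= e /\ `|w.1.2| <= e].

(* equality and distance at most e in R/Z *)
Definition eq_mod1 (q q' : R) : Prop := exists k : int, q' = q + k%:~R.

Definition close_mod1 (e q q' : R) : Prop := exists k : int, `|q + k%:~R - q'| <= e.

End Calculus.

(* The components of the link are indexed by 'I_N and given by 1-periodic
   parameterizations lam i; Lpos is the set of indices of the components of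
   Lambda^+.  The function f is allowed to depend on epsilon, since delta does:
   shear eps is the function f used for the parameter eps. *)
Record surgery (R : realType) (N : nat) := Surgery {
  Lpos : {set 'I_N};
  lam : 'I_N -> R -> triple R;
  eps0 : R;
  Phi : 'I_N -> triple R -> triple R;
  delta : R -> R;
  shear : R -> R -> R }.

(* Endpoints are recorded by a component and a parameter in [0, 1). *)
Record chord (R : realType) (N : nat) := Chord {
  tail_comp : 'I_N;
  tail_par : R;
  tip_comp : 'I_N;
  tip_par : R }.

Section Surgery.
Variables (R : realType) (N : nat) (S : surgery R N).
Implicit Types (r : chord R N) (eps : R).

Definition coef (i : 'I_N) : R := if i \in Lpos S then 1 else -1.

(* unit tangent of the xy-projection of the i-th component *)
Definition tangent (i : 'I_N) (q : R) : R * R := xy (derive1 (lam S i) q).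

Definition legendrian_link : Prop :=
  (forall i, smooth_on setT (lam S i)) /\
  (forall i q, lam S i (q + 1) = lam S i q) /\
  (forall i i' q q', lam S i q = lam S i' q' -> i = i' /\ eq_mod1 q q') /\
  (forall i q, alpha_std (lam S i q) (derive1 (lam S i) q) = 0) /\
  (* unit speed for the metric on xi_std in which d_x + y d_z and d_y are
     orthonormal; with period 1, every component has length 1 *)
  (forall i q, (tangent i q).1 ^+ 2 + (tangent i q).2 ^+ 2 = 1).

Definition tail r : triple R := lam S (tail_comp r) (tail_par r).
Definition tip r : triple R := lam S (tip_comp r) (tip_par r).

Definition is_chord r : Prop :=
  [/\ 0 <= tail_par r < 1, 0 <= tip_par r < 1,
      xy (tail r) = xy (tip r) & (tail r).2 < (tip r).2].

Definition chord_points r : set (triple R) :=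
  [set P | xy P = xy (tail r) /\ (tail r).2 <= P.2 <= (tip r).2].

Definition chord_endpoint (i : 'I_N) (q : R) : Prop :=
  exists r, is_chord r /\
    ((i = tail_comp r /\ q = tail_par r) \/ (i = tip_comp r /\ q = tip_par r)).

Definition chord_generic : Prop :=
  (forall r, is_chord r ->
     let v := tangent (tail_comp r) (tail_par r) in
     let w := tangent (tip_comp r) (tip_par r) in
     v.1 * w.2 - v.2 * w.1 != 0) /\
  (forall r r', is_chord r -> is_chord r' -> r <> r' ->
     chord_points r `&` chord_points r' = set0).

Definition good_position : Prop :=
  forall r, is_chord r ->
    (\forall q \near tip_par r, exists s : R,
       xy (lam S (tip_comp r) q) = xy (tip r) + (s, - s)) /\
    (\forall q \near tail_par r, exists s : R,
       xy (lam S (tail_comp r) q) = xy (tail r) + (s, s)).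

(* (i, q) lies on the strand through the tip (resp. the tail) of r, at distance
   at most e from it *)
Definition near_tip (e : R) r (i : 'I_N) (q : R) : Prop :=
  i = tip_comp r /\ close_mod1 e q (tip_par r).
Definition near_tail (e : R) r (i : 'I_N) (q : R) : Prop :=
  i = tail_comp r /\ close_mod1 e q (tail_par r).

Definition standard_nbhds : Prop :=
  0 < eps0 S /\
  (* smooth embeddings of the closed boxes: smooth near the box, immersive,
     injective modulo q ~ q + 1, with pairwise disjoint images *)
  (forall i, exists U : set (triple R),
     [/\ open U, box (eps0 S) `<=` U & smooth_on U (Phi S i)]) /\
  (forall i w v, box (eps0 S) w -> 'd (Phi S i) w v = 0 -> v = 0) /\
  (forall i z p q, box (eps0 S) (z, p, q) ->
     Phi S i (z, p, q + 1) = Phi S i (z, p, q)) /\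
  (forall i i' w w', box (eps0 S) w -> box (eps0 S) w' ->
     Phi S i w = Phi S i' w' -> [/\ i = i', w.1 = w'.1 & eq_mod1 w.2 w'.2]) /\
  (forall i w v, box (eps0 S) w ->
     alpha_std (Phi S i w) ('d (Phi S i) w v) = alpha_nbhd w v) /\
  (forall i z p q, box (eps0 S) (z, p, q) ->
     Phi S i (z, p, q) = Phi S i (0, p, q) + (0, 0, z)) /\
  (forall i q, Phi S i (0, 0, q) = lam S i q) /\
  (* the linear form near the endpoints of chords, valid over the rectangles *)
  (forall i q0, chord_endpoint i q0 ->
     forall z p q, box (eps0 S) (z, p, q) -> `|q - q0| <= eps0 S ->
       xy (Phi S i (z, p, q)) =
         xy (lam S i q0) + (q - q0) *: tangent i q0 - p *: J0 (tangent i q0)) /\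
  (* the projections of the strands overlap only in the rectangles *)
  (forall i i' p p' q q', `|p| <= eps0 S -> `|p'| <= eps0 S ->
     xy (Phi S i (0, p, q)) = xy (Phi S i' (0, p', q')) ->
     ~ [/\ i = i', p = p' & eq_mod1 q q'] ->
     exists r, is_chord r /\
       ((near_tip (eps0 S) r i q /\ near_tail (eps0 S) r i' q') \/
        (near_tail (eps0 S) r i q /\ near_tip (eps0 S) r i' q'))).

Definition f_ eps (p : R) : R := shear S eps (p / eps).

Definition H_ eps (p : R) : R :=
  \int[lebesgue_measure]_(P in `]-oo, p]) (P * derive1 (f_ eps) P).

Definition shear_functions : Prop :=
  forall eps, 0 < eps -> eps < eps0 S ->
    let f := shear S eps in
    smooth_on setT f /\
    (forall p, p <= -1 -> f p = 0) /\
    (forall p, derive1 f (- p) = derive1 f p) /\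
    (forall p, 0 <= derive1 f p <= 1) /\
    (forall p, 1 < `|p| -> derive1 f p = 0) /\
    \int[lebesgue_measure]_(p in setT) (derive1 f p) = 1 /\
    0 < delta S eps /\
    (forall p, `|p| <= (1 - delta S eps) / 2 -> derive1 f p = 1) /\
    (* A point flowing through the i-th handle enters it at (p, q) and leaves it
       at (p, q + c_i f_eps(p)).  The rectangle of a chord meets the i-th strand
       near q0 for each endpoint (i, q0) of the chord; distinct endpoints are
       allowed to belong to the same chord. *)
    (forall i q0 q1, chord_endpoint i q0 -> chord_endpoint i q1 -> q0 <> q1 ->
       forall p q, `|p| <= eps -> close_mod1 eps q q0 ->
         close_mod1 eps (q + coef i * f_ eps p) q1 ->
         `|p / eps| <= (1 - delta S eps) / 2).

Definition surgery_setup : Prop :=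
  [/\ legendrian_link, chord_generic, good_position,
      standard_nbhds & shear_functions].

(* The surgered manifold is the union of the outside chart, the complement of
   N_eps in R^3 (chart None), and of one open chart for every handle (chart
   Some i).  The latter contains the reglued closed handle; its remaining points
   are identified with outside points through the gluing map: the shear above
   and the identity below (the two agree modulo q ~ q + 1 for |p| >= eps, where
   H_eps vanishes and f_eps is an integer).  The handle is cut where its top
   reaches the outside level z = eps; as the gluing map is defined on a whole
   collar, the glued manifold does not depend on the level of the cut. *)
Definition nbhd_link eps : set (triple R) :=
  [set P | exists i w, box eps w /\ P = Phi S i w].

Definition handle eps (i : 'I_N) : set (triple R) :=
  [set w | [/\ `|w.1.2| <= eps, - eps <= w.1.1
             & w.1.1 - coef i * H_ eps w.1.2 <= eps]].

Definition glue eps (i : 'I_N) (w : triple R) : triple R :=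
  if 0 < w.1.1 then
    (w.1.1 - coef i * H_ eps w.1.2, w.1.2, w.2 + coef i * f_ eps w.1.2)
  else w.

Definition spoint : Type := (option 'I_N * triple R)%type.

Definition chart_dom eps (x : spoint) : Prop :=
  match x with
  | (None, P) => ~ nbhd_link eps P
  | (Some i, w) => [/\ `|w.1.2| < eps0 S, - eps0 S < w.1.1
                     & w.1.1 - coef i * H_ eps w.1.2 < eps0 S]
  end.

Definition same_point eps (x x' : spoint) : Prop :=
  chart_dom eps x /\ chart_dom eps x' /\
  match x, x' with
  | (None, P), (None, P') => P = P'
  | (Some i, w), (Some i', w') => [/\ i = i', w.1 = w'.1 & eq_mod1 w.2 w'.2]
  | (Some i, w), (None, P) | (None, P), (Some i, w) =>
      ~ handle eps i w /\ P = Phi S i (glue eps i w)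
  end.

(* the contact form alpha_eps in the charts *)
Definition alpha_chart (k : option 'I_N) : one_form R :=
  if k is Some _ then @alpha_nbhd R else @alpha_std R.

(* gam is an integral curve of the Reeb field R_eps on a neighbourhood of t *)
Definition reeb_at eps (gam : R -> spoint) (t : R) : Prop :=
  exists (k : option 'I_N) (c : R -> triple R),
    \forall s \near t, same_point eps (gam s) (k, c s) /\
      exists v, is_derive s 1 c v /\ reeb_vector (alpha_chart k) (c s) v.

Definition closed_orbit eps (gam : R -> spoint) (T : R) : Prop :=
  [/\ 0 < T, forall t, reeb_at eps gam t
    & forall t, same_point eps (gam (t + T)) (gam t)].

(* x' is the image of x under the time T Reeb flow *)
Definition reeb_flow eps (T : R) (x x' : spoint) : Prop :=
  exists gam : R -> spoint,
    [/\ forall t, 0 <= t <= T -> reeb_at eps gam t,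
        same_point eps (gam 0) x & same_point eps (gam T) x'].

(* A is the matrix, in some basis e of the contact plane at gam 0, of the
   restriction to that plane of the derivative of the time T flow; F is the
   expression of this flow in a chart k around gam 0 = (k, a). *)
Definition linearized_return eps (gam : R -> spoint) (T : R) (A : 'M[R]_2) : Prop :=
  exists (k : option 'I_N) (a : triple R) (F : triple R -> triple R)
         (e : 'I_2 -> triple R),
    same_point eps (gam 0) (k, a) /\
    (\forall b \near a, reeb_flow eps T (k, b) (k, F b)) /\
    F a = a /\ differentiable F a /\
    (forall l, alpha_chart k a (e l) = 0) /\
    (forall s : 'I_2 -> R, \sum_l s l *: e l = 0 -> forall l, s l = 0) /\
    (forall l, 'd F a (e l) = \sum_l' A l' l *: e l').

Definition hyperbolic eps gam T : Prop :=
  exists A, linearized_return eps gam T A /\ 2 < `|\tr A|.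

Definition has_CZ2 eps gam T (m : 'Z_2) : Prop :=
  exists A, linearized_return eps gam T A /\
    Num.sg (\det (A - 1%:M)) = (-1) ^+ (m : nat).+1.

(* the rectangle over which the two strands at the ends of r overlap *)
Definition rectangle eps r : set (R * R) :=
  [set u | (exists p q, [/\ `|p| <= eps, `|q - tip_par r| <= eps
                          & u = xy (Phi S (tip_comp r) (0, p, q))]) /\
           (exists p q, [/\ `|p| <= eps, `|q - tail_par r| <= eps
                          & u = xy (Phi S (tail_comp r) (0, p, q))])].

(* The orbit gam, of period T, has the cyclic word w 0, ..., w (n - 1): it runs
   outside N_eps, over the rectangle of w k, in the time interval ]a k, b k[,
   and through the handle at the tip of w k (i.e. at the tail of the next chord)
   in the time interval [b k, a (k + 1)]. *)
Definition orbit_word eps (gam : R -> spoint) (T : R) (n : nat)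
    (w : 'I_n -> chord R N) : Prop :=
  (forall k, is_chord (w k)) /\
  (forall k, tip_comp (w k) = tail_comp (w (ordS k))) /\
  exists a b : nat -> R,
    a n = a 0%N + T /\
    forall k : 'I_n,
      [/\ a k < b k, b k < a k.+1,
          forall t, a k < t < b k -> exists P,
            same_point eps (gam t) (None, P) /\ rectangle eps (w k) (xy P)
        & forall t, b k <= t <= a k.+1 -> exists u,
            same_point eps (gam t) (Some (tip_comp (w k)), u) /\
            handle eps (tip_comp (w k)) u].

(* theta is the total rotation angle of the tangent over the arc [q0, q1] *)
Definition total_rotation (i : 'I_N) (q0 q1 theta : R) : Prop :=
  exists phi : R -> R,
    [/\ {within `[q0, q1], continuous phi},
        forall q, q0 <= q <= q1 -> tangent i q = (cos (phi q), sin (phi q))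
      & theta = phi q1 - phi q0].

(* The arc from the tip of r to the tail of r' ends at the first lift of
   tail_par r' after tip_par r. *)
Definition theta r r' : R :=
  xget 0 [set th | total_rotation (tip_comp r) (tip_par r)
    (if tip_par r < tail_par r' then tail_par r' else tail_par r' + 1) th].

Definition rot_angle r r' : int := Num.floor (theta r r' / pi).

End Surgery.

(* Main.v *)
Require Import Defs.
From mathcomp Require Import all_boot all_order all_algebra.
From mathcomp Require Import all_classical all_reals all_analysis.
From mathcomp Require Import ring lra.
Set Implicit Arguments.
Unset Strict Implicit.
Unset Printing Implicit Defensive.
Import Order.TTheory GRing.Theory Num.Theory.
Import numFieldNormedType.Exports.
Local Open Scope classical_set_scope.
Local Open Scope ring_scope.

(** Why the theorem holds.  In every chart the Reeb field is a constant vertical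
    field, so orbits are made of vertical segments, and the whole dynamics is
    contained in the changes of charts.  A closed orbit crosses a handle from
    bottom to top, which moves it from (p, q) to (p, q + c f(p)), then rises
    along a vertical segment of R^3, and enters another handle from below.

    - Exit and entry of such a segment are points of two different strands with
      the same projection, so they lie over the rectangle of a chord; since the
      strand of the tip is the upper one over the whole rectangle
      (strand_order), the segment runs from near the tail to near the tip
      (passage).  In good position the two strands are perpendicular, and
      crossing the rectangle acts on the transverse coordinates (p, q) as a
      quarter turn with a sign (crossing_turn).
    - Within a handle the orbit goes from near the tip of one chord to near the
      tail of another one.  These endpoints differ because chords are disjoint,
      so the twist f is affine there and the handle acts by the shear of slope
      c / eps.

    The linearized return map is therefore a product of matrices of the form
    plus or minus ((x, -1), (1, 0)) with x = - c / eps, up to conjugation which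
    depends on the base point (return_from_flow_along).  When eps < 1 / 2 we have
    |x| > 2, and every such matrix maps the cone |v| <= |u| into its interior.
    So does the product, up to the product s of the signs of its factors,
    whatever the signs of the c; as its determinant is 1, this forces
    s tr > 2 (preserves_cone_turn).  Hence closed orbits are hyperbolic.

    The index is read off from det (Ret - 1) = 2 - tr, whose sign is - s.  Each
    factor contributes - c, which accounts for the Kronecker delta, times the
    sign that compares the orientations of the upper and lower strand of a
    chord.  Regrouping these orientations along the strands instead of along
    the chords gives, for two consecutive letters, the sine of the rotation
    angle from the tip of the first to the tail of the second, which is 1 or -1
    according to the parity of the rotation number (word_signE, sign2_rot). *)

(** * The shear functions f and H *)

Section Primitive.
Variable R : realType.
Notation mu := (@lebesgue_measure R).

Section CompactSupport.
Variables (h : R -> R) (M : R).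
Hypothesis (h_cont : continuous h) (h_supp : forall x, M < `|x| -> h x = 0).

Let h_restrict : h \_ `[- M, M] = h.
Proof.
apply/funext => x; rewrite patchE; case: ifPn => // /negP xM.
rewrite h_supp // ltNge; apply/negP => xM'; apply: xM.
by rewrite inE /= in_itv /= -ler_norml.
Qed.

Let h_integrable (A : set R) : measurable A -> mu.-integrable A (EFin \o h).
Proof.
move=> mA; apply: (@integrableS _ _ _ mu setT) => //.
have -> : EFin \o h = (EFin \o h) \_ `[- M, M].
  by rewrite -[in LHS]h_restrict restrict_EFin.
rewrite -integrable_mkcond //.
apply: continuous_compact_integrable; first exact: segment_compact.
exact: continuous_subspaceT.
Qed.

Definition primitive (x : R) : R := \int[mu]_(t in `]-oo, x]) h t.

Lemma primitive_deriv (x : R) : is_derive x 1 primitive (h x).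
Proof.
have xx : x < x + 1 by rewrite ltrDl.
have [|//||dF <-] := @continuous_FTC1 R h -oo%O x (x + 1) xx.
- exact: h_integrable.
- by rewrite /= ltNyr.
- exact: h_cont.
by rewrite derive1E; apply: derivableP.
Qed.

Lemma primitive_continuous : continuous primitive.
Proof.
move=> x; apply: differentiable_continuous; apply/derivable1_diffP.
by have [] := primitive_deriv x.
Qed.

Let primitive_below_lt x : x < - M -> primitive x = 0.
Proof.
move=> xM; rewrite /primitive Rintegral_mkcond.
rewrite (_ : _ \_ _ = cst 0) /Rintegral ?integral0//.
apply/funext => t; rewrite patchE; case: ifPn => //; rewrite inE /= in_itv /= => tx.
by apply: h_supp; have := ler_norm (- t); rewrite normrN; lra.
Qed.

(** At - M itself the mean value theorem applies: it samples h strictly to the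
    left of - M, where h vanishes. *)
Lemma primitive_below x : x <= - M -> primitive x = 0.
Proof.
move=> xM; have x1 : x - 1 < x by lra.
have [|c] := MVT x1 (fun y _ => primitive_deriv y).
  by apply: continuous_subspaceT; exact: primitive_continuous.
rewrite in_itv /= => /andP[_ cx]; rewrite h_supp ?mul0r; last first.
  by have := ler_norm (- c); rewrite normrN; lra.
by rewrite (primitive_below_lt (x := x - 1)) ?subr0 //; lra.
Qed.

Lemma primitive_above x : M <= x -> primitive x = \int[mu]_(t in setT) h t.
Proof.
move=> xM; rewrite /primitive Rintegral_mkcond; congr Rintegral.
apply/funext => t; rewrite patchE; case: ifPn => // /negP; rewrite inE /= in_itv /= => tx.
rewrite h_supp //; have := ler_norm t; move: tx => /negP; rewrite -ltNge; lra.
Qed.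

End CompactSupport.
End Primitive.

Lemma smooth_derivable (R : realType) (V : normedModType R) (g : R -> V) :
  smooth_on setT g ->
  (forall x : R, derivable g x 1) /\ continuous (fun x : R => derive1 g x).
Proof.
move=> /(_ 1%N) [dg cg]; split=> [x|x].
  by apply/derivable1_diffP; exact: dg.
have -> : (fun x : R => derive1 g x) = 'D_1 g by apply/funext => y; rewrite derive1E.
exact: (cg 1 x).
Qed.

Section Shear.
Variables (R : realType) (N : nat) (S : surgery R N).
Hypothesis HS : shear_functions S.
Variable eps : R.
Hypotheses (eps_gt0 : 0 < eps) (eps_lt : eps < eps0 S).
Local Notation f := (shear S eps).
Local Notation fe := (f_ S eps).
Local Notation He := (H_ S eps).

Let sf := HS eps_gt0 eps_lt.

Let f_derive (x : R) : is_derive x 1 f (derive1 f x).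
Proof.
case: sf => /smooth_derivable[df _] _.
by rewrite derive1E; exact: derivableP.
Qed.

Let f'_cont : continuous (fun x : R => derive1 f x).
Proof. by case: sf => /smooth_derivable[]. Qed.

Let f'_supp (x : R) : 1 < `|x| -> derive1 f x = 0.
Proof. by case: sf => _ [_ [_ [_ [+ _]]]]; exact. Qed.

Let f_primitive : f = primitive (derive1 f).
Proof.
apply/funext => x; apply/eqP; rewrite -subr_eq0; apply/eqP.
rewrite -[LHS]/((f - primitive (derive1 f)) x).
have d0 (y : R) : is_derive y 1 (f - primitive (derive1 f)) 0.
  have F1 := f_derive y; have F2 := primitive_deriv f'_cont f'_supp y.
  by apply: is_derive_eq; rewrite subrr.
rewrite (is_derive_0_is_cst _ (-1) d0) !fctE (primitive_below f'_cont f'_supp) //.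
by case: sf => _ [-> // _]; rewrite subr0.
Qed.

Lemma f_low p : p <= - eps -> fe p = 0.
Proof.
move=> pe; case: sf => _ [+ _]; apply.
by rewrite ler_pdivrMr // mulN1r.
Qed.

(** Both the shear and the primitive of its derivative vanish at -1, hence they
    agree, and beyond 1 the primitive has collected the total integral 1. *)
Lemma f_high p : eps <= p -> fe p = 1.
Proof.
move=> pe; case: sf => _ [_ [_ [_ [_ [f1 _]]]]].
rewrite /f_ f_primitive (primitive_above f'_supp) // ler_pdivlMr //; lra.
Qed.

Lemma f_deriv (p : R) : is_derive p 1 fe (derive1 f (p / eps) / eps).
Proof.
have -> : fe = f \o (fun x => x * eps^-1) by [].
apply: is_derive1_comp.
  exact: f_derive.
by apply: is_derive_eq; rewrite scaler0 add0r [_%:A]mulr1.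
Qed.

Lemma f_derive1 p : derive1 fe p = derive1 f (p / eps) / eps.
Proof. by rewrite derive1E; have := f_deriv p => /@derive_val. Qed.

Let h (p : R) := p * derive1 fe p.

Let h_cont : continuous h.
Proof.
have f1E : derive1 fe = fun p => derive1 f (p / eps) / eps by apply/funext => p; exact: f_derive1.
move=> p; rewrite /h f1E; apply: cvgM; first exact: cvg_id.
apply: cvgM; last exact: cvg_cst.
apply: (continuous_comp (f := fun x : R => x / eps)); last exact: f'_cont.
by apply: cvgM; [exact: cvg_id|exact: cvg_cst].
Qed.

Let h_supp p : eps < `|p| -> h p = 0.
Proof.
move=> pe; rewrite /h f_derive1 f'_supp ?mul0r ?mulr0 //.
by rewrite normrM normfV (gtr0_norm eps_gt0) ltr_pdivlMr ?mul1r.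
Qed.

Lemma H_deriv (p : R) : is_derive p 1 He (p * derive1 fe p).
Proof. exact: (primitive_deriv h_cont h_supp). Qed.

Let H_low p : p <= - eps -> He p = 0.
Proof. exact: (primitive_below h_cont h_supp). Qed.

(** The derivative p f'(p) of H is odd because f' is even; in particular H
    vanishes again at the far side p = eps of the handle. *)
Lemma H_even p : He (- p) = He p.
Proof.
pose g := He \o -%R - He.
have d0 (y : R) : is_derive y 1 g 0.
  have Hy := H_deriv y.
  have Hc : is_derive y 1 (He \o -%R) ((- y * derive1 fe (- y)) * (-1)).
    by apply: is_derive1_comp; exact: H_deriv.
  apply: is_derive_eq; rewrite !f_derive1 !mulNr; case: sf => _ [_ [-> _]].
  by rewrite mulrN1 opprK subrr.
apply/eqP; rewrite -subr_eq0; apply/eqP; rewrite -[LHS]/(g p).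
by rewrite (is_derive_0_is_cst _ 0 d0) /g !fctE /= oppr0 subrr.
Qed.

Lemma H_out p : eps <= `|p| -> He p = 0.
Proof.
case: (ger0P p) => p0 pe; last by apply: H_low; lra.
by rewrite -H_even H_low // lerN2.
Qed.

Lemma H_continuous : continuous He.
Proof.
move=> x; apply: differentiable_continuous; apply/derivable1_diffP.
by have [] := H_deriv x.
Qed.

Lemma f_derive1_ge0 p : 0 <= derive1 fe p <= eps^-1.
Proof.
rewrite f_derive1; case: sf => _ [_ [_ [/(_ (p / eps))/andP[a b] _]]].
have e0 : 0 <= eps^-1 by rewrite invr_ge0 ltW.
by apply/andP; split; [rewrite mulr_ge0|rewrite ler_piMl].
Qed.

(** Since 0 <= f' <= 1 / eps, on the left half of the handle H decreases, but
    stays above the parabola (p ^ 2 - eps ^ 2) / (2 eps), with which it agrees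
    at p = - eps. *)
Lemma H_bounds p : - (eps / 2) <= He p <= 0.
Proof.
wlog p0 : p / p <= 0.
  move=> W; case: (lerP p 0) => [|p0]; first exact: W.
  by rewrite -H_even; apply: W; lra.
case: (lerP p (- eps)) => pe; first by rewrite H_low // lexx oppr_le0 divr_ge0 // ltW.
have Hd (y : R) : derivable He y 1 by have [] := H_deriv y.
have sub : {subset `[- eps, 0] <= `]-oo, 0]}.
  by move=> y; rewrite !in_itv /= => /andP[].
have einv : 0 < eps^-1 by rewrite invr_gt0.
have e1 : - eps \in `[- eps, 0] by rewrite in_itv /= lexx oppr_le0 ltW.
have e2 : p \in `[- eps, 0] by rewrite in_itv /= ltW.
apply/andP; split; last first.
  rewrite -[leRHS](H_low (lexx _)).
  apply: (@ler0_derive1_le_cc _ He (- eps) 0) => //.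
  - move=> y /subset_itv_oo_cc /sub; rewrite in_itv /= => y0.
    rewrite derive1E (derive_val (is_derive := H_deriv y)).
    by rewrite mulr_le0_ge0 //; case/andP: (f_derive1_ge0 y).
  - by apply: continuous_subspaceT; exact: H_continuous.
  - exact: ltW.
(* the excess of H over the parabola *)
pose K (y : R) := He y - (y ^+ 2 - eps ^+ 2) / (2 * eps).
have dK (y : R) : is_derive y 1 K (y * derive1 fe y - y / eps).
  have Hy := H_deriv y.
  have -> : K = He - (2 * eps)^-1 \*: ((fun y => y ^+ 2) - cst (eps ^+ 2)).
    by apply/funext => x; rewrite /K !fctE /= mulrC.
  apply: is_derive_eq; congr (_ - _).
  rewrite subr0 [y%:A]mulr1 /GRing.scale /=; field.
  by rewrite gt_eqF.
have Kd (y : R) : derivable K y 1 by have [] := dK y.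
have : K (- eps) <= K p.
  apply: (@ger0_derive1_le_cc _ K (- eps) 0) => //.
  - move=> y /subset_itv_oo_cc /sub; rewrite in_itv /= => y0.
    rewrite derive1E (derive_val (is_derive := dK y)) -mulrBr.
    by rewrite mulr_le0 // subr_le0; case/andP: (f_derive1_ge0 y).
  - apply: continuous_subspaceT => y; apply: differentiable_continuous.
    by apply/derivable1_diffP; exact: Kd.
  - exact: ltW.
rewrite /K H_low // sqrrN subrr mul0r subr0 subr_ge0 => h1.
apply: le_trans h1; rewrite lerNl -mulNr opprB ler_pdivrMr ?mulr_gt0 //.
rewrite (_ : _ / _ * _ = eps ^+ 2); last by field.
by rewrite gerBl sqr_ge0.
Qed.

End Shear.

(** * The glued manifold *)

Section Gluing.
Variables (R : realType) (N : nat) (S : surgery R N).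
Hypothesis HS : surgery_setup S.
Variable eps : R.
Hypotheses (eps_gt0 : 0 < eps) (eps_lt : eps < eps0 S).
Local Notation fe := (f_ S eps).
Local Notation He := (H_ S eps).
Local Notation e0 := (eps0 S).
Local Notation glue := Defs.glue.
Local Notation "x ~~ y" := (same_point S eps x y) (at level 70).
Ltac elra := (pose proof eps_gt0; pose proof eps_lt; lra).
Implicit Types (i : 'I_N) (w P : triple R) (k : option 'I_N) (x y : spoint R N).

Let HSf : shear_functions S. Proof. by case: HS. Qed.

Definition ez k (s : R) : triple R := if k is Some _ then (s, 0, 0) else (0, 0, s).

Lemma coef_pm1 i : coef S i = 1 \/ coef S i = -1.
Proof. by rewrite /coef; case: ifP; [left|right]. Qed.

Lemma coefH_bound i p : `|coef S i * He p| <= eps / 2.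
Proof.
have /andP[h1 h2] := H_bounds HSf eps_gt0 eps_lt p.
by rewrite ler_norml; case: (coef_pm1 i) => ->; rewrite ?mul1r ?mulN1r; apply/andP; split; elra.
Qed.

(** The vertical shift of the gluing map is so small that the top, which is glued
    to the level eps, stays above the level 0 at which the gluing map switches
    between its two formulas. *)
Lemma coefH_bounds i p : - (eps / 2) <= coef S i * He p <= eps / 2.
Proof. by rewrite -ler_norml; exact: coefH_bound. Qed.

(** Beyond the sides of a handle the twist is a full number of turns, hence
    trivial on R / Z. *)
Lemma f_int i p : eps <= `|p| -> exists k : int, coef S i * fe p = k%:~R.
Proof.
case: (ger0P p) => p0 pe.
  rewrite (f_high HSf) // mulr1.
  by case: (coef_pm1 i) => ->; [exists 1|exists (-1)].
by exists 0; rewrite (f_low HSf) ?mulr0 //; elra.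
Qed.

Let nbhds : standard_nbhds S. Proof. by case: HS. Qed.

Lemma Phi_periodZ i z p q (k : int) : box e0 (z, p, q) ->
  Phi S i (z, p, q + k%:~R) = Phi S i (z, p, q).
Proof.
case: nbhds => _ [_ [_ [per _]]] bw.
have pern (n : nat) q' : Phi S i (z, p, q' + n%:R) = Phi S i (z, p, q').
  by elim: n q' => [|n IH] q'; rewrite ?addr0 // -addn1 natrD addrA per // IH.
case: k => n; first exact: pern.
by rewrite NegzE rmorphN /= -[LHS](pern n.+1) -pmulrn addrNK.
Qed.

Lemma Phi_mod1 i w w' : box e0 w -> w.1 = w'.1 -> eq_mod1 w.2 w'.2 ->
  Phi S i w = Phi S i w'.
Proof.
case: w w' => [[z p] q] [[z' p'] q'] /= bw [<- <-] [k ->].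
by rewrite Phi_periodZ.
Qed.

Lemma Phi_inj i i' w w' : box e0 w -> box e0 w' -> Phi S i w = Phi S i' w' ->
  [/\ i = i', w.1 = w'.1 & eq_mod1 w.2 w'.2].
Proof. by case: nbhds => _ [_ [_ [_ [+ _]]]]; exact. Qed.

Lemma Phi_vertical i z p q : box e0 (z, p, q) ->
  Phi S i (z, p, q) = Phi S i (0, p, q) + (0, 0, z).
Proof. by case: nbhds => _ [_ [_ [_ [_ [_ [+ _]]]]]]; exact. Qed.

Lemma eq_mod1_refl (q : R) : eq_mod1 q q.
Proof. by exists 0; rewrite addr0. Qed.

Lemma eq_mod1_sym (q q' : R) : eq_mod1 q q' -> eq_mod1 q' q.
Proof. by move=> [k ->]; exists (- k); rewrite rmorphN /= addrK. Qed.

Lemma eq_mod1_trans (q q' q'' : R) : eq_mod1 q q' -> eq_mod1 q' q'' -> eq_mod1 q q''.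
Proof. by move=> [k ->] [l ->]; exists (k + l); rewrite rmorphD /= addrA. Qed.

Lemma eq_mod1D (q q' r : R) : eq_mod1 q q' -> eq_mod1 (q + r) (q' + r).
Proof. by move=> [k ->]; exists k; rewrite addrAC. Qed.

Lemma glue_box i w : chart_dom S eps (Some i, w) -> box e0 (glue S eps i w).
Proof.
case: w => [[z p] q] [/= pe z1 z2]; have /andP[h1 h2] := coefH_bounds i p.
rewrite /glue /box /=; case: (ltrP 0 z) => z0 /=; rewrite (ltW pe); split => //.
  by rewrite ler_norml; apply/andP; split; elra.
by rewrite ler_norml; apply/andP; split; elra.
Qed.

Lemma handle_mod1 i w w' : w.1 = w'.1 -> handle S eps i w <-> handle S eps i w'.
Proof. by move=> h; rewrite /handle /= h. Qed.

Lemma chart_dom_mod1 i w w' : w.1 = w'.1 ->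
  chart_dom S eps (Some i, w) <-> chart_dom S eps (Some i, w').
Proof. by move=> h; rewrite /chart_dom /= h. Qed.

Lemma glue_mod1 i w w' : w.1 = w'.1 -> eq_mod1 w.2 w'.2 ->
  (glue S eps i w).1 = (glue S eps i w').1 /\
  eq_mod1 (glue S eps i w).2 (glue S eps i w').2.
Proof.
by move=> h1 h2; rewrite /glue -h1; case: ifP => _; split=> //=; exact: eq_mod1D.
Qed.

Lemma Phi_glue_mod1 i w w' : chart_dom S eps (Some i, w) ->
  w.1 = w'.1 -> eq_mod1 w.2 w'.2 ->
  Phi S i (glue S eps i w) = Phi S i (glue S eps i w').
Proof.
move=> dw h1 h2; have [g1 g2] := glue_mod1 i h1 h2.
by apply: Phi_mod1 => //; exact: glue_box.
Qed.

Lemma handle_chart i w : handle S eps i w -> chart_dom S eps (Some i, w).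
Proof.
by case=> h1 h2 h3; split; [apply: le_lt_trans h1 _| |apply: le_lt_trans h3 _] => //; elra.
Qed.

(** Near the handle the gluing map could send a point below the shifted top
    into the box that was cut out only if this point were in the handle. *)
Lemma glue_out i w : chart_dom S eps (Some i, w) -> ~ handle S eps i w ->
  ~ nbhd_link S eps (Phi S i (glue S eps i w)).
Proof.
move=> dw nh [i' [w' [bw' E]]]; apply: nh.
have bw'0 : box e0 w' by case: bw'; split; apply: le_trans (ltW eps_lt).
have [_ g1 _] := Phi_inj (glue_box dw) bw'0 E.
move: bw'; rewrite /box /= -g1 /glue; case: w dw {E g1} => [[z p] q] dw /=.
have /andP[h1 h2] := coefH_bounds i p.
case: (ltrP 0 z) => z0 /= -[]; rewrite ler_norml => /andP[a1 a2] a3; split=> //=; elra.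
Qed.

(** The two formulas of the gluing map cannot identify a point near the top with
    a point near the bottom, except beyond the sides of the handle, where they
    agree. *)
Lemma glue_inj i w w' : chart_dom S eps (Some i, w) -> chart_dom S eps (Some i, w') ->
  ~ handle S eps i w -> ~ handle S eps i w' ->
  (glue S eps i w).1 = (glue S eps i w').1 ->
  eq_mod1 (glue S eps i w).2 (glue S eps i w').2 ->
  w.1 = w'.1 /\ eq_mod1 w.2 w'.2.
Proof.
have X z p q z' q' : chart_dom S eps (Some i, (z, p, q)) ->
    chart_dom S eps (Some i, (z', p, q')) -> 0 < z -> z' <= 0 ->
    ~ handle S eps i (z, p, q) -> z - coef S i * He p = z' ->
    eq_mod1 (q + coef S i * fe p) q' -> z = z' /\ eq_mod1 q q'.
  move=> [/= d1 d2 d3] [_ /= d2' d3'] z0 z0' nh E Eq.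
  have [pe|pe] := lerP eps `|p|; last first.
    by case: nh; split => /=; [exact: ltW|elra|elra].
  have H0 := H_out HSf eps_gt0 eps_lt pe; have [k fk] := f_int i pe.
  move: E; rewrite H0 mulr0 subr0 => zz; split=> //.
  by apply: eq_mod1_trans Eq; exists k; rewrite fk.
case: w w' => [[z p] q] [[z' p'] q'] d d' nh nh'.
rewrite /glue /=; case: (ltrP 0 z) => z0; case: (ltrP 0 z') => z0' /= -[].
- move=> /[swap] <- /addIr <- E; split=> //.
  by have := eq_mod1D (- (coef S i * fe p)) E; rewrite !addrK.
- move=> E1 E2 E3; subst p'.
  by have [<- ?] := X _ _ _ _ _ d d' z0 z0' nh E1 E3.
- move=> E1 E2 E3; subst p'.
  have [<- ?] := X _ _ _ _ _ d' d z0' z0 nh' (esym E1) (eq_mod1_sym E3).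
  by split=> //; exact: eq_mod1_sym.
- by move=> -> ->.
Qed.

Lemma same_point_refl x : chart_dom S eps x -> x ~~ x.
Proof.
by case: x => [[i|] w] d; split=> //; split=> //; split=> //; exact: eq_mod1_refl.
Qed.

Lemma same_point_sym x y : x ~~ y -> y ~~ x.
Proof.
case: x y => [[i|] w] [[i'|] w'] [d [d' E]]; split=> //; split=> //.
by case: E => <- <- ?; split=> //; exact: eq_mod1_sym.
Qed.

Lemma same_point_chart i w : chart_dom S eps (Some i, w) -> ~ handle S eps i w ->
  (Some i, w) ~~ (None, Phi S i (glue S eps i w)).
Proof. by move=> d nh; do 2?split=> //; exact: glue_out. Qed.

Lemma same_point_dom x y : x ~~ y -> chart_dom S eps x /\ chart_dom S eps y.
Proof. by case=> ? []. Qed.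

Lemma same_point_trans x y z : x ~~ y -> y ~~ z -> x ~~ z.
Proof.
case: x y z => [[i|] w] [[i'|] w'] [[i''|] w''] [d [d']] /= E [_ [d'']] F; split=> //; split=> //.
- case: E F => <- e1 e2 [<- f1 f2]; split=> //; [exact: etrans f1|exact: eq_mod1_trans f2].
- case: E F => <- e1 e2 [nh ->]; split; first by rewrite (handle_mod1 i e1).
  by apply/esym; exact: Phi_glue_mod1.
- case: E F => nh -> [nh' E'].
  have [ii g1 g2] := Phi_inj (glue_box d) (glue_box d'') E'; subst i''.
  by have [e1 e2] := glue_inj d d'' nh nh' g1 g2.
- by case: E F => nh <- <-.
- case: E F => nh -> [<- f1 f2]; split; first by rewrite -(handle_mod1 i' f1).
  exact: Phi_glue_mod1.
- by case: E F => nh -> [_ ->].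
- by rewrite E.
- by rewrite E.
Qed.

End Gluing.

(** * Charts and vertical translations *)

Lemma coord_continuous (R : realType) :
  [/\ continuous (fun w : triple R => w.1.1),
      continuous (fun w : triple R => w.1.2) &
      continuous (fun w : triple R => w.2)].
Proof.
split=> w; first exact: (cvg_comp _ _ cvg_fst cvg_fst).
  exact: (cvg_comp _ _ cvg_fst cvg_snd).
exact: cvg_snd.
Qed.

Lemma triple_cvg (R : realType) (T : Type) (F : set_system T) {FF : Filter F} (f g h : T -> R) (a b c : R) :
  f t @[t --> F] --> a -> g t @[t --> F] --> b -> h t @[t --> F] --> c ->
  ((f t, g t, h t) : triple R) @[t --> F] --> ((a, b, c) : triple R).
Proof. by move=> fa gb hc; exact: (cvg_pair (cvg_pair fa gb) hc). Qed.

Section Topology.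
Variables (R : realType) (N : nat) (S : surgery R N).
Hypothesis HS : surgery_setup S.
Variable eps : R.
Hypotheses (eps_gt0 : 0 < eps) (eps_lt : eps < eps0 S).
Local Notation fe := (f_ S eps).
Local Notation He := (H_ S eps).
Local Notation e0 := (eps0 S).
Local Notation glue := Defs.glue.
Local Notation "x ~~ y" := (same_point S eps x y) (at level 70).
Local Notation ezN := (@ez R N None).
Local Notation sp_trans := (same_point_trans HS eps_gt0 eps_lt).
Ltac elra := (pose proof eps_gt0; pose proof eps_lt; lra).
Implicit Types (i : 'I_N) (w P : triple R) (k : option 'I_N) (x y : spoint R N) (s t z p q : R).

Let nbhds : standard_nbhds S. Proof. by case: HS. Qed.
Let HSf : shear_functions S. Proof. by case: HS. Qed.

Lemma ezD k s t : ez k (s + t) = ez k s + ez k t.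
Proof. by case: k => [i|] /=; congr (_, _, _); rewrite /= ?addr0. Qed.

Lemma ez0 k : ez k (0 : R) = 0.
Proof. by case: k. Qed.

Lemma ez_continuous k : continuous (fun s : R => ez k s).
Proof.
by case: k => [i|] s; apply: triple_cvg; rewrite /=; (exact: cvg_cst || exact: cvg_id).
Qed.

Lemma Phi_diff i w : box e0 w -> differentiable (Phi S i) w.
Proof.
case: nbhds => _ [/(_ i)[U [_ bU sU]] _] bw.
by have [+ _] := sU 1%N; apply; exact: bU.
Qed.

Lemma Phi_continuous i w : box e0 w -> {for w, continuous (Phi S i)}.
Proof. by move=> bw; apply: differentiable_continuous; exact: Phi_diff. Qed.

Let period_box : set (triple R) := (`[- eps, eps] `*` `[- eps, eps]) `*` `[0, 1].

Let swept (t : R) : set (triple R) :=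
  [set P | exists s, 0 <= s <= t /\ nbhd_link S eps (P + ezN s)].

Let swept_closed t : closed (swept t).
Proof.
have -> : swept t = \bigcup_(i in [set: 'I_N])
    ((fun ws => Phi S i ws.1 - ezN ws.2) @` (period_box `*` `[0, t])).
  apply/seteqP; split=> [P [s [st [i [w [[bw1 bw2] E]]]]]|P [i _ [[w s]]]].
    exists i => //; exists ((w.1, w.2 - (Num.floor w.2)%:~R), s) => /=.
      have /andP[f1 f2] := real_floor_itv (num_real w.2); rewrite intrD in f2.
      move: bw1 bw2; rewrite !ler_norml => bw1 bw2.
      do 2!split=> //=; rewrite in_itv //=; apply/andP; split; lra.
    rewrite -[P](addrK (ezN s)) E; congr (_ - _); apply/esym/Phi_mod1 => //.
      by split; apply: le_trans (ltW eps_lt).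
    by exists (- Num.floor w.2); rewrite rmorphN.
  move=> [[[]]] /=; rewrite !in_itv /= => w1 w2 w3 st <-.
  exists s; split=> //; exists i, w; split; last by rewrite subrK.
  by split; rewrite ler_norml.
apply: closed_bigcup; first exact: finite_finset.
move=> i _; apply: compact_closed; first exact: norm_hausdorff.
apply: continuous_compact; last first.
  by repeat apply: compact_setX; exact: segment_compact.
apply: continuous_in_subspaceT => -[w s]; rewrite inE => -[/= [[]]].
rewrite !in_itv /= => w1 w2 w3 st.
have bw : box e0 w by split; rewrite (le_trans _ (ltW eps_lt)) // ler_norml.
apply: (@cvgB _ _ _ (nbhs (w, s))).
  by apply: (cvg_comp _ _ cvg_fst); exact: Phi_continuous.
exact: (cvg_comp (fun ws : triple R * R => ws.2) (fun s : R => ezN s) cvg_snd (@ez_continuous None s)).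
Qed.

(** A vertical segment in a chart has a neighbourhood of such segments.
    Outside, the starting points whose segment meets the cut-out boxes form a
    closed set, because modulo the period the boxes are compact. *)
Lemma chart_dom_translate_near k a t : 0 <= t ->
  (forall s, 0 <= s <= t -> chart_dom S eps (k, a + ez k s)) ->
  \forall b \near a, forall s, 0 <= s <= t -> chart_dom S eps (k, b + ez k s).
Proof.
move=> t0; case: k => [i|] /= ha; last first.
  have : nbhs a (~` swept t).
    apply: open_nbhs_nbhs; split; first by apply: closed_openC; exact: swept_closed.
    by move=> [s [st sw]]; exact: (ha s st).
  by apply: filterS => b nb s st sw; apply: nb; exists s.
have [c1 c2 c3] := coord_continuous R.
have [|d1 d2 _] := ha 0; first by rewrite lexx.
have [|_ _ d3] := ha t; first by rewrite t0 lexx.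
rewrite /= !addr0 in d1 d2 d3.
have n1 : \forall b \near a, `|b.1.2| < e0 by exact: (cvgr_norm_lt _ (c2 a) _ d1).
have n2 : \forall b \near a, - e0 < b.1.1 by exact: (cvgr_gt _ (c1 a) _ d2).
have n3 : \forall b \near a, b.1.1 + t - coef S i * He b.1.2 < e0.
  apply: (@cvgr_lt _ _ (nbhs a) _ (fun b => b.1.1 + t - coef S i * He b.1.2) (a.1.1 + t - coef S i * He a.1.2) _ _ d3).
  apply: cvgB; first by apply: cvgD; [exact: c1|exact: cvg_cst].
  apply: cvgM; first exact: cvg_cst.
  exact: (cvg_comp (fun b : triple R => b.1.2) He (c2 a) (H_continuous HSf eps_gt0 eps_lt (x:=a.1.2))).
near=> b => s /andP[s0 st]; rewrite /= !addr0.
have b1 : `|b.1.2| < e0 by near: b.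
have b2 : - e0 < b.1.1 by near: b.
have b3 : b.1.1 + t - coef S i * He b.1.2 < e0 by near: b.
by split=> //; elra.
Unshelve. all: by end_near. Qed.

Lemma chart_dom_near k a : chart_dom S eps (k, a) ->
  \forall b \near a, chart_dom S eps (k, b).
Proof.
move=> da; have := @chart_dom_translate_near k a 0 (lexx _).
have h s : 0 <= s <= 0 -> s = 0 by move=> h; apply/eqP; rewrite eq_le andbC.
case=> [s /h ->|e e_gt0 he]; first by rewrite ez0 addr0.
by exists e => // b /he /(_ 0); rewrite lexx ez0 addr0; exact.
Qed.

Lemma not_handle_near i w : ~ handle S eps i w -> \forall b \near w, ~ handle S eps i b.
Proof.
have [c1 c2 c3] := coord_continuous R.
have [pe|pe nh] := ltrP eps `|w.1.2|.
  move=> _; have : \forall b \near w, eps < `|b.1.2| by exact: (cvgr_norm_gt _ (c2 w) _ pe).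
  by apply: filterS => b bp [/= bp' _ _]; elra.
have [z1|z1] := ltrP w.1.1 (- eps).
  have : \forall b \near w, b.1.1 < - eps by exact: (cvgr_lt _ (c1 w) _ z1).
  by apply: filterS => b bp [/= _ bp' _]; elra.
have [z2|z2] := ltrP eps (w.1.1 - coef S i * He w.1.2); last by case: nh.
have : \forall b \near w, eps < b.1.1 - coef S i * He b.1.2.
  apply: (@cvgr_gt _ _ (nbhs w) _ (fun b => b.1.1 - coef S i * He b.1.2) (w.1.1 - coef S i * He w.1.2) _ _ z2).
  apply: cvgB; first exact: c1.
  apply: cvgM; first exact: cvg_cst.
  exact: (cvg_comp (fun b : triple R => b.1.2) He (c2 w) (H_continuous HSf eps_gt0 eps_lt (x:=w.1.2))).
by apply: filterS => b bp [/= _ _ bp']; elra.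
Qed.

Lemma translate_near k (a : triple R) (Q : triple R -> Prop) : (\forall b \near a, Q b) ->
  \forall s \near (0 : R), Q (a + ez k s).
Proof.
move=> h; have : (fun s => a + ez k s) @ 0 --> a.
  rewrite -[X in _ --> X]addr0 -(ez0 k).
  by apply: cvgD; [exact: cvg_cst|exact: ez_continuous].
exact.
Qed.

Lemma Phi_translate i w s : box e0 w -> box e0 (w + ez (Some i) s) ->
  Phi S i (w + ez (Some i) s) = Phi S i w + ezN s.
Proof.
case: w => [[z p] q] b1 b2.
have -> : (z, p, q) + ez (Some i) s = (z + s, p, q).
  by congr (_, _, _); rewrite /= addr0.
rewrite (Phi_vertical HS i b1) (Phi_vertical HS i) -?addrA; last first.
  by move: b2; rewrite /box /= addr0.
by congr (_ + _); congr (_, _, _); rewrite /= ?addr0.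
Qed.

(** Beyond the sides H vanishes and f is an integer, so the shear is the
    identity modulo the period. *)
Lemma Phi_glue_side i w : chart_dom S eps (Some i, w) -> eps <= `|w.1.2| ->
  box e0 w /\ Phi S i (glue S eps i w) = Phi S i w.
Proof.
move=> d pe; have H0 := H_out HSf eps_gt0 eps_lt pe.
have bw : box e0 w.
  case: d => /= d1 d2; rewrite H0 mulr0 subr0 => d3; split; first by rewrite ler_norml !ltW.
  exact: ltW.
split=> //; apply/esym/(Phi_mod1 HS) => //; rewrite /glue; case: ifP => _ //=.
- by rewrite H0 mulr0 subr0; case: (w.1).
- by have [k ->] := f_int HS eps_gt0 eps_lt i pe; exists k.
- exact: eq_mod1_refl.
Qed.

(** Both charts express the Reeb field as a constant vertical field, and the
    gluing map commutes with vertical translations. The height 0, where its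
    formula changes, is harmless: points outside the handle at this height are
    beyond its sides. *)
Lemma same_point_translate k k' a a' : (k, a) ~~ (k', a') ->
  \forall s \near (0 : R), (k, a + ez k s) ~~ (k', a' + ez k' s).
Proof.
have X i w P : (Some i, w) ~~ (None, P) ->
    \forall s \near (0 : R), (Some i, w + ez (Some i) s) ~~ (None, P + ezN s).
  move=> [d [d' [nh E]]].
  have n1 := translate_near (Some i) (chart_dom_near d).
  have n2 := translate_near (Some i) (not_handle_near nh).
  suff n3 : \forall s \near (0 : R), P + ezN s = Phi S i (glue S eps i (w + ez (Some i) s)).
    near=> s; rewrite (_ : P + _ = Phi S i (glue S eps i (w + ez (Some i) s))); last by near: s.
    by apply: same_point_chart => //; near: s.
  have [z0|z0] := eqVneq w.1.1 0.
    have pe : eps <= `|w.1.2|.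
      have /andP[h1 h2] := coefH_bounds HS eps_gt0 eps_lt i w.1.2.
      rewrite leNgt; apply/negP => pe; apply: nh.
      by split; rewrite ?z0 ?(ltW pe) //; elra.
    rewrite E; have [bw ->] := Phi_glue_side d pe.
    near=> s; have [||bws ->] := @Phi_glue_side i (w + ez (Some i) s).
    - by near: s.
    - by rewrite /= addr0.
    by rewrite -Phi_translate.
  have n3 : \forall s \near (0 : R), (0 < w.1.1 + s) = (0 < w.1.1).
    have [c1 _ _] := coord_continuous R.
    suff : \forall b \near w, (0 < b.1.1) = (0 < w.1.1).
      exact: (@translate_near (Some i) w (fun b => (0 < b.1.1) = (0 < w.1.1))).
    case: (ltrgtP w.1.1 0) z0 => // z0 _.
      by apply: filterS (cvgr_lt _ (c1 w) _ z0) => b /= b0; rewrite ltNge ltW.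
    by apply: filterS (cvgr_gt _ (c1 w) _ z0) => b /= ->.
  near=> s; rewrite E.
  have ds : chart_dom S eps (Some i, w + ez (Some i) s) by near: s.
  have gE : glue S eps i (w + ez (Some i) s) = glue S eps i w + ez (Some i) s.
    rewrite /glue /= !addr0 (_ : 0 < _ + s = (0 < w.1.1)); last by near: s.
    by case: ifP => // _; congr (_, _, _); rewrite /= ?addr0 // addrAC.
  by rewrite gE -Phi_translate -?gE //; exact: glue_box.
move=> E0; have [d [d' E]] := E0; case: k k' a a' E0 d d' E => [i|] [i'|] a a' E0 d d' E.
- have n1 := translate_near (Some i) (chart_dom_near d).
  have n2 := translate_near (Some i') (chart_dom_near d').
  near=> s; split; first by near: s.
  split; first by near: s.
  case: E => -> e1 e2; split=> //=; last by rewrite !addr0.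
  by rewrite /GRing.add /= /Algebra.add /= e1.
- exact: X.
- by apply: filterS (X _ _ _ (same_point_sym E0)) => s /same_point_sym.
- move: E d; rewrite /= => <- d.
  by apply: filterS (translate_near None (@chart_dom_near None a d)) => s; exact: same_point_refl.
Unshelve. all: by end_near. Qed.

End Topology.

(** * Integral curves of the Reeb field *)

Section Calculus.
Variable R : realType.

Lemma near_sub (t : R) (Q : R -> Prop) :
  (\forall s \near 0, Q s) -> \forall s \near t, Q (s - t).
Proof.
move=> h; have : (fun s => s - t) @ t --> (0 : R).
  by rewrite -[X in _ --> X](subrr t); apply: cvgB; [exact: cvg_id|exact: cvg_cst].
exact.
Qed.

Lemma is_derive_linear (V W : normedModType R) (L : {linear V -> W}) (c : R -> V) (s : R) v :
  continuous L -> is_derive s 1 c v -> is_derive s 1 (L \o c) (L v).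
Proof.
move=> cL [dc cv].
have dc' : differentiable c s by apply/derivable1_diffP.
have dL : differentiable L (c s) by exact: linear_differentiable.
have dLc : differentiable (L \o c) s by exact: differentiable_comp.
apply: DeriveDef; first exact/derivable1_diffP.
by rewrite deriveE // diff_comp // diff_lin //= -cv deriveE.
Qed.

Lemma near_cst (g : R -> R) (t : R) :
  (\forall s \near t, is_derive (s : R) 1 g 0) -> \forall s \near t, g s = g t.
Proof.
move=> /nbhs_ballP[e /= e0 he].
have ge (s : R) : `|t - s| < e -> is_derive s 1 g 0 by exact: he.
have cg (s : R) : `|t - s| < e -> {for s, continuous g}.
  move=> /ge[dg _]; apply: differentiable_continuous; exact/derivable1_diffP.
exists e => //= s /= ts; have := ts; rewrite /ball /= => ts'.
have [st|st] := leP s t.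
  have [||c _] := @MVT_segment R g (fun=> 0) s t st.
  - move=> x; rewrite in_itv /= => /andP[x1 x2]; apply: ge.
    by move: ts'; rewrite !ger0_norm ?subr_ge0 ?(ltW x2) //; lra.
  - apply: continuous_in_subspaceT => x; rewrite inE /= in_itv /= => /andP[x1 x2]; apply: cg.
    by move: ts'; rewrite !ger0_norm ?subr_ge0 //; lra.
  - by rewrite mul0r => /eqP; rewrite subr_eq0 => /eqP.
have [||c _] := @MVT_segment R g (fun=> 0) t s (ltW st).
- move=> x; rewrite in_itv /= => /andP[x1 x2]; apply: ge.
  by move: ts'; rewrite !ler0_norm ?subr_le0 ?(ltW x1) ?(ltW st) //; lra.
- apply: continuous_in_subspaceT => x; rewrite inE /= in_itv /= => /andP[x1 x2]; apply: cg.
  by move: ts'; rewrite !ler0_norm ?subr_le0 ?(ltW st) //; lra.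
- by rewrite mul0r => /eqP; rewrite subr_eq0 => /eqP.
Qed.

Lemma near_affine (c : R -> triple R) (v : triple R) (t : R) :
  (\forall s \near t, is_derive (s : R) 1 c v) -> \forall s \near t, c s = c t + (s - t) *: v.
Proof.
move=> hc.
have comp (L : {linear triple R -> R}) : continuous L ->
    \forall s \near t, L (c s) = L (c t) + (s - t) * L v.
  move=> cL; pose g := L \o c - (fun s : R => s * L v).
  have hg : \forall s \near t, is_derive (s : R) 1 g 0.
    apply: filterS hc => s /(is_derive_linear cL) Ls.
    apply: is_derive_eq.
    by rewrite scaler0 add0r [X in _ - X]mulr1 subrr.
  apply: filterS (near_cst hg) => s; rewrite /g !fctE /=; lra.
have n1 := comp (fst \o fst) (fun w => let: And3 c1 _ _ := coord_continuous R in c1 w).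
have n2 := comp (snd \o fst) (fun w => let: And3 _ c1 _ := coord_continuous R in c1 w).
have n3 := comp snd (fun w => let: And3 _ _ c1 := coord_continuous R in c1 w).
near=> s; apply: injective_projections; first apply: injective_projections.
- by rewrite /=; near: s.
- by rewrite /=; near: s.
- by rewrite /=; near: s.
Unshelve. all: by end_near. Qed.

Lemma is_derive_affine (a b q0 q : R) : is_derive q 1 (fun s => a + (s - q0) * b) b.
Proof.
have -> : (fun s => a + (s - q0) * b) = cst (a - q0 * b) + (fun s => s *: (b : R^o)).
  by apply/funext => s; rewrite !fctE /GRing.scale /=; ring.
have db : is_derive q 1 (fun s : R => s *: (b : R^o)) b.
  apply: DeriveDef; first exact/derivable1_diffP.
  by rewrite deriveE // diff_val scale1r.
by apply: (is_derive_eq (is_deriveD (is_derive_cst _ _ _) db)); rewrite add0r.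
Qed.

Lemma is_derive_near_unique (f g : R -> R) (q a b : R) :
  is_derive q 1 f a -> is_derive q 1 g b -> (\forall s \near q, f s = g s) -> a = b.
Proof. by move=> [_ <-] [_ <-]; exact: near_eq_derive. Qed.

Lemma derive_affine_coord (a b : R) (x u : triple R) :
  'D_u (fun w : triple R => a + w.1.2 * b) x = u.1.2 * b.
Proof.
have dL : is_derive x u (fun w : triple R => w.1.2) u.1.2.
  pose L : {linear triple R -> R} := snd \o fst.
  have cL : continuous L by case: (coord_continuous R).
  have dL : differentiable L x by exact: linear_differentiable.
  apply: DeriveDef; first exact: diff_derivable.
  by rewrite -[LHS]/('D_u L x) deriveE // diff_lin.
have : is_derive x u (cst a + (fun w : triple R => w.1.2) * cst b) (u.1.2 * b).
  apply: (is_derive_eq (is_deriveD (is_derive_cst _ _ _) (is_deriveM dL (is_derive_cst _ _ _)))).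
  by rewrite scaler0 !add0r /GRing.scale /= mulrC.
by move=> /@derive_val.
Qed.

End Calculus.

Section Reeb.
Variables (R : realType) (N : nat) (S : surgery R N).
Hypothesis HS : surgery_setup S.
Variable eps : R.
Hypotheses (eps_gt0 : 0 < eps) (eps_lt : eps < eps0 S).
Local Notation fe := (f_ S eps).
Local Notation He := (H_ S eps).
Local Notation e0 := (eps0 S).
Local Notation glue := Defs.glue.
Local Notation "x ~~ y" := (same_point S eps x y) (at level 70).
Local Notation ezN := (@ez R N None).
Local Notation sp_trans := (same_point_trans HS eps_gt0 eps_lt).
Ltac elra := (pose proof eps_gt0; pose proof eps_lt; lra).
Implicit Types (i : 'I_N) (w P : triple R) (k : option 'I_N) (x y : spoint R N) (s t z p q : R).

(** For both contact forms the kernel of the exterior derivative is the vertical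
    direction. *)
Lemma reeb_vectorP k (a v : triple R) : reeb_vector (alpha_chart k) a v <-> v = ez k 1.
Proof.
case: k => [i|]; rewrite /reeb_vector /ext_deriv /=.
  have E (u w : triple R) : 'D_u (fun b' : triple R => alpha_nbhd b' w) a - 'D_w (fun b' : triple R => alpha_nbhd b' u) a
      = u.1.2 * w.2 - w.1.2 * u.2 by rewrite !derive_affine_coord.
  split=> [[h1 h2]|->].
    have := h2 (0, 0, 1); have := h2 (0, 1, 0); rewrite !E /alpha_nbhd /= in h1 *.
    move: h1 {h2}; case: v => [[v1 v2] v3] /= h1 h2 h3.
    have v30 : v3 = 0 by move: h2; lra.
    have v20 : v2 = 0 by move: h3; lra.
    by move: h1; rewrite v30 v20 mulr0 addr0 => ->.
  by split=> [|w]; rewrite ?E /alpha_nbhd /= ?mulr0 ?addr0 // mul0r subrr.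
have aE (w : triple R) : (fun b' : triple R => alpha_std b' w) = (fun b' => w.2 + b'.1.2 * (- w.1.1)).
  by apply/funext => x; rewrite /alpha_std mulrN.
have E (u w : triple R) : 'D_u (fun b' : triple R => alpha_std b' w) a - 'D_w (fun b' : triple R => alpha_std b' u) a
      = w.1.2 * u.1.1 - u.1.2 * w.1.1 by rewrite !aE !derive_affine_coord; lra.
split=> [[h1 h2]|->].
  have := h2 (0, 1, 0); have := h2 (1, 0, 0); rewrite !E /alpha_std /= in h1 *.
  move: h1 {h2}; case: v => [[v1 v2] v3] /= h1 h2 h3.
  have v30 : v1 = 0 by move: h3; lra.
  have v20 : v2 = 0 by move: h2; lra.
  by move: h1; rewrite v30 v20 mulr0 subr0 => ->.
by split=> [|w]; rewrite ?E /alpha_std /= ?mulr0 ?subr0 // mul0r subrr.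
Qed.

Lemma ezZ k s : s *: ez k 1 = ez k s.
Proof. by case: k => [i|]; congr (_, _, _); rewrite /= ?scaler0 // /GRing.scale /= mulr1. Qed.

(** The Reeb field is constant in every chart, so its integral curves are
    vertical line segments. *)
Lemma reeb_at_straight (gam : R -> spoint R N) t :
  reeb_at S eps gam t <->
  exists k (a : triple R), \forall s \near t, gam s ~~ (k, a + ez k (s - t)).
Proof.
split=> [[k [c h]]|[k [a h]]].
  exists k, (c t).
  have : \forall s \near t, is_derive (s : R) 1 c (ez k 1).
    by apply: filterS h => s [_ [v [dv /reeb_vectorP vE]]]; rewrite -vE.
  move=> /near_affine h2.
  near=> s; have [h3 _] : gam s ~~ (k, c s) /\
      exists v, is_derive s 1 c v /\ reeb_vector (alpha_chart k) (c s) v by near: s.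
  rewrite -ezZ (_ : c t + _ = c s) //; apply/esym; near: s; exact: h2.
exists k, (fun s => a + ez k (s - t)); apply: filterS h => s h; split=> //.
exists (ez k 1); split; last exact/reeb_vectorP.
have -> : (fun s => a + ez k (s - t)) = cst (a - ez k t) + (fun s => s *: ez k 1).
  apply/funext => r; rewrite !fctE ezZ -addrA; congr (_ + _).
  by rewrite ezD addrC -[X in _ + X]ezZ scaleNr ezZ.
have dk : is_derive s 1 (fun s : R => s *: ez k 1 : triple R) (ez k 1).
  apply: DeriveDef; first exact/derivable1_diffP.
  by rewrite deriveE // diff_val scale1r.
by apply: (is_derive_eq (is_deriveD (is_derive_cst _ _ _) dk)); rewrite add0r.
Unshelve. all: by end_near. Qed.

(** Uniqueness of the integral curve: the chart and the point that describe it
    at one time may be chosen freely. *)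
Lemma reeb_at_chart gam t k a : reeb_at S eps gam t -> gam t ~~ (k, a) ->
  \forall s \near t, gam s ~~ (k, a + ez k (s - t)).
Proof.
move=> /reeb_at_straight[k' [a' h]] ga.
have := nbhs_singleton h; rewrite subrr ez0 addr0 => ga'.
have := same_point_translate HS eps_gt0 eps_lt
  (same_point_trans HS eps_gt0 eps_lt (same_point_sym ga') ga).
move=> /(near_sub t) h2; near=> s.
apply: (same_point_trans HS eps_gt0 eps_lt (y := (k', a' + ez k' (s - t)))).
  by near: s.
by near: s; exact: h2.
Unshelve. all: by end_near. Qed.

Lemma same_chart_translate k a b s : (k, a) ~~ (k, b) ->
  chart_dom S eps (k, a + ez k s) -> (k, a + ez k s) ~~ (k, b + ez k s).
Proof.
case: k => [i|] [d [d']] /=; last by move=> ->.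
case=> _ e1 e2 ds; have e1' : (a + ez (Some i) s).1 = (b + ez (Some i) s).1.
  by rewrite /GRing.add /= /Algebra.add /= e1.
split=> //; split; first by rewrite -(chart_dom_mod1 S eps i e1').
by split=> //=; rewrite !addr0.
Qed.

(** A Reeb orbit stays on a vertical line of a chart for as long as it does not
    leave the chart. The set of times up to which this holds is open by
    uniqueness, and the hypothesis makes it closed. *)
Lemma reeb_propagate gam k c t0 t1 : t0 <= t1 ->
  (forall t, t0 <= t <= t1 -> reeb_at S eps gam t) -> gam t0 ~~ (k, c) ->
  (forall t, t0 < t <= t1 ->
    (forall s, t0 <= s < t -> gam s ~~ (k, c + ez k (s - t0))) ->
    exists c', gam t ~~ (k, c')) ->
  forall t, t0 <= t <= t1 -> gam t ~~ (k, c + ez k (t - t0)).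
Proof.
move=> t01 hr h0 hcl.
pose E := [set t | t0 <= t <= t1 /\ forall s, t0 <= s <= t -> gam s ~~ (k, c + ez k (s - t0))].
have E0 : E t0.
  split=> [|s]; first by rewrite lexx.
  by rewrite -eq_le => /eqP <-; rewrite subrr ez0 addr0.
have supE : has_sup E by split; [exists t0|exists t1 => t [/andP[]]].
pose m := sup E.
have t0m : t0 <= m by apply: ub_le_sup => //; case: supE.
have mt1 : m <= t1 by apply: ge_sup => [|t [/andP[]]]; first by exists t0.
have below s : t0 <= s < m -> gam s ~~ (k, c + ez k (s - t0)).
  move=> /andP[ts sm]; have ms : 0 < m - s by rewrite subr_gt0.
  have [e [_ Ee] se] := sup_adherent ms supE.
  by apply: Ee; rewrite ts /=; move: se; rewrite /m; lra.
have splitD (u v w' : R) : ez k (u - v) + ez k (w' - u) = ez k (w' - v).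
  by rewrite -ezD; congr ez; lra.
(* the supremum is attained: compare with a time slightly before it *)
have Em : gam m ~~ (k, c + ez k (m - t0)).
  have [<-|t0m'] := eqVneq t0 m; first by rewrite subrr ez0 addr0.
  have t0m'' : t0 < m by rewrite lt_neqAle t0m'.
  have [c' gc'] := hcl m (introT andP (conj t0m'' mt1)) below.
  have /nbhs_ballP[e /= egt0 he] := reeb_at_chart (hr m (introT andP (conj t0m mt1))) gc'.
  pose s := Num.max t0 (m - e / 2).
  have sm : t0 <= s < m by rewrite /s le_max lexx /= gt_max t0m'' /=; lra.
  have sms : `|m - s| < e.
    have : m - e / 2 <= s by rewrite /s le_max lexx orbT.
    by case/andP: sm => _ sm; rewrite ger0_norm; lra.
  have := he s sms => h1; have h2 := below s sm.
  have h3 := same_point_trans HS eps_gt0 eps_lt (same_point_sym h1) h2.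
  have := same_chart_translate (s := m - s) h3; rewrite -!addrA !splitD subrr ez0 addr0.
  move=> /(_ (same_point_dom gc').2); exact: same_point_trans.
suff -> : t1 = m.
  move=> t /andP[tt]; rewrite le_eqVlt => /orP[/eqP ->|tm] //.
  by apply: below; rewrite tt.
apply/eqP; rewrite eq_le mt1 andbT leNgt; apply/negP => mt1'.
have /nbhs_ballP[e /= egt0 he] := reeb_at_chart (hr m (introT andP (conj t0m mt1))) Em.
pose m' := Num.min t1 (m + e / 2).
have mm' : m < m' by rewrite /m' lt_min mt1' /=; lra.
have m'e : m' <= m + e / 2 by rewrite /m' ge_min lexx orbT.
have m't1 : m' <= t1 by rewrite /m' ge_min lexx.
suff : E m' by move=> /(ub_le_sup supE.2); rewrite -/m leNgt mm'.
split=> [|s /andP[s1 s2]]; first by rewrite m't1 (le_trans t0m) // ltW.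
have [sm|ms|->] := ltrgtP s m; last exact: Em.
  by apply: below; rewrite s1.
have := he s; rewrite /ball /= ltr0_norm; last by lra.
by rewrite -addrA splitD; apply; lra.
Qed.

End Reeb.

(** * The flow near an orbit and its transverse derivative *)

Section Flow.
Variables (R : realType) (N : nat) (S : surgery R N).
Hypothesis HS : surgery_setup S.
Variable eps : R.
Hypotheses (eps_gt0 : 0 < eps) (eps_lt : eps < eps0 S).
Local Notation fe := (f_ S eps).
Local Notation He := (H_ S eps).
Local Notation e0 := (eps0 S).
Local Notation glue := Defs.glue.
Local Notation "x ~~ y" := (same_point S eps x y) (at level 70).
Local Notation ezN := (@ez R N None).
Local Notation sp_trans := (same_point_trans HS eps_gt0 eps_lt).
Ltac elra := (pose proof eps_gt0; pose proof eps_lt; lra).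
Implicit Types (i : 'I_N) (w P : triple R) (k : option 'I_N) (x y : spoint R N) (s t z p q : R).

Lemma reeb_flow_translate k a t : 0 <= t ->
  (forall s, 0 <= s <= t -> chart_dom S eps (k, a + ez k s)) ->
  reeb_flow S eps t (k, a) (k, a + ez k t).
Proof.
move=> t0 ha; exists (fun s => (k, a + ez k s)); split=> [s st||]; last first.
- by apply: same_point_refl; apply: ha; rewrite t0 lexx.
- rewrite ez0 addr0; apply: same_point_refl; rewrite -[a]addr0 -(ez0 R k).
  by apply: ha; rewrite lexx t0.
apply/reeb_at_straight; exists k, (a + ez k s).
have := translate_near k (chart_dom_near HS eps_gt0 eps_lt (ha s st)).
move=> /(near_sub s); apply: filterS => r dr.
have -> : a + ez k r = a + ez k s + ez k (r - s).
  by rewrite -addrA -ezD; congr (_ + ez _ _); lra.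
exact: same_point_refl.
Qed.

Lemma reeb_flow_same x y : x ~~ y -> reeb_flow S eps 0 x y.
Proof.
case: x => k a xy; have [dx dy] := same_point_dom xy.
have [|gam [h1 h2 h3]] := @reeb_flow_translate k a 0 (lexx _).
  move=> s s0; have -> : s = 0 by apply/eqP; rewrite eq_le andbC.
  by rewrite ez0 addr0.
exists gam; split=> //.
by move: h3; rewrite ez0 addr0 => h3; exact: sp_trans xy.
Qed.

Lemma reeb_at_shift gam t r : reeb_at S eps gam t -> reeb_at S eps (fun s => gam (s - r)) (t + r).
Proof.
move=> /reeb_at_straight[k [a h]]; apply/reeb_at_straight; exists k, a.
have h2 : \forall s \near (0 : R), gam (t + s) ~~ (k, a + ez k s).
  have ct : (fun s : R => t + s) @ (0 : R) --> t.
    by rewrite -[X in _ --> X]addr0; apply: cvgD; [exact: cvg_cst|exact: cvg_id].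
  have h' : \forall s \near (0 : R), gam (t + s) ~~ (k, a + ez k (t + s - t)) by exact: (ct _ h).
  by apply: filterS h' => s; rewrite (_ : t + s - t = s) //; lra.
apply: filterS (near_sub (t + r) h2) => s.
by rewrite (_ : t + (s - (t + r)) = s - r) //; lra.
Qed.

Lemma reeb_at_near_eq gam gam' t : (\forall s \near t, gam s = gam' s) ->
  reeb_at S eps gam t -> reeb_at S eps gam' t.
Proof.
move=> h [k [c hc]]; exists k, c.
near=> s; have <- : gam s = gam' s by near: s.
by near: s; exact: hc.
Unshelve. all: by end_near. Qed.

(** At the junction both curves are straight in the same chart, so that the
    concatenation is again an integral curve there. *)
Lemma reeb_flow_trans t t' x y y' : 0 <= t -> 0 <= t' ->
  reeb_flow S eps t x y -> reeb_flow S eps t' y y' -> reeb_flow S eps (t + t') x y'.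
Proof.
move=> t0 t0' [g1 [r1 s1 e1]] [g2 [r2 s2 e2]].
have mid : g1 t ~~ g2 0 := sp_trans e1 (same_point_sym s2).
exists (fun s => if s < t then g1 s else g2 (s - t)); split; last first.
- by rewrite ltNge lerDl t0' /= (_ : t + t' - t = t') //; lra.
- have [t00|tn0] := eqVneq 0 t.
    rewrite -t00 ltxx subrr; rewrite -t00 in mid; apply: sp_trans (same_point_sym mid) _.
    exact: s1.
  by rewrite lt_neqAle tn0 t0.
move=> s /andP[s0 st].
have [ts|ts|ts] := ltrgtP s t.
- apply: (@reeb_at_near_eq g1); last by apply: r1; rewrite s0 ltW.
  by apply: filterS (lt_nbhsl ts) => r ->.
- apply: (@reeb_at_near_eq (fun s => g2 (s - t))).
    have h : \forall r \near s, t < r by exact: (@cvgr_gt R R (nbhs s) _ id s cvg_id t ts).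
    by apply: filterS h => r tr; rewrite ltNge ltW.
  by rewrite -(subrK t s); apply: reeb_at_shift; apply: r2; apply/andP; split; lra.
- subst s; apply/reeb_at_straight.
  have rt : reeb_at S eps g1 t by apply: r1; rewrite s0 lexx.
  have r0 : reeb_at S eps g2 0 by apply: r2; rewrite t0' lexx.
  have := rt => /reeb_at_straight[k [a h]]; exists k, a.
  have g1a : g1 t ~~ (k, a) by have := nbhs_singleton h; rewrite subrr ez0 addr0.
  have := reeb_at_chart HS eps_gt0 eps_lt r0 (sp_trans (same_point_sym mid) g1a).
  move=> /(near_sub t) h2; near=> r; case: ltP => _; first by near: r.
  have : g2 (r - t) ~~ (k, a + ez k (r - t - 0)) by near: r; exact: h2.
  by rewrite subr0.
Unshelve. all: by end_near. Qed.

(** Coordinates on the space of Reeb trajectories near a point of a chart; they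
    identify every contact plane with R^2. *)
Definition transverse k (v : triple R) : 'cV[R]_2 :=
  if k is Some _ then \col_j (if j == 0 then v.1.2 else v.2)
  else \col_j (if j == 0 then v.1.1 else v.1.2).

(** Besides the flow itself, only two features of its derivative are recorded:
    it preserves the contact form, and it acts by M on transverse coordinates.
    They compose easily and determine the derivative on the contact planes. *)
Definition contact_flow t x x' (M : 'M[R]_2) : Prop :=
  exists F : triple R -> triple R,
  [/\ \forall b \near x.2, reeb_flow S eps t (x.1, b) (x'.1, F b),
      F x.2 = x'.2, differentiable F x.2,
      forall v, alpha_chart x'.1 x'.2 ('d F (x.2) v) = alpha_chart x.1 x.2 v
    & forall v, transverse x'.1 ('d F (x.2) v) = M *m transverse x.1 v].

Lemma contact_flow_trans t t' x y y' M M' : 0 <= t -> 0 <= t' ->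
  contact_flow t x y M -> contact_flow t' y y' M' -> contact_flow (t + t') x y' (M' *m M).
Proof.
move=> t0 t0' [F [f1 f2 f3 f4 f5]] [G [g1 g2 g3 g4 g5]].
rewrite -f2 in g1 g2 g3 g4 g5.
exists (G \o F); split.
- have h : \forall b \near x.2, reeb_flow S eps t' (y.1, F b) (y'.1, G (F b)).
    exact: (differentiable_continuous f3 g1).
  near=> b; apply: (@reeb_flow_trans _ _ _ (y.1, F b)) => //; near: b => //.
- by [].
- exact: differentiable_comp.
- by move=> v; rewrite diff_comp //= g4 f2 f4.
- by move=> v; rewrite diff_comp //= g5 f5 mulmxA.
Unshelve. all: by end_near. Qed.

Lemma is_diff_translate (a b : triple R) : is_diff a (fun w => w + b) id.
Proof.
have -> : (fun w => w + b) = id + cst b by [].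
by apply: is_diff_eq; rewrite addr0.
Qed.

Let alpha_translate k a s v : alpha_chart k (a + ez k s) v = alpha_chart k a v.
Proof. by case: k => [i|]; rewrite /= /alpha_nbhd /alpha_std /= addr0. Qed.

Lemma contact_flow_translate k a t : 0 <= t ->
  (forall s, 0 <= s <= t -> chart_dom S eps (k, a + ez k s)) ->
  contact_flow t (k, a) (k, a + ez k t) 1%:M.
Proof.
move=> t0 ha; have dF := is_diff_translate a (ez k t).
exists (fun b => b + ez k t); split=> //=.
- apply: filterS (chart_dom_translate_near HS eps_gt0 eps_lt t0 ha) => b.
  exact: reeb_flow_translate.
- by move=> v; rewrite diff_val alpha_translate.
- by move=> v; rewrite diff_val mul1mx.
Qed.

Lemma contact_flow_mod1 i w w' : chart_dom S eps (Some i, w) ->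
  w.1 = w'.1 -> eq_mod1 w.2 w'.2 -> contact_flow 0 (Some i, w) (Some i, w') 1%:M.
Proof.
move=> dw e1 [n e2]; have dF := is_diff_translate w (0, 0, n%:~R).
exists (fun b => b + (0, 0, n%:~R)); split=> //=.
- apply: filterS (chart_dom_near HS eps_gt0 eps_lt dw) => b db.
  apply: reeb_flow_same; split=> //.
  have e : b.1 = (b + (0, 0, n%:~R)).1 by apply: injective_projections; rewrite /= addr0.
  by split; [rewrite -(chart_dom_mod1 S eps i e)|split=> //; exists n].
- by case: w w' e1 e2 {dw dF} => [[z p] q] [w1 w2] /= <- ->; congr (_, _, _); rewrite /= addr0.
- by move=> v; rewrite diff_val /alpha_nbhd e1.
- by move=> v; rewrite diff_val mul1mx.
Qed.

Definition contact_lift k (a : triple R) (u : 'cV[R]_2) : triple R :=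
  if k is Some _ then (- a.1.2 * u 1 0, u 0 0, u 1 0) else (u 0 0, u 1 0, a.1.2 * u 0 0).

Lemma contact_liftP k a v : alpha_chart k a v = 0 -> v = contact_lift k a (transverse k v).
Proof.
case: k => [i|]; case: v => [[v1 v2] v3]; rewrite /= /contact_lift /alpha_nbhd /alpha_std /= !mxE /=.
  by move=> h; congr (_, _, _); lra.
by move=> h; congr (_, _, _); lra.
Qed.

Lemma alpha_contact_lift k a u : alpha_chart k a (contact_lift k a u) = 0.
Proof. by case: k => [i|] /=; rewrite /alpha_nbhd /alpha_std /=; lra. Qed.

Lemma transverse_contact_lift k a u : transverse k (contact_lift k a u) = u.
Proof.
apply/matrixP => j l; rewrite (ord1 l) {l}.
by case: k => [i|]; rewrite mxE; case: (j =P 0) => [->//|/eqP j0];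
  congr (u _ _); apply/val_inj; case: j j0 => [[|[]]].
Qed.

(** The lifts of the two transverse unit vectors form a basis of the contact
    plane in which the linearized return map has matrix M. *)
Lemma contact_flow_return gam T x M : gam 0 ~~ x -> contact_flow T x x M ->
  linearized_return S eps gam T M.
Proof.
case: x => k a gx [F [/= f1 f2 f3 f4 f5]].
pose e (l : 'I_2) := contact_lift k a (delta_mx l 0).
have liftE (s : 'I_2 -> R) : \sum_l s l *: e l = contact_lift k a (\col_l s l).
  have o1 : lift ord0 ord0 = 1 :> 'I_2 by exact: val_inj.
  have o0 : ord0 = 0 :> 'I_2 by exact: val_inj.
  rewrite !big_ord_recl big_ord0 addr0 o1 o0 /e /contact_lift.
  by case: k {f1 f2 f3 f4 f5 gx e} => [i|]; congr (_, _, _);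
    rewrite /= !mxE /= /GRing.scale /=; ring.
exists k, a, F, e; do 4!split=> //; split; [|split] => [l|s|l].
- exact: alpha_contact_lift.
- rewrite liftE => /(congr1 (transverse k)); rewrite transverse_contact_lift => /matrixP h l.
  by have := h l 0; rewrite mxE; case: k {f1 f2 f3 f4 f5 gx e liftE h} => [i|]; rewrite !mxE /=; case: ifP.
- rewrite liftE [LHS](@contact_liftP k a); last by rewrite f4 alpha_contact_lift.
  congr contact_lift; rewrite f5 transverse_contact_lift; apply/matrixP => j j'.
  by rewrite (ord1 j') !mxE (bigD1 l) //= mxE !eqxx mulr1 big1 ?addr0 // => l' /negPf l'l; rewrite mxE l'l mulr0.
Qed.

End Flow.

(** * Strands near the chords *)

Section Strands.
Variables (R : realType) (N : nat) (S : surgery R N).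
Hypothesis HS : surgery_setup S.
Variable eps : R.
Hypotheses (eps_gt0 : 0 < eps) (eps_lt : eps < eps0 S).
Local Notation fe := (f_ S eps).
Local Notation He := (H_ S eps).
Local Notation e0 := (eps0 S).
Local Notation glue := Defs.glue.
Local Notation "x ~~ y" := (same_point S eps x y) (at level 70).
Local Notation ezN := (@ez R N None).
Local Notation sp_trans := (same_point_trans HS eps_gt0 eps_lt).
Ltac elra := (pose proof eps_gt0; pose proof eps_lt; lra).
Implicit Types (i : 'I_N) (w P : triple R) (k : option 'I_N) (x y : spoint R N) (s t z p q : R).

Let nbhds : standard_nbhds S. Proof. by case: HS. Qed.
Let link : legendrian_link S. Proof. by case: HS. Qed.
Implicit Types r : chord R N.

Lemma lam_Phi i q : lam S i q = Phi S i (0, 0, q).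
Proof. by case: nbhds => _ [_ [_ [_ [_ [_ [_ [+ _]]]]]]]; move=> ->. Qed.

Lemma box0 p q : `|p| <= e0 -> box e0 (0, p, q).
Proof. by move=> pe; split; rewrite //= normr0; case: nbhds => /ltW. Qed.

Lemma lam_derive i q : is_derive q 1 (lam S i) (derive1 (lam S i) q).
Proof.
have [/(_ i)/smooth_derivable[dl _] _] := link.
by rewrite derive1E; exact: derivableP.
Qed.

Lemma tangent_periodZ i q (n : int) : tangent S i (q + n%:~R) = tangent S i q.
Proof.
have lamZ q' : lam S i (q' + n%:~R) = lam S i q'.
  by rewrite !lam_Phi (Phi_periodZ HS) //; apply: box0; rewrite normr0; case: nbhds => /ltW.
rewrite /tangent /derive1.
have -> : (fun h : R => h^-1 *: (lam S i (h + (q + n%:~R)) - lam S i (q + n%:~R))) =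
  (fun h : R => h^-1 *: (lam S i (h + q) - lam S i q)) by apply/funext => h; rewrite addrA !lamZ.
by [].
Qed.

Lemma tangent_mod1 i q q' : eq_mod1 q q' -> tangent S i q = tangent S i q'.
Proof. by move=> [n ->]; rewrite tangent_periodZ. Qed.

Lemma tangent_unit i q : (tangent S i q).1 ^+ 2 + (tangent S i q).2 ^+ 2 = 1.
Proof. by case: link => _ [_ [_ [_]]]; exact. Qed.

Lemma tangent_derive i q :
  is_derive q 1 (fun s => (lam S i s).1.1) (tangent S i q).1 /\
  is_derive q 1 (fun s => (lam S i s).1.2) (tangent S i q).2.
Proof.
have [c1 c2 _] := coord_continuous R; split.
  exact: (is_derive_linear (L := fst \o fst) c1 (lam_derive i q)).
exact: (is_derive_linear (L := snd \o fst) c2 (lam_derive i q)).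
Qed.

Lemma tip_endpoint r : is_chord S r -> chord_endpoint S (tip_comp r) (tip_par r).
Proof. by exists r; split=> //; right. Qed.

Lemma tail_endpoint r : is_chord S r -> chord_endpoint S (tail_comp r) (tail_par r).
Proof. by exists r; split=> //; left. Qed.

Let good : good_position S. Proof. by case: HS. Qed.

(** In good position the upper strand is projected to a line of slope -1, and its
    tangent is a unit vector. *)
Lemma tip_tangent r : is_chord S r ->
  exists2 a, 2 * a ^+ 2 = 1 & tangent S (tip_comp r) (tip_par r) = (a, - a).
Proof.
move=> /good[h _]; set i := tip_comp r in h *; set q := tip_par r in h *.
have [d1 d2] := tangent_derive i q; have := tangent_unit i q.
have : is_derive q 1 ((fun s => (lam S i s).1.1) + (fun s => (lam S i s).1.2)) 0.
  apply: (@near_eq_is_derive _ _ _ (cst ((tip S r).1.1 + (tip S r).1.2))).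
  apply: filterS h => s [u]; rewrite /xy !fctE => -> /=; lra.
move=> E2; have : (tangent S i q).1 + (tangent S i q).2 = 0.
  by apply: (is_derive_near_unique (is_deriveD d1 d2) E2); exists 1 => /=.
case: (tangent S i q) => u v /= uv u2; exists u; last by congr (_, _); lra.
by move: u2; (have -> : v = - u by lra); rewrite sqrrN; lra.
Qed.

Lemma tail_tangent r : is_chord S r ->
  exists2 b, 2 * b ^+ 2 = 1 & tangent S (tail_comp r) (tail_par r) = (b, b).
Proof.
move=> /good[_ h]; set i := tail_comp r in h *; set q := tail_par r in h *.
have [d1 d2] := tangent_derive i q; have := tangent_unit i q.
have : is_derive q 1 ((fun s => (lam S i s).1.1) - (fun s => (lam S i s).1.2)) 0.
  apply: (@near_eq_is_derive _ _ _ (cst ((tail S r).1.1 - (tail S r).1.2))).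
  apply: filterS h => s [u]; rewrite /xy !fctE => -> /=; lra.
move=> E2; have : (tangent S i q).1 - (tangent S i q).2 = 0.
  by apply: (is_derive_near_unique (is_deriveB d1 d2) E2); exists 1 => /=.
case: (tangent S i q) => u v /= uv u2; exists u; last by congr (_, _); lra.
by move: u2; (have -> : v = u by lra); lra.
Qed.

Lemma strand_xy i q0 z p q : chord_endpoint S i q0 -> box e0 (z, p, q) -> `|q - q0| <= e0 ->
  (Phi S i (z, p, q)).1 =
    ((lam S i q0).1.1 + (q - q0) * (tangent S i q0).1 + p * (tangent S i q0).2,
     (lam S i q0).1.2 + (q - q0) * (tangent S i q0).2 - p * (tangent S i q0).1).
Proof.
case: nbhds => _ [_ [_ [_ [_ [_ [_ [_ [+ _]]]]]]]] ep bw qq.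
move=> /(_ i q0 ep z p q bw qq); rewrite /xy => ->.
by apply: injective_projections; rewrite /= /GRing.scale /=; lra.
Qed.

Lemma strand_xyD i q0 z p d : chord_endpoint S i q0 -> box e0 (z, p, q0 + d) -> `|d| <= e0 ->
  (Phi S i (z, p, q0 + d)).1 =
    ((lam S i q0).1.1 + d * (tangent S i q0).1 + p * (tangent S i q0).2,
     (lam S i q0).1.2 + d * (tangent S i q0).2 - p * (tangent S i q0).1).
Proof.
have dE : q0 + d - q0 = d by rewrite addrAC subrr add0r.
by move=> ep bw de; rewrite (strand_xy ep bw) dE.
Qed.

(** Along the part of the strand on which the projection is affine, the tangent
    is constant. *)
Lemma tangent_near i q0 q : chord_endpoint S i q0 -> `|q - q0| < e0 ->
  tangent S i q = tangent S i q0.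
Proof.
move=> ep qq; have e0_gt0 : 0 < e0 by case: nbhds.
have nq : \forall s \near q, `|s - q0| < e0.
  have cq : (fun s => s - q0) @ q --> q - q0 by apply: cvgB; [exact: cvg_id|exact: cvg_cst].
  exact: (cvgr_norm_lt _ cq _ qq).
have [d1 d2] := tangent_derive i q.
have E s : `|s - q0| < e0 -> (lam S i s).1 =
    ((lam S i q0).1.1 + (s - q0) * (tangent S i q0).1, (lam S i q0).1.2 + (s - q0) * (tangent S i q0).2).
  move=> sq; rewrite lam_Phi (strand_xy ep) ?ltW //; last by apply: box0; rewrite normr0 ltW.
  by congr (_, _); rewrite mul0r ?addr0 ?subr0.
apply: injective_projections.
  by apply: (is_derive_near_unique d1 (is_derive_affine _ _ q0 q)); apply: filterS nq => s /E ->.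
by apply: (is_derive_near_unique d2 (is_derive_affine _ _ q0 q)); apply: filterS nq => s /E ->.
Qed.

Lemma near_tip_tangent r i q : is_chord S r -> near_tip eps r i q ->
  tangent S i q = tangent S (tip_comp r) (tip_par r).
Proof.
move=> hr [-> [n nq]]; rewrite -(tangent_periodZ _ _ n).
by apply: tangent_near; [exact: tip_endpoint|elra].
Qed.

Lemma near_tail_tangent r i q : is_chord S r -> near_tail eps r i q ->
  tangent S i q = tangent S (tail_comp r) (tail_par r).
Proof.
move=> hr [-> [n nq]]; rewrite -(tangent_periodZ _ _ n).
by apply: tangent_near; [exact: tail_endpoint|elra].
Qed.

(** Good position separates the two kinds of ends: upper strands have slope -1
    over the rectangles and lower strands have slope 1. *)
Lemma not_near_tip_tail r r' i q q' : is_chord S r -> is_chord S r' ->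
  near_tip eps r i q -> near_tail eps r' i q' -> ~ eq_mod1 q q'.
Proof.
move=> hr hr' h h' /(tangent_mod1 i).
rewrite (near_tip_tangent hr h) (near_tail_tangent hr' h').
have [a a2 ->] := tip_tangent hr; have [b b2 ->] := tail_tangent hr'.
by move=> [ab ab']; (have a0 : a = 0 by lra); move: a2; rewrite a0 expr0n /=; lra.
Qed.

Lemma Phi_lift i p q (n : int) : `|p| <= e0 -> Phi S i (0, p, q + n%:~R) = Phi S i (0, p, q).
Proof. by move=> pe; apply: (Phi_periodZ HS); exact: box0. Qed.

(** The two strands over a rectangle are perpendicular, so that the position
    along one of them is the transverse coordinate of the other. *)
Lemma crossing_coords r p q p' q' : is_chord S r ->
  `|p| <= e0 -> `|q - tip_par r| <= e0 -> `|p'| <= e0 -> `|q' - tail_par r| <= e0 ->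
  xy (Phi S (tip_comp r) (0, p, q)) = xy (Phi S (tail_comp r) (0, p', q')) ->
  `|q - tip_par r| = `|p'| /\ `|q' - tail_par r| = `|p|.
Proof.
move=> hr pe qe pe' qe'; rewrite /xy.
rewrite (strand_xy (tip_endpoint hr) (box0 q pe) qe) (strand_xy (tail_endpoint hr) (box0 q' pe') qe').
have [_ _ + _] := hr; rewrite /xy /tip /tail => ->.
have [a a2 ->] := tip_tangent hr; have [b b2 ->] := tail_tangent hr => /= -[e1 e2].
set Q := q - tip_par r in qe e1 e2 *; set Q' := q' - tail_par r in qe' e1 e2 *.
have ab : a ^+ 2 = b ^+ 2 by lra.
have a0 : a != 0 by apply/eqP => a0; move: a2; rewrite a0 expr0n /=; lra.
have e3 : a * Q = b * p' by lra.
have e4 : a * p = - b * Q' by lra.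
have /eqP := ab; rewrite eqf_sqr => /orP[/eqP ab'|/eqP ab']; rewrite -?ab' in e3 e4.
  move/(mulfI a0): e3 => ->; split=> //.
  by (have : a * p = a * - Q' by move: e4; lra); move=> /(mulfI a0) ->; rewrite normrN.
have ba : b = - a by rewrite ab' opprK.
rewrite ba in e3 e4; split.
  by (have : a * Q = a * - p' by move: e3; lra); move=> /(mulfI a0) ->; rewrite normrN.
by (have : a * p = a * Q' by move: e4; lra); move=> /(mulfI a0) ->.
Qed.

(** Over a rectangle the strand of the tip stays above the strand of the tail:
    this holds at the chord itself, and along a segment from there the two
    strands cannot exchange their heights, since their tubes are disjoint and
    they have different tangents. *)
Lemma strand_order r i i' p q p' q' : is_chord S r -> `|p| <= eps -> `|p'| <= eps ->
  near_tip e0 r i q -> near_tail e0 r i' q' ->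
  xy (Phi S i (0, p, q)) = xy (Phi S i' (0, p', q')) ->
  [/\ near_tip eps r i q, near_tail eps r i' q' &
      (Phi S i' (0, p', q')).2 < (Phi S i (0, p, q)).2].
Proof.
move=> hr pe pe' [-> [n nq]] [-> [n' nq']] E.
have pe0 := le_trans pe (ltW eps_lt); have pe0' := le_trans pe' (ltW eps_lt).
rewrite -(Phi_lift _ _ n pe0) -(Phi_lift _ _ n' pe0') in E *.
have [c1 c2] := crossing_coords hr pe0 nq pe0' nq' E.
split; [by split=> //; exists n; rewrite c1|by split=> //; exists n'; rewrite c2|].
set Q := q + n%:~R in nq E c1 *; set Q' := q' + n'%:~R in nq' E c2 *.
(* The affine formulas keep the two points over each other when their
   positions are contracted towards the chord by the factor s. *)
pose qs s := tip_par r + s * (Q - tip_par r).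
pose qs' s := tail_par r + s * (Q' - tail_par r).
have bnd s (u v : R) : s \in `[0, 1] -> `|u| <= v -> `|s * u| <= v.
  rewrite in_itv /= => /andP[s0 s1] uv; rewrite normrM (ger0_norm s0).
  by apply: le_trans uv; rewrite ler_piMl.
have qsE s : qs s - tip_par r = s * (Q - tip_par r) by rewrite /qs addrAC subrr add0r.
have qsE' s : qs' s - tail_par r = s * (Q' - tail_par r) by rewrite /qs' addrAC subrr add0r.
pose w s : triple R := (0, s * p, qs s); pose w' s : triple R := (0, s * p', qs' s).
pose h s := (Phi S (tip_comp r) (w s)).2 - (Phi S (tail_comp r) (w' s)).2.
have xyE s : s \in `[0, 1] -> xy (Phi S (tip_comp r) (w s)) = xy (Phi S (tail_comp r) (w' s)).
  move=> s01; move: E; rewrite /xy /w /w'.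
  have b1 := bnd _ _ _ s01 pe0; have b2 := bnd _ _ _ s01 pe0'.
  have q1 := bnd _ _ _ s01 nq; have q2 := bnd _ _ _ s01 nq'.
  rewrite (strand_xy (tip_endpoint hr) (box0 Q pe0) nq) (strand_xy (tail_endpoint hr) (box0 Q' pe0') nq').
  rewrite (strand_xyD (tip_endpoint hr) (box0 _ b1) q1) (strand_xyD (tail_endpoint hr) (box0 _ b2) q2).
  have : (lam S (tail_comp r) (tail_par r)).1 = (lam S (tip_comp r) (tip_par r)).1 by case: hr.
  case: (lam S (tip_comp r) (tip_par r)) => L1 z1; case: (lam S (tail_comp r) (tail_par r)) => L2 z2 /=.
  move: (tangent _ _ _) (tangent _ _ _) => v1 v2.
  move=> -> [f1 f2].
  by congr (_, _); [have := congr1 ( *%R s) f1|have := congr1 ( *%R s) f2]; lra.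
have hn0 s : s \in `[0, 1] -> h s <> 0.
  move=> s01 /eqP; rewrite subr_eq0 => /eqP h0.
  have b1 := bnd _ _ _ s01 pe0; have b2 := bnd _ _ _ s01 pe0'.
  have EP : Phi S (tip_comp r) (w s) = Phi S (tail_comp r) (w' s).
    by apply: injective_projections => //; exact: xyE.
  have [ii _ qq] := Phi_inj HS (box0 _ b1) (box0 _ b2) EP.
  have nt : near_tip eps r (tip_comp r) (qs s).
    by split=> //; exists 0; rewrite addr0 (qsE s); apply: bnd; rewrite ?c1.
  have nt' : near_tail eps r (tip_comp r) (qs' s).
    by split=> //; exists 0; rewrite addr0 (qsE' s); apply: bnd; rewrite ?c2.
  exact: (not_near_tip_tail hr hr nt nt').
have ch : {within `[0, 1], continuous h}.
  apply: continuous_in_subspaceT => s; rewrite inE /= => s01.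
  have cl (c d : R) : (fun s : R => c + s * d) @ s --> c + s * d.
    by apply: cvgD; [exact: cvg_cst|apply: cvgM; [exact: cvg_id|exact: cvg_cst]].
  have cl0 (d : R) : (fun s : R => s * d) @ s --> s * d.
    by apply: cvgM; [exact: cvg_id|exact: cvg_cst].
  have cw : w @ s --> w s by apply: triple_cvg; [exact: cvg_cst|exact: cl0|exact: cl].
  have cw' : w' @ s --> w' s by apply: triple_cvg; [exact: cvg_cst|exact: cl0|exact: cl].
  have P1 := Phi_continuous HS (i := tip_comp r) (box0 (qs s) (bnd _ _ _ s01 pe0)).
  have P2 := Phi_continuous HS (i := tail_comp r) (box0 (qs' s) (bnd _ _ _ s01 pe0')).
  apply: (@cvgB _ _ _ (nbhs s)).
    exact: (cvg_comp _ _ (cvg_comp _ _ cw P1) cvg_snd).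
  exact: (cvg_comp _ _ (cvg_comp _ _ cw' P2) cvg_snd).
have w1 : w 1 = (0, p, Q) by rewrite /w /qs !mul1r addrC subrK.
have w1' : w' 1 = (0, p', Q') by rewrite /w' /qs' !mul1r addrC subrK.
rewrite -w1 -w1' -subr_gt0 -/(h 1) ltNge; apply/negP => h1.
have h0 : 0 < h 0.
  by rewrite /h /w /w' /qs /qs' !mul0r !addr0 -!lam_Phi subr_gt0; case: hr.
have [|c c01 hc] := IVT (v := 0) (ler01 : 0 <= (1 : R)) ch; last exact: hn0 c01 hc.
by rewrite ge_min h1 orbT le_max ltW.
Qed.

End Strands.

(** * Planar linear algebra and differentials of the strands *)

Section Matrices.
Variable R : realType.

Definition mx2 (a b c d : R) : 'M[R]_2 :=
  \matrix_(i, j) (if i == 0 then if j == 0 then a else b else if j == 0 then c else d).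

Lemma ord2P (j : 'I_2) : j = 0 \/ j = 1.
Proof. by case: j => [[|[]] // ?]; [left|right]; exact: val_inj. Qed.

Lemma mx2_mul a b c d a' b' c' d' : mx2 a b c d *m mx2 a' b' c' d' =
  mx2 (a * a' + b * c') (a * b' + b * d') (c * a' + d * c') (c * b' + d * d').
Proof.
have o1 : lift ord0 ord0 = 1 :> 'I_2 by exact: val_inj.
apply/matrixP => i j; rewrite !mxE !big_ord_recl big_ord0 addr0 o1 !mxE /=.
by case: (ord2P i) => ->; case: (ord2P j) => ->.
Qed.

Lemma mx2_1 : mx2 1 0 0 1 = 1%:M.
Proof.
by apply/matrixP => i j; rewrite !mxE; case: (ord2P i) => ->; case: (ord2P j) => ->.
Qed.

Lemma mx2_E (A : 'M[R]_2) : A = mx2 (A 0 0) (A 0 1) (A 1 0) (A 1 1).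
Proof.
by apply/matrixP => i j; rewrite !mxE; case: (ord2P i) => ->; case: (ord2P j) => ->.
Qed.

Lemma mx2_tr a b c d : \tr (mx2 a b c d) = a + d.
Proof.
have o1 : lift ord0 ord0 = 1 :> 'I_2 by exact: val_inj.
by rewrite /mxtrace !big_ord_recl big_ord0 addr0 o1 !mxE.
Qed.

Lemma mx2_det a b c d : \det (mx2 a b c d) = a * d - b * c.
Proof.
rewrite (expand_det_row _ 0) !big_ord_recl big_ord0 addr0 /cofactor !det_mx11 !mxE /=.
by rewrite expr0 expr1 mul1r mulN1r mulrN.
Qed.

End Matrices.

Section Differentials.
Variable R : realType.

Lemma derive_linear_comp (V U W : normedModType R) (L : {linear U -> W}) (F : V -> U) (w u : V) :
  continuous L -> differentiable F w -> 'D_u (L \o F) w = L ('d F w u).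
Proof.
move=> cL dF; have dL : differentiable L (F w) by exact: linear_differentiable.
have dLF : differentiable (L \o F) w by exact: differentiable_comp.
by rewrite (deriveE _ dLF) (diff_comp dF dL) (diff_lin _ cL).
Qed.

Lemma derive_affine (V W : normedModType R) (L : {linear V -> W}) (a : W) (w u : V) :
  continuous L -> 'D_u (fun b => a + L b) w = L u.
Proof.
move=> cL; have dL : differentiable L w by exact: linear_differentiable.
have dLa : is_derive w u (cst a + L) (L u).
  have : is_derive w u L (L u).
    by apply: DeriveDef; [exact: diff_derivable|rewrite (deriveE _ dL) (diff_lin _ cL)].
  by move=> ?; apply: is_derive_eq; rewrite add0r.
exact: (@derive_val _ _ _ _ _ _ _ dLa).
Qed.

Lemma diff_near_affine (V U W : normedModType R) (L : {linear U -> W}) (L' : {linear V -> W})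
    (F : V -> U) (a : W) (w u : V) :
  continuous L -> continuous L' -> differentiable F w ->
  (\forall b \near w, L (F b) = a + L' b) -> L ('d F w u) = L' u.
Proof.
move=> cL cL' dF h.
rewrite -(derive_linear_comp u cL dF) -(derive_affine a w u cL').
exact: near_eq_derive.
Qed.

Lemma diff_compE (V U W : normedModType R) (F : U -> W) (g dg : V -> U) (w u : V) :
  is_diff w g dg -> differentiable F (g w) -> 'd (F \o g) w u = 'd F (g w) (dg u).
Proof.
by move=> hg dF; have dg' : differentiable g w by []; rewrite (diff_comp dg' dF) diff_val.
Qed.

Lemma diff_cancel (V U : normedModType R) (F : V -> U) (G : U -> V) (P u : V) (w : U) :
  differentiable F P -> differentiable G w -> F P = w ->
  (\forall Q \near P, G (F Q) = Q) -> 'd G w ('d F P u) = u.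
Proof.
move=> dF dG Fw h; rewrite -Fw in dG *.
have dGF : differentiable (G \o F) P by exact: differentiable_comp.
have -> : 'd G (F P) ('d F P u) = 'd (G \o F) P u by rewrite (diff_comp dF dG).
by rewrite -(deriveE _ dGF) -[RHS](derive_id P); exact: near_eq_derive.
Qed.

Lemma is_diff_linear (V W : normedModType R) (L : {linear V -> W}) (w : V) :
  continuous L -> is_diff w L L.
Proof.
by move=> cL; apply: DiffDef; [exact: linear_differentiable|rewrite diff_lin].
Qed.

Lemma is_diff_slice (g : R -> R) (g' : R) (w : triple R) : is_derive w.1.2 1 g g' ->
  is_diff w (fun b : triple R => g b.1.2) (fun u => u.1.2 * g').
Proof.
move=> [dg vg]; have [_ c2 _] := coord_continuous R.
have d2 := is_diff_linear (L := snd \o fst) w c2.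
have dg' : is_diff (w.1.2) g (fun s => s *: g').
  apply: DiffDef; first exact/derivable1_diffP.
  by rewrite deriv1E // derive1E vg.
exact: is_diff_comp d2 dg'.
Qed.

End Differentials.

Section ChartChanges.
Variables (R : realType) (N : nat) (S : surgery R N).
Hypothesis HS : surgery_setup S.
Variable eps : R.
Hypotheses (eps_gt0 : 0 < eps) (eps_lt : eps < eps0 S).
Local Notation fe := (f_ S eps).
Local Notation He := (H_ S eps).
Local Notation e0 := (eps0 S).
Local Notation glue := Defs.glue.
Local Notation "x ~~ y" := (same_point S eps x y) (at level 70).
Local Notation ezN := (@ez R N None).
Local Notation sp_trans := (same_point_trans HS eps_gt0 eps_lt).
Ltac elra := (pose proof eps_gt0; pose proof eps_lt; lra).
Implicit Types (i : 'I_N) (w P : triple R) (k : option 'I_N) (x y : spoint R N) (s t z p q : R).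

Let nbhds : standard_nbhds S. Proof. by case: HS. Qed.

(** The derivative of (p, q) |-> (x, y) along a strand with unit tangent v. *)
Definition frame (v : R * R) : 'M[R]_2 := mx2 v.2 v.1 (- v.1) v.2.
Definition frame_inv (v : R * R) : 'M[R]_2 := mx2 v.2 (- v.1) v.1 v.2.

Lemma frame_invK v : v.1 ^+ 2 + v.2 ^+ 2 = 1 -> frame_inv v *m frame v = 1%:M.
Proof.
by move=> v1; rewrite mx2_mul -mx2_1 -v1; congr mx2; ring.
Qed.

Let box_near w : `|w.1.1| < e0 -> `|w.1.2| < e0 -> \forall b \near w, box e0 b.
Proof.
have [c1 c2 c3] := coord_continuous R => h1 h2.
near=> b; split; apply: ltW; near: b.
  exact: (cvgr_norm_lt _ (c1 w) _ h1).
exact: (cvgr_norm_lt _ (c2 w) _ h2).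
Unshelve. all: by end_near. Qed.

Let q_near w (c d : R) : `|w.2 + c| < d -> \forall b \near w, `|b.2 + c| < d.
Proof.
have [_ _ c3] := coord_continuous R => h1.
have cq : (fun b : triple R => b.2 + c) @ w --> w.2 + c by apply: cvgD; [exact: c3|exact: cvg_cst].
exact: (cvgr_norm_lt _ cq _ h1).
Qed.

Lemma Phi_transverse i q0 w (n : int) (u : triple R) : chord_endpoint S i q0 ->
  `|w.1.1| < e0 -> `|w.1.2| < e0 -> `|w.2 + (n%:~R - q0)| < e0 ->
  transverse (@None 'I_N) ('d (Phi S i) w u) = frame (tangent S i q0) *m transverse (Some i) u.
Proof.
move=> ep h1 h2 h3; have [c1 c2 c3] := coord_continuous R.
have dP : differentiable (Phi S i) w by apply: (Phi_diff HS); split; exact: ltW.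
set v := tangent S i q0; set X := (lam S i q0).1.
have xyE : \forall b \near w, (Phi S i b).1 =
    (X.1 + (n%:~R - q0) * v.1 + (v.2 * b.1.2 + v.1 * b.2),
     X.2 + (n%:~R - q0) * v.2 + (- v.1 * b.1.2 + v.2 * b.2)).
  have xyb b : box e0 b -> `|b.2 + (n%:~R - q0)| < e0 -> (Phi S i b).1 =
    (X.1 + (n%:~R - q0) * v.1 + (v.2 * b.1.2 + v.1 * b.2),
     X.2 + (n%:~R - q0) * v.2 + (- v.1 * b.1.2 + v.2 * b.2)).
    case: b => [[z p] q] /= bb bq.
    rewrite -(Phi_periodZ HS i n bb) (strand_xy HS ep) //; last by rewrite -addrA ltW.
    by congr (_, _); rewrite -/v -/X; ring.
  by near=> b; apply: xyb; near: b; [exact: box_near|exact: q_near].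
have cL (a b : R) : continuous (fun w : triple R => a *: w.1.2 + b *: w.2).
  by move=> w'; apply: cvgD; apply: cvgZr; [exact: c2|exact: c3].
have E1 : ('d (Phi S i) w u).1.1 = v.2 * u.1.2 + v.1 * u.2.
  apply: (@diff_near_affine _ _ _ _ (fst \o fst) ((v.2 \*: (snd \o fst)) \+ (v.1 \*: snd))
    _ (X.1 + (n%:~R - q0) * v.1)); [exact: c1|exact: cL|exact: dP|].
  by apply: filterS xyE => b /= ->.
have E2 : ('d (Phi S i) w u).1.2 = - v.1 * u.1.2 + v.2 * u.2.
  apply: (@diff_near_affine _ _ _ _ (snd \o fst) ((- v.1 \*: (snd \o fst)) \+ (v.2 \*: snd))
    _ (X.2 + (n%:~R - q0) * v.2)); [exact: c2|exact: cL|exact: dP|].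
  by apply: filterS xyE => b /= ->.
have o1 : lift ord0 ord0 = 1 :> 'I_2 by exact: val_inj.
apply/matrixP => j l; rewrite !mxE !big_ord_recl big_ord0 addr0 o1 !mxE /=.
by rewrite E1 E2; case: (ord2P j) => ->.
Unshelve. all: by end_near. Qed.

Lemma Phi_alpha i w u : box e0 w ->
  alpha_std (Phi S i w) ('d (Phi S i) w u) = alpha_nbhd w u.
Proof. by case: nbhds => _ [_ [_ [_ [_ [+ _]]]]]; exact. Qed.

End ChartChanges.

(** * Changes of charts along an orbit *)

Section Crossings.
Variables (R : realType) (N : nat) (S : surgery R N).
Hypothesis HS : surgery_setup S.
Variable eps : R.
Hypotheses (eps_gt0 : 0 < eps) (eps_lt : eps < eps0 S).
Local Notation fe := (f_ S eps).
Local Notation He := (H_ S eps).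
Local Notation e0 := (eps0 S).
Local Notation glue := Defs.glue.
Local Notation "x ~~ y" := (same_point S eps x y) (at level 70).
Local Notation ezN := (@ez R N None).
Local Notation sp_trans := (same_point_trans HS eps_gt0 eps_lt).
Ltac elra := (pose proof eps_gt0; pose proof eps_lt; lra).
Implicit Types (i : 'I_N) (w P : triple R) (k : option 'I_N) (x y : spoint R N) (s t z p q : R).

Let HSf : shear_functions S. Proof. by case: HS. Qed.

(** At the top of a handle the change of charts is the shear followed by the
    embedding of the strand. It preserves the contact form because H' = p f'. *)
Lemma exit_flow i q0 w (n : int) : chord_endpoint S i q0 ->
  0 < w.1.1 -> `|w.1.2| < e0 -> eps < w.1.1 - coef S i * He w.1.2 < e0 ->
  `|w.2 + coef S i * fe w.1.2 + (n%:~R - q0)| < e0 ->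
  contact_flow S eps 0 (Some i, w) (None, Phi S i (glue S eps i w))
    (frame (tangent S i q0) *m mx2 1 0 (coef S i * derive1 fe w.1.2) 1).
Proof.
move=> ep z0 pe /andP[z1 z2] qe; set c := coef S i in z1 z2 qe *.
pose g (b : triple R) : triple R := (b.1.1 - c * He b.1.2, b.1.2, b.2 + c * fe b.1.2).
have gE b : 0 < b.1.1 -> glue S eps i b = g b by rewrite /glue => ->.
pose dg (u : triple R) : triple R :=
  (u.1.1 - c * (u.1.2 * (w.1.2 * derive1 fe w.1.2)), u.1.2, u.2 + c * (u.1.2 * derive1 fe w.1.2)).
have [c1 c2 c3] := coord_continuous R.
have isdg : is_diff w g dg.
  have d1 := is_diff_linear (L := fst \o fst) w c1.
  have d2 := is_diff_linear (L := snd \o fst) w c2.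
  have d3 := is_diff_linear (L := snd) w c3.
  have dH := is_diff_slice (H_deriv HSf eps_gt0 eps_lt w.1.2).
  have df : is_diff w (fun b : triple R => fe b.1.2) (fun u => u.1.2 * derive1 fe w.1.2).
    by apply: is_diff_slice; rewrite (f_derive1 HSf eps_gt0 eps_lt); exact: f_deriv.
  exact: (is_diff_pair (is_diff_pair (is_diffB d1 (is_diffZ c dH)) d2) (is_diffD d3 (is_diffZ c df))).
have b0 : box e0 (g w).
  by split; [rewrite /= ler_norml; apply/andP; split; elra|exact: ltW].
have dP := Phi_diff HS i b0.
have dgw : differentiable g w by exact: ex_diff.
have dE (u : triple R) : 'd (Phi S i \o g) w u = 'd (Phi S i) (g w) (dg u).
  exact: diff_compE isdg dP.
exists (Phi S i \o g); split=> /=.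
- have n1 : \forall b \near w, 0 < b.1.1 by exact: (cvgr_gt _ (c1 w) _ z0).
  have n2 : \forall b \near w, chart_dom S eps (Some i, b).
    by apply: (chart_dom_near HS eps_gt0 eps_lt); split=> //; elra.
  have n3 : \forall b \near w, ~ handle S eps i b.
    by apply: (not_handle_near HS eps_gt0 eps_lt) => -[_ _ /=]; rewrite leNgt z1.
  near=> b; rewrite -gE; last by near: b.
  by apply: reeb_flow_same => //; apply: (same_point_chart HS eps_gt0 eps_lt); near: b.
- by rewrite gE.
- exact: differentiable_comp.
- move=> u; rewrite dE gE // (Phi_alpha HS) // /alpha_nbhd /=; ring.
- move=> u; rewrite dE; have h1 : `|(g w).1.1| < e0 by rewrite /= ltr_norml; apply/andP; split; elra.
  apply: (etrans (Phi_transverse HS (w := g w) (n := n) (dg u) ep h1 pe qe)).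
  rewrite -mulmxA; congr (_ *m _); have o1 : lift ord0 ord0 = 1 :> 'I_2 by exact: val_inj.
  apply/matrixP => j l; rewrite !mxE !big_ord_recl big_ord0 addr0 o1 !mxE /=.
  by case: (ord2P j) => -> /=; ring.
Unshelve. all: by end_near. Qed.

(** Over a rectangle the embedding of a strand has an explicit inverse: its
    projection is affine in (p, q), and the height determines z. The derivative
    of this inverse need not be computed, it is inverse to that of the
    embedding. *)
Lemma entry_flow i q0 w : chord_endpoint S i q0 ->
  - e0 < w.1.1 < - eps -> `|w.1.2| < e0 -> `|w.2 - q0| < e0 ->
  contact_flow S eps 0 (None, Phi S i w) (Some i, w) (frame_inv (tangent S i q0)).
Proof.
move=> ep /andP[z1 z2] pe qe.
have [c1 c2 c3] := coord_continuous R.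
have v1 := tangent_unit HS i q0; set v := tangent S i q0 in v1 *; set X := (lam S i q0).1.
pose pq (P : triple R) := (v.2 * (P.1.1 - X.1) - v.1 * (P.1.2 - X.2),
  q0 + (v.1 * (P.1.1 - X.1) + v.2 * (P.1.2 - X.2))).
pose E (P : triple R) : triple R := (0, (pq P).1, (pq P).2).
pose F (P : triple R) : triple R := (P.2 - (Phi S i (E P)).2, (pq P).1, (pq P).2).
have bw : box e0 w by split; [rewrite /= ler_norml; apply/andP; split; elra|exact: ltW].
have xyw : (Phi S i w).1 = (X.1 + (w.2 - q0) * v.1 + w.1.2 * v.2, X.2 + (w.2 - q0) * v.2 - w.1.2 * v.1).
  by case: w bw qe {z1 z2 pe} => [[z p] q] bw qe; rewrite (strand_xy HS ep) ?ltW.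
have pqw : pq (Phi S i w) = (w.1.2, w.2).
  rewrite /pq xyw /=; congr (_, _).
    by transitivity (w.1.2 * (v.1 ^+ 2 + v.2 ^+ 2)); [ring|rewrite v1 mulr1].
  by transitivity (q0 + (w.2 - q0) * (v.1 ^+ 2 + v.2 ^+ 2)); [ring|rewrite v1; ring].
have Ew : E (Phi S i w) = (0, w.1.2, w.2) by rewrite /E pqw.
have b0 : box e0 (E (Phi S i w)) by rewrite Ew; apply: (box0 HS); exact: ltW.
have Fw : F (Phi S i w) = w.
  rewrite /F pqw Ew; case: w bw {z1 z2 pe qe xyw pqw Ew b0} => [[z p] q] bw.
  by rewrite (Phi_vertical HS i bw) /= addrC addKr.
have aff (a b d : R) (P : triple R) : differentiable (fun P : triple R => a + (b * P.1.1 + d * P.1.2)) P.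
  have -> : (fun P : triple R => a + (b * P.1.1 + d * P.1.2)) = 
    cst a + ((b \*: (fst \o fst) : triple R -> R) + (d \*: (snd \o fst) : triple R -> R)) by [].
  apply: differentiableD => //; apply: differentiableD; apply: differentiableZ.
    exact: (linear_differentiable (f := fst \o fst) _ c1).
  exact: (linear_differentiable (f := snd \o fst) _ c2).
have dpq1 P : differentiable (fun P => (pq P).1) P.
  have -> : (fun P => (pq P).1) = (fun P => (- v.2 * X.1 + v.1 * X.2) + (v.2 * P.1.1 + (- v.1) * P.1.2)).
    by apply/funext => b; rewrite /pq /=; ring.
  exact: aff.
have dpq2 P : differentiable (fun P => (pq P).2) P.
  have -> : (fun P => (pq P).2) = (fun P => (q0 - v.1 * X.1 - v.2 * X.2) + (v.1 * P.1.1 + v.2 * P.1.2)).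
    by apply/funext => b; rewrite /pq /=; ring.
  exact: aff.
have dE P : differentiable E P.
  by apply: differentiable_pair => //; apply: differentiable_pair.
have dF : differentiable F (Phi S i w).
  apply: differentiable_pair => //; apply: differentiable_pair => //.
  apply: differentiableB; first exact: (linear_differentiable (f := snd) _ c3).
  apply: (differentiable_comp (f := Phi S i \o E) (g := snd)).
    by apply: differentiable_comp => //; exact: (Phi_diff HS).
  exact: (linear_differentiable (f := snd) _ c3).
have near_pull (Q : triple R -> Prop) : (\forall b \near w, Q b) -> \forall P \near Phi S i w, Q (F P).
  by rewrite -{1}Fw => h; exact: (differentiable_continuous dF h).
have n1 : \forall P \near Phi S i w, chart_dom S eps (Some i, F P).
  apply: (near_pull (fun b => chart_dom S eps (Some i, b))); apply: (chart_dom_near HS eps_gt0 eps_lt).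
  have /andP[h1 h2] := coefH_bounds HS eps_gt0 eps_lt i w.1.2.
  by split=> //; elra.
have n2 : \forall P \near Phi S i w, (F P).1.1 < - eps.
  by apply: (near_pull (fun b => b.1.1 < - eps)); exact: (cvgr_lt _ (c1 w) _ z2).
have n3 : \forall P \near Phi S i w, `|(F P).2 - q0| < e0.
  apply: (near_pull (fun b => `|b.2 - q0| < e0)).
  have cq : (fun b : triple R => b.2 - q0) @ w --> w.2 - q0 by apply: cvgB; [exact: c3|exact: cvg_cst].
  exact: (cvgr_norm_lt _ cq _ qe).
have FK P : chart_dom S eps (Some i, F P) -> (F P).1.1 < - eps -> `|(F P).2 - q0| < e0 ->
    Phi S i (F P) = P.
  move=> d1 d2 d3; have bF : box e0 (F P).
    have := glue_box HS eps_gt0 eps_lt d1; rewrite /glue ifF //.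
    by apply/negbTE; rewrite -leNgt; elra.
  have -> : F P = ((F P).1.1, (pq P).1, (pq P).2) by [].
  rewrite (Phi_vertical HS i bF); apply: injective_projections; last first.
    by rewrite /= addrC subrK.
  rewrite -[LHS]/((Phi S i (E P)).1 + (0, 0)) addr0.
  rewrite /E (strand_xy HS ep) //; [|by apply: (box0 HS); case: bF|exact: ltW].
  rewrite -/v -/X /pq /=; case: P {d1 d2 d3 bF} => [[a b] d] /=; congr (_, _).
    by transitivity (X.1 + (a - X.1) * (v.1 ^+ 2 + v.2 ^+ 2)); [ring|rewrite v1; ring].
  by transitivity (X.2 + (b - X.2) * (v.1 ^+ 2 + v.2 ^+ 2)); [ring|rewrite v1; ring].
have dw := Phi_diff HS i bw.
have chain (u : triple R) : 'd (Phi S i) w ('d F (Phi S i w) u) = u.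
  apply: diff_cancel dF dw Fw _.
  near=> P; apply: FK; by near: P.
exists F; split=> //=.
- near=> P; have P1 : chart_dom S eps (Some i, F P) by near: P.
  have P2 : (F P).1.1 < - eps by near: P.
  have P3 : `|(F P).2 - q0| < e0 by near: P.
  apply: reeb_flow_same => //; apply: same_point_sym.
  have gF : glue S eps i (F P) = F P by rewrite /glue ifF //; apply/negbTE; rewrite -leNgt; elra.
  have := same_point_chart HS eps_gt0 eps_lt P1; rewrite gF FK //; apply.
  by case=> _ + _; rewrite leNgt P2.
- move=> u; apply: etrans (esym (Phi_alpha HS i ('d F (Phi S i w) u) bw)) _.
  exact: (congr1 (alpha_std (Phi S i w)) (chain u)).
- move=> u; have h1 : `|w.1.1| < e0 by rewrite ltr_norml; apply/andP; split; elra.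
  have h3 : `|w.2 + (0%:~R - q0)| < e0 by rewrite add0r.
  have PT := Phi_transverse HS (w := w) (n := 0) ('d F (Phi S i w) u) ep h1 pe h3.
  have {}PT := etrans (esym (congr1 (transverse (@None 'I_N)) (chain u))) PT.
  apply: etrans (esym (congr1 (mulmx (frame_inv v)) PT)).
  by rewrite mulmxA frame_invK // mul1mx.
Unshelve. all: by end_near. Qed.

End Crossings.

(** * From one handle to the next *)

Section Transit.
Variables (R : realType) (N : nat) (S : surgery R N).
Hypothesis HS : surgery_setup S.
Variable eps : R.
Hypotheses (eps_gt0 : 0 < eps) (eps_lt : eps < eps0 S).
Local Notation fe := (f_ S eps).
Local Notation He := (H_ S eps).
Local Notation e0 := (eps0 S).
Local Notation glue := Defs.glue.
Local Notation "x ~~ y" := (same_point S eps x y) (at level 70).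
Local Notation ezN := (@ez R N None).
Local Notation sp_trans := (same_point_trans HS eps_gt0 eps_lt).
Ltac elra := (pose proof eps_gt0; pose proof eps_lt; lra).
Implicit Types (i : 'I_N) (w P : triple R) (k : option 'I_N) (x y : spoint R N) (s t z p q : R).

Implicit Types r : chord R N.

Let handle_same i i' w w' : (Some i, w) ~~ (Some i', w') -> handle S eps i w -> handle S eps i' w'.
Proof. by move=> [_ [_ /= [<- e _]]] /(handle_mod1 S eps i e). Qed.

Lemma not_handle_out i w P : (Some i, w) ~~ (None, P) -> ~ handle S eps i w.
Proof. by move=> [_ [_ /= []]]. Qed.

Lemma same_outside P P' : (None : option 'I_N, P) ~~ (None, P') -> P = P'.
Proof. by move=> [_ []]. Qed.

Section Orbit.
Variable gam : R -> spoint R N.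
Hypothesis hr : forall t, reeb_at S eps gam t.

Definition inside i t : Prop := exists u, gam t ~~ (Some i, u) /\ handle S eps i u.
Definition outside t : Prop := exists P, gam t ~~ (None, P).

Lemma inside_not_outside i t : inside i t -> ~ outside t.
Proof.
move=> [u [h1 h2]] [P h3].
exact: (not_handle_out (sp_trans (same_point_sym h1) h3)).
Qed.

Lemma reeb_ball t k a : gam t ~~ (k, a) ->
  exists2 e : R, 0 < e & forall d, `|d| < e -> gam (t + d) ~~ (k, a + ez k d).
Proof.
move=> /(reeb_at_chart HS eps_gt0 eps_lt (hr t))/nbhs_ballP[e /= e_gt0 he].
exists e => // d de; have dE : t + d - t = d by rewrite addrC addKr.
by have := he (t + d); rewrite dE; apply; rewrite /ball /= -normrN opprB dE.
Qed.

(** While it is in a handle the orbit moves up a vertical line, so it can only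
    leave through the top and the next handle can only be entered through the
    bottom. Comparing the two descriptions of the vertical segment in between
    shows that the entry lies straight above the exit. *)
Lemma transit (t0 ta tb : R) i i' w0 w' (p := w0.1.2) (q1 := w0.2 + coef S i * fe w0.1.2) :
  t0 <= ta -> ta < tb -> gam t0 ~~ (Some i, w0) ->
  (forall t, t0 <= t <= ta -> inside i t) -> (forall t, ta < t < tb -> outside t) ->
  gam tb ~~ (Some i', w') -> handle S eps i' w' ->
  [/\ forall t, t0 <= t <= ta -> gam t ~~ (Some i, w0 + ez (Some i) (t - t0)),
      [/\ `|p| <= eps, - eps <= w0.1.1, w0.1.1 + (ta - t0) - coef S i * He p = eps,
          w'.1.1 = - eps & `|w'.1.2| <= eps],
      forall t, ta < t < tb -> gam t ~~ (None, Phi S i (eps, p, q1) + ezN (t - ta)) &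
      Phi S i' w' = Phi S i (eps, p, q1) + ezN (tb - ta)].
Proof.
move=> t0a tab g0 gin gout gb hb.
have gt t : t0 <= t <= ta -> gam t ~~ (Some i, w0 + ez (Some i) (t - t0)).
  apply: (reeb_propagate HS eps_gt0 eps_lt t0a) => // s /andP[s1 s2] _.
  by have [|u [h _]] := gin s; [rewrite ltW|exists u].
have inh t : t0 <= t <= ta -> handle S eps i (w0 + ez (Some i) (t - t0)).
  move=> tt; have [u [h1 h2]] := gin t tt.
  exact: handle_same (sp_trans (same_point_sym h1) (gt t tt)) h2.
have ta' : t0 <= ta <= ta by rewrite t0a lexx.
have t0' : t0 <= t0 <= ta by rewrite t0a lexx.
have [pe z2 z3] := inh ta ta'; rewrite /= addr0 -/p in pe z2 z3.
have [_ z0 _] := inh t0 t0'; rewrite /= subrr addr0 in z0.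
have [e egt0 he] := reeb_ball (gt ta ta').
have up d : 0 < d -> d < e -> d < tb - ta ->
    ~ handle S eps i (w0 + ez (Some i) (ta - t0 + d)) /\
    gam (ta + d) ~~ (Some i, w0 + ez (Some i) (ta - t0 + d)).
  move=> d0 de dt; have := he d; rewrite gtr0_norm // -addrA -ezD => /(_ de) hd.
  split=> // hh; have [|P hP] := gout (ta + d); first by apply/andP; split; lra.
  exact: not_handle_out (sp_trans (same_point_sym hd) hP) hh.
(* Were the orbit strictly below the top at time ta, it would be in the handle
   a little later. *)
have top : w0.1.1 + (ta - t0) - coef S i * He p = eps.
  apply/eqP; rewrite eq_le z3 leNgt; apply/negP => h4.
  set X := w0.1.1 + (ta - t0) - coef S i * He p in z3 h4.
  pose d := Num.min (e / 2) (Num.min ((tb - ta) / 2) (eps - X)).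
  have d1 : d <= e / 2 by rewrite /d ge_min lexx.
  have d2 : d <= (tb - ta) / 2 by rewrite /d !ge_min lexx orbT.
  have d3 : d <= eps - X by rewrite /d !ge_min lexx !orbT.
  have d0 : 0 < d by rewrite /d !lt_min !divr_gt0 ?subr_gt0.
  have [||hn _] := up d d0; [lra|lra|].
  by apply: hn; rewrite /X in d3 *; split; rewrite /= ?addr0 -/p //; lra.
have gN t : ta < t < tb -> gam t ~~ (None, Phi S i (eps, p, q1) + ezN (t - ta)).
  move=> /andP[tt1 tt2].
  pose d := Num.min (e / 2) (Num.min ((t - ta) / 2) ((e0 - eps) / 2)).
  have d1 : d <= e / 2 by rewrite /d ge_min lexx.
  have d2 : d <= (t - ta) / 2 by rewrite /d !ge_min lexx orbT.
  have d3 : d <= (e0 - eps) / 2 by rewrite /d !ge_min lexx !orbT.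
  have d0 : 0 < d by rewrite /d !lt_min !divr_gt0 ?subr_gt0.
  have [||hn hd] := up d d0; [lra|lra|].
  have dom := (same_point_dom hd).2.
  have h1 := sp_trans hd (same_point_chart HS eps_gt0 eps_lt dom hn).
  have gE : glue S eps i (w0 + ez (Some i) (ta - t0 + d)) = (eps, p, q1) + ez (Some i) d.
    rewrite /glue /= ifT; last first.
      by have /andP[] := coefH_bounds HS eps_gt0 eps_lt i p; elra.
    have zE : w0.1.1 + (ta - t0 + d) - coef S i * He w0.1.2 = eps + d.
      by rewrite -/p; lra.
    by rewrite !addr0 zE; congr (_, _, _); rewrite /= addr0.
  have b0 : box e0 (eps, p, q1).
    by split; rewrite /= ?(gtr0_norm eps_gt0); elra.
  have b1 := glue_box HS eps_gt0 eps_lt dom; rewrite gE in b1 h1.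
  rewrite (Phi_translate HS b0 b1) in h1.
  have tad : ta + d <= t by lra.
  have h2 s : ta + d < s <= t -> (forall s', ta + d <= s' < s ->
      gam s' ~~ (None, Phi S i (eps, p, q1) + ezN d + ezN (s' - (ta + d)))) ->
      exists P, gam s ~~ (None, P).
    by move=> /andP[s1 s2] _; apply: gout; apply/andP; split; lra.
  have := reeb_propagate HS eps_gt0 eps_lt tad (fun t _ => hr t) h1 h2 (t := t).
  by rewrite tad lexx -addrA -ezD (_ : d + (t - (ta + d)) = t - ta) //; [exact|lra].
have [e' e'gt0 he'] := reeb_ball gb.
have [pe' z1' z2'] := hb.
have down d : 0 < d -> d < e' -> d < tb - ta ->
    ~ handle S eps i' (w' + ez (Some i') (- d)) /\
    gam (tb - d) ~~ (Some i', w' + ez (Some i') (- d)).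
  move=> d0 de dt; have := he' (- d); rewrite normrN gtr0_norm // => /(_ de) hd.
  split=> // hh; have [|P hP] := gout (tb - d); first by apply/andP; split; lra.
  exact: not_handle_out (sp_trans (same_point_sym hd) hP) hh.
(* Were the orbit strictly above the bottom at time tb, it would have been in
   the handle a little earlier. *)
have bot : w'.1.1 = - eps.
  apply/eqP; rewrite eq_le z1' andbT leNgt; apply/negP => h4.
  pose d := Num.min (e' / 2) (Num.min ((tb - ta) / 2) (w'.1.1 + eps)).
  have d1 : d <= e' / 2 by rewrite /d ge_min lexx.
  have d2 : d <= (tb - ta) / 2 by rewrite /d !ge_min lexx orbT.
  have d3 : d <= w'.1.1 + eps by rewrite /d !ge_min lexx !orbT.
  have d0 : 0 < d by rewrite /d !lt_min !divr_gt0 ?subr_gt0 //; lra.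
  have [||hn _] := down d d0; [lra|lra|].
  by apply: hn; split; rewrite /= ?addr0 //; lra.
split=> //.
pose d := Num.min (e' / 2) (Num.min ((tb - ta) / 2) ((e0 - eps) / 2)).
have d1 : d <= e' / 2 by rewrite /d ge_min lexx.
have d2 : d <= (tb - ta) / 2 by rewrite /d !ge_min lexx orbT.
have d3 : d <= (e0 - eps) / 2 by rewrite /d !ge_min lexx !orbT.
have d0 : 0 < d by rewrite /d !lt_min !divr_gt0 ?subr_gt0.
have [||hn hd] := down d d0; [lra|lra|].
have dom := (same_point_dom hd).2.
have h1 := sp_trans hd (same_point_chart HS eps_gt0 eps_lt dom hn).
have gE : glue S eps i' (w' + ez (Some i') (- d)) = w' + ez (Some i') (- d).
  by rewrite /glue ifF //; apply/negbTE; rewrite -leNgt /= bot; elra.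
have b1 := glue_box HS eps_gt0 eps_lt dom; rewrite gE in b1 h1.
have b0 : box e0 w' by split; rewrite ?bot ?normrN ?(gtr0_norm eps_gt0); elra.
rewrite (Phi_translate HS b0 b1) in h1.
have := same_outside (sp_trans (same_point_sym h1) (gN (tb - d) _)).
have -> : ta < tb - d < tb by apply/andP; split; lra.
move=> /(_ isT) h3; rewrite -[LHS](addrK (ezN (- d))) h3 -addrA; congr (_ + _).
have -> : - ezN (- d) = ezN d by congr (_, _, _); rewrite /= ?oppr0 ?opprK.
by rewrite -ezD; congr ez; lra.
Qed.

End Orbit.
End Transit.

(** * The linearized flow of a passage *)

Section Passage.
Variables (R : realType) (N : nat) (S : surgery R N).
Hypothesis HS : surgery_setup S.
Variable eps : R.
Hypotheses (eps_gt0 : 0 < eps) (eps_lt : eps < eps0 S).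
Local Notation fe := (f_ S eps).
Local Notation He := (H_ S eps).
Local Notation e0 := (eps0 S).
Local Notation glue := Defs.glue.
Local Notation "x ~~ y" := (same_point S eps x y) (at level 70).
Local Notation ezN := (@ez R N None).
Local Notation sp_trans := (same_point_trans HS eps_gt0 eps_lt).
Ltac elra := (pose proof eps_gt0; pose proof eps_lt; lra).
Implicit Types (i : 'I_N) (w P : triple R) (k : option 'I_N) (x y : spoint R N) (s t z p q : R).

Implicit Types r : chord R N.
Let nbhds : standard_nbhds S. Proof. by case: HS. Qed.
Let HSf : shear_functions S. Proof. by case: HS. Qed.

Section Splitting.
Variable gam : R -> spoint R N.

(** Stating the factorization of the linearized flow at every intermediate time
    makes it possible to base the return map at any point of a closed orbit. *)
Definition flow_along t0 t1 x0 x1 (M : 'M[R]_2) : Prop :=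
  forall t, t0 <= t <= t1 -> exists x A B,
    [/\ gam t ~~ x, contact_flow S eps (t - t0) x0 x A,
        contact_flow S eps (t1 - t) x x1 B & B *m A = M].

Lemma flow_along_flow t0 t1 x0 x1 (M : 'M[R]_2) : t0 <= t1 -> flow_along t0 t1 x0 x1 M ->
  contact_flow S eps (t1 - t0) x0 x1 M.
Proof.
move=> t01 h; have [|x [A [B [_ fA fB <-]]]] := h t0; first by rewrite lexx.
have -> : t1 - t0 = t0 - t0 + (t1 - t0) by lra.
by apply: (contact_flow_trans HS eps_gt0 eps_lt) fA fB; rewrite ?subrr ?subr_ge0.
Qed.

Lemma flow_along_trans t0 t1 t2 x0 x1 x2 (M M' : 'M[R]_2) : t0 <= t1 -> t1 <= t2 ->
  flow_along t0 t1 x0 x1 M -> flow_along t1 t2 x1 x2 M' -> flow_along t0 t2 x0 x2 (M' *m M).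
Proof.
move=> t01 t12 hM hM' t /andP[tt1 tt2]; have [tt|tt] := leP t t1.
  have [|x [A [B [gx fA fB <-]]]] := hM t; first by rewrite tt1.
  exists x, A, (M' *m B); split=> //; last by rewrite mulmxA.
  have -> : t2 - t = t1 - t + (t2 - t1) by lra.
  by apply: (contact_flow_trans HS eps_gt0 eps_lt) fB (flow_along_flow t12 hM'); rewrite subr_ge0.
have [|x [A [B [gx fA fB <-]]]] := hM' t; first by rewrite ltW.
exists x, (A *m M), B; split=> //; last by rewrite mulmxA.
have -> : t - t0 = t1 - t0 + (t - t1) by lra.
by apply: (contact_flow_trans HS eps_gt0 eps_lt) (flow_along_flow t01 hM) fA; rewrite subr_ge0 // ltW.
Qed.

Lemma flow_along_chart t0 t1 k a : t0 <= t1 ->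
  (forall t, t0 <= t <= t1 -> gam t ~~ (k, a + ez k (t - t0))) ->
  flow_along t0 t1 (k, a) (k, a + ez k (t1 - t0)) 1%:M.
Proof.
move=> t01 h t /andP[tt1 tt2]; exists (k, a + ez k (t - t0)), 1%:M, 1%:M.
have dom s : t0 <= s <= t1 -> chart_dom S eps (k, a + ez k (s - t0)) by move=> /h/same_point_dom[].
split; first by apply: h; rewrite tt1.
- apply: (contact_flow_translate HS eps_gt0 eps_lt); first by rewrite subr_ge0.
  move=> s /andP[s1 s2]; have -> : s = t0 + s - t0 by lra.
  by apply: dom; apply/andP; split; lra.
- have -> : a + ez k (t1 - t0) = a + ez k (t - t0) + ez k (t1 - t).
    by rewrite -addrA -ezD; congr (_ + ez _ _); lra.
  apply: (contact_flow_translate HS eps_gt0 eps_lt); first by rewrite subr_ge0.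
  move=> s /andP[s1 s2]; rewrite -addrA -ezD; have -> : t - t0 + s = t + s - t0 by lra.
  by apply: dom; apply/andP; split; lra.
- by rewrite mul1mx.
Qed.

Lemma flow_along_jump t x y (M : 'M[R]_2) : gam t ~~ x -> contact_flow S eps 0 x y M ->
  flow_along t t x y M.
Proof.
move=> gx fM s; rewrite -eq_le => /eqP <-; exists x, 1%:M, M; split=> //; last by rewrite mulmx1.
  rewrite subrr; case: x gx {fM} => k a /same_point_dom[_ dx].
  have := contact_flow_translate HS eps_gt0 eps_lt (k := k) (a := a) (lexx 0).
  rewrite ez0 addr0; apply=> s' /andP[s1 s2]; have -> : s' = 0 by lra.
  by rewrite ez0 addr0.
by rewrite subrr.
Qed.

End Splitting.

Lemma above_handle i w d (q1 := w.2 + coef S i * fe w.1.2) : `|w.1.2| <= eps ->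
  w.1.1 - coef S i * He w.1.2 = eps -> 0 < d -> d < e0 - eps ->
  [/\ chart_dom S eps (Some i, w + ez (Some i) d), ~ handle S eps i (w + ez (Some i) d) &
    Phi S i (glue S eps i (w + ez (Some i) d)) = Phi S i (eps, w.1.2, q1) + ezN d].
Proof.
move=> pe top d0 d1; have /andP[h1 h2] := coefH_bounds HS eps_gt0 eps_lt i w.1.2.
have dom : chart_dom S eps (Some i, w + ez (Some i) d) by split; rewrite /= ?addr0 //; elra.
have nh : ~ handle S eps i (w + ez (Some i) d) by case=> _ _ /=; rewrite addr0; elra.
split=> //; have gE : glue S eps i (w + ez (Some i) d) = (eps, w.1.2, q1) + ez (Some i) d.
  rewrite /glue /= ifT; last by elra.
  have zE : w.1.1 + d - coef S i * He w.1.2 = eps + d by lra.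
  by rewrite !addr0 zE; congr (_, _, _); rewrite /= addr0.
have b0 : box e0 (eps, w.1.2, q1) by split; rewrite /= ?(gtr0_norm eps_gt0); elra.
by have b1 := glue_box HS eps_gt0 eps_lt dom; rewrite gE in b1 *; exact: Phi_translate.
Qed.

Lemma below_handle i w d : `|w.1.2| <= eps -> w.1.1 = - eps -> 0 < d -> d < e0 - eps ->
  [/\ chart_dom S eps (Some i, w + ez (Some i) (- d)), ~ handle S eps i (w + ez (Some i) (- d)),
    glue S eps i (w + ez (Some i) (- d)) = w + ez (Some i) (- d) &
    Phi S i (w + ez (Some i) (- d)) = Phi S i w + ezN (- d)].
Proof.
move=> pe bot d0 d1; have /andP[h1 h2] := coefH_bounds HS eps_gt0 eps_lt i w.1.2.
have dom : chart_dom S eps (Some i, w + ez (Some i) (- d)).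
  by split; rewrite /= ?addr0 ?bot //; elra.
have nh : ~ handle S eps i (w + ez (Some i) (- d)) by case=> _ /= + _; rewrite bot; elra.
have gE : glue S eps i (w + ez (Some i) (- d)) = w + ez (Some i) (- d).
  by rewrite /glue ifF //; apply/negbTE; rewrite -leNgt /= bot; elra.
split=> //.
have b0 : box e0 w by split; rewrite ?bot ?normrN ?(gtr0_norm eps_gt0); elra.
by have b1 := glue_box HS eps_gt0 eps_lt dom; rewrite gE in b1; exact: Phi_translate.
Qed.

(** Chords which share an endpoint are equal because distinct chords are
    disjoint, but the two ends of a single chord are distinct points. *)
Lemma tip_neq_tail r r' : is_chord S r -> is_chord S r' -> tip_comp r = tail_comp r' ->
  tip_par r <> tail_par r'.
Proof.
move=> hr hr' cc pp; have E : tip S r = tail S r' by rewrite /tip /tail cc pp.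
have [/= _ _ xy1 z1] := hr; have [/= _ _ xy2 z2] := hr'.
have [rr|rr] := EM (r = r'); first by move: z1; rewrite E -rr ltxx.
have gen : chord_generic S by case: HS.
have := gen.2 r r' hr hr' rr; rewrite -subset0 => /(_ (tip S r)); apply; split.
  by split; [exact: esym|rewrite lexx ltW].
by rewrite E; split; rewrite ?lexx ?ltW.
Qed.

(** The transverse linear map from the exit at the lower strand over r to the
    entry at the upper one. *)
Definition crossing_mx r : 'M[R]_2 :=
  frame_inv (tangent S (tip_comp r) (tip_par r)) *m frame (tangent S (tail_comp r) (tail_par r)).

Definition shear_mx i : 'M[R]_2 := mx2 1 0 (coef S i / eps) 1.

(** The exit and the entry lie over each other on different strands, hence over
    the rectangle of a chord r. The entry is the higher one, so it is near the
    tip of r. If the previous entry is near the tip of r0, the twist of the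
    handle has carried it from there to the tail of r, which is a different
    endpoint; hence the twist is affine where the orbit passes, with slope
    1 / eps. *)
Lemma passage gam (t0 ta tb : R) i i' w0 w'
    (q1 := w0.2 + coef S i * fe w0.1.2) :
  (forall t, reeb_at S eps gam t) ->
  t0 <= ta -> ta < tb -> gam t0 ~~ (Some i, w0) ->
  (forall t, t0 <= t <= ta -> inside S eps gam i t) ->
  (forall t, ta < t < tb -> outside S eps gam t) ->
  gam tb ~~ (Some i', w') -> handle S eps i' w' ->
  exists r w, [/\ [/\ is_chord S r, near_tail eps r i q1 & near_tip eps r i' w.2],
    [/\ gam tb ~~ (Some i', w), handle S eps i' w & w.1.1 = - eps],
    [/\ `|w0.1.2| <= eps, xy (Phi S i (0, w0.1.2, q1)) = xy (Phi S i' (0, w.1.2, w.2)) &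
      forall t P, ta < t < tb -> gam t ~~ (None, P) -> xy P = xy (Phi S i (0, w0.1.2, q1))] &
    forall r0, is_chord S r0 -> near_tip eps r0 i w0.2 ->
      flow_along gam t0 tb (Some i, w0) (Some i', w) (crossing_mx r *m shear_mx i)].
Proof.
move=> hr t0a tab g0 gin gout gb hb.
have [gt [pe z0 top bot pe'] gN glueE] := transit HS eps_gt0 eps_lt hr t0a tab g0 gin gout gb hb.
have pe0 := le_trans pe (ltW eps_lt); have pe0' := le_trans pe' (ltW eps_lt).
have bw' : box e0 w' by split; rewrite ?bot ?normrN ?(gtr0_norm eps_gt0); elra.
have b0 : box e0 (eps, w0.1.2, q1) by split; rewrite /= ?(gtr0_norm eps_gt0); elra.
have lift : Phi S i' (0, w'.1.2, w'.2) = Phi S i (0, w0.1.2, q1) + ezN (tb - ta + 2 * eps).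
  have e1 : Phi S i' w' = Phi S i' (0, w'.1.2, w'.2) + ezN (- eps).
    by rewrite -bot; case: w' bw' {gb hb bot pe' glueE pe0'} => [[? ?] ?] bw'; rewrite (Phi_vertical HS i' bw').
  rewrite -[LHS](addrK (ezN (- eps))) -e1 glueE (Phi_vertical HS i b0).
  have -> : - ezN (- eps) = ezN eps by congr (_, _, _); rewrite /= ?oppr0 ?opprK.
  rewrite -[(0, 0, eps)]/(ezN eps) -!addrA -!ezD; congr (_ + ez _ _); lra.
have xyE : xy (Phi S i (0, w0.1.2, q1)) = xy (Phi S i' (0, w'.1.2, w'.2)).
  by rewrite lift /xy /= addr0.
have hgt : (Phi S i (0, w0.1.2, q1)).2 < (Phi S i' (0, w'.1.2, w'.2)).2.
  by rewrite lift /=; elra.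
have [r [hcr nr]] : exists r, is_chord S r /\
    (near_tip e0 r i q1 /\ near_tail e0 r i' w'.2 \/ near_tail e0 r i q1 /\ near_tip e0 r i' w'.2).
  case: nbhds => _ [_ [_ [_ [_ [_ [_ [_ [_ overlap]]]]]]]].
  apply: (overlap i i' w0.1.2 w'.1.2 q1 w'.2 pe0 pe0' xyE) => -[ii pp qq].
  by move: hgt; rewrite -ii -pp (Phi_mod1 HS i (box0 HS q1 pe0) (w' := (0, w0.1.2, w'.2))) // ltxx.
case: nr => -[nr1 nr2].
  have [_ _] := strand_order HS eps_gt0 eps_lt hcr pe pe' nr1 nr2 xyE.
  by rewrite ltNge ltW.
have [[itip [n nq]] [itail [m mq]] _] := strand_order HS eps_gt0 eps_lt hcr pe' pe nr2 nr1 (esym xyE).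
pose w : triple R := (w'.1, w'.2 + n%:~R).
have ew : eq_mod1 w'.2 w.2 by exists n.
have hw : handle S eps i' w by exact: hb.
have gw : gam tb ~~ (Some i', w).
  apply: sp_trans gb _; split; first exact: handle_chart.
  by split; [exact: handle_chart|].
have PE : Phi S i' w = Phi S i' w' by rewrite -(Phi_mod1 HS i' bw' (w' := w)).
exists r, w; split=> //.
- by split=> //; split=> //; [exists m|exists 0; rewrite addr0].
- split=> //; first by rewrite /= (Phi_lift HS).
  move=> t P tt /(sp_trans (same_point_sym (gN t tt)))/same_outside <-.
  by rewrite (Phi_vertical HS i b0) /xy /= !addr0.
move=> r0 hr0 nt0.
have tN : tip_par r0 <> tail_par r by apply: tip_neq_tail => //; rewrite -itail; case: nt0.
have fder : derive1 fe w0.1.2 = eps^-1.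
  rewrite (f_derive1 HSf eps_gt0 eps_lt).
  have [_ [_ [_ [_ [_ [_ [_ [flat twist]]]]]]]] := HSf eps_gt0 eps_lt.
  rewrite flat ?mul1r //; apply: (twist i (tip_par r0) (tail_par r) _ _ tN w0.1.2 w0.2 pe).
  - by case: (nt0) => -> _; exact: tip_endpoint.
  - by rewrite itail; exact: tail_endpoint.
  - by case: nt0.
  - by exists m.
(* Change charts at the distance d above the exit and below the entry, where
   the chart of the handle overlaps the outside. *)
pose d := Num.min ((tb - ta) / 3) ((e0 - eps) / 2).
have d1 : d <= (tb - ta) / 3 by rewrite /d ge_min lexx.
have d2 : d <= (e0 - eps) / 2 by rewrite /d ge_min lexx orbT.
have d0 : 0 < d by rewrite /d lt_min !divr_gt0 ?subr_gt0.
have d3 : d < e0 - eps by elra.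
move: (d) d0 d1 d2 d3 => {}d d0 d1 d2 d3.
pose ua := w0 + ez (Some i) (ta - t0).
have above s : 0 < s -> s < e0 - eps ->
    [/\ chart_dom S eps (Some i, ua + ez (Some i) s), ~ handle S eps i (ua + ez (Some i) s) &
    Phi S i (glue S eps i (ua + ez (Some i) s)) = Phi S i (eps, w0.1.2, q1) + ezN s].
  by have := @above_handle i ua s; rewrite /= !addr0; apply.
pose w1 := ua + ez (Some i) d.
have w1E : w0 + ez (Some i) (ta + d - t0) = w1.
  by rewrite /w1 /ua -[in RHS]addrA -[in RHS]ezD; congr (_ + ez _ _); lra.
have seg1 : flow_along gam t0 (ta + d) (Some i, w0) (Some i, w1) 1%:M.
  rewrite -w1E; apply: flow_along_chart; first by lra.
  move=> t /andP[tt1 tt2]; have [tt|tt] := leP t ta; first by apply: gt; rewrite tt1.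
  have [||a1 a2 a3] := above (t - ta); [lra|lra|].
  have <- : ua + ez (Some i) (t - ta) = w0 + ez (Some i) (t - t0).
    by rewrite /ua -[LHS]addrA -ezD; congr (_ + ez _ _); lra.
  apply: sp_trans (same_point_sym (same_point_chart HS eps_gt0 eps_lt a1 a2)).
  by rewrite a3; apply: gN; rewrite tt; lra.
have [a1 a2 a3] := above d d0 d3.
pose P1 := Phi S i (glue S eps i w1).
have P1E : P1 = Phi S i (eps, w0.1.2, q1) + ezN d by [].
have g1 : gam (ta + d) ~~ (Some i, w1).
  apply: sp_trans (same_point_sym (same_point_chart HS eps_gt0 eps_lt a1 a2)).
  rewrite a3; have {2}-> : d = ta + d - ta by lra.
  by apply: gN; apply/andP; split; lra.
have zb := coefH_bounds HS eps_gt0 eps_lt i w0.1.2.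
have jump1 : contact_flow S eps 0 (Some i, w1) (None, P1)
    (frame (tangent S (tail_comp r) (tail_par r)) *m shear_mx i).
  have := @exit_flow _ _ _ HS _ eps_gt0 eps_lt i (tail_par r) w1 m.
  rewrite /= !addr0 fder -itail; apply.
  - by rewrite itail; exact: tail_endpoint.
  - by case/andP: zb; elra.
  - by elra.
  - by apply/andP; split; elra.
  - by rewrite addrA; elra.
have seg2 : flow_along gam (ta + d) (tb - d) (None, P1) (None, P1 + ezN (tb - d - (ta + d))) 1%:M.
  apply: flow_along_chart; first by lra.
  move=> t /andP[tt1 tt2]; rewrite P1E -addrA -ezD.
  have -> : d + (t - (ta + d)) = t - ta by lra.
  by apply: gN; apply/andP; split; lra.
have below s : 0 < s -> s < e0 - eps -> [/\ chart_dom S eps (Some i', w + ez (Some i') (- s)),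
    ~ handle S eps i' (w + ez (Some i') (- s)),
    glue S eps i' (w + ez (Some i') (- s)) = w + ez (Some i') (- s) &
    Phi S i' (w + ez (Some i') (- s)) = Phi S i' w + ezN (- s)].
  by move=> s0 s1; apply: below_handle.
pose w2 := w + ez (Some i') (- d).
have [b1 b2 b3 b4] := below d d0 d3.
have P2E : P1 + ezN (tb - d - (ta + d)) = Phi S i' w2.
  rewrite b4 PE glueE P1E -!addrA -!ezD; congr (_ + ez _ _); lra.
rewrite P2E in seg2.
have gback t : tb - d <= t <= tb -> gam t ~~ (Some i', w + ez (Some i') (t - tb)).
  move=> /andP[tt1]; rewrite le_eqVlt => /orP[/eqP ->|tt2]; first by rewrite subrr ez0 addr0.
  have [||e1 e2 e3 e4] := below (tb - t); [lra|lra|].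
  rewrite opprB in e1 e2 e3 e4.
  apply: sp_trans (same_point_sym (same_point_chart HS eps_gt0 eps_lt e1 e2)).
  rewrite e3 e4 PE glueE -addrA -ezD; have -> : tb - ta + (t - tb) = t - ta by lra.
  by apply: gN; apply/andP; split; lra.
have g2 : gam (tb - d) ~~ (None, Phi S i' w2).
  rewrite -P2E P1E -addrA -ezD; have -> : d + (tb - d - (ta + d)) = tb - d - ta by lra.
  by apply: gN; apply/andP; split; lra.
have jump2 : contact_flow S eps 0 (None, Phi S i' w2) (Some i', w2)
    (frame_inv (tangent S (tip_comp r) (tip_par r))).
  rewrite itip; apply: (entry_flow HS eps_gt0 eps_lt).
  - exact: tip_endpoint.
  - by rewrite /= bot; apply/andP; split; elra.
  - by rewrite /= addr0; elra.
  - by rewrite /= addr0; elra.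
have seg3 : flow_along gam (tb - d) tb (Some i', w2) (Some i', w) 1%:M.
  have -> : w = w2 + ez (Some i') (tb - (tb - d)).
    rewrite /w2 -addrA -ezD; have -> : - d + (tb - (tb - d)) = 0 by lra.
    by rewrite ez0 addr0.
  apply: flow_along_chart; first by lra.
  move=> t tt; rewrite /w2 -addrA -ezD; have -> : - d + (t - (tb - d)) = t - tb by lra.
  exact: gback.
have l1 : t0 <= ta + d by lra.
have l2 : ta + d <= tb - d by lra.
have l4 : tb - d <= tb by lra.
have l3 := le_trans l1 l2.
have F1 := flow_along_trans l1 (lexx _) seg1 (flow_along_jump g1 jump1).
have F2 := flow_along_trans l1 l2 F1 seg2.
have F3 := flow_along_trans l3 (lexx _) F2 (flow_along_jump g2 jump2).
have := flow_along_trans l3 l4 F3 seg3.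
by rewrite !mul1mx mulmx1 mulmxA.
Qed.

End Passage.

(** * An invariant cone *)

Section Cone.
Variable R : realType.
Implicit Types (M : 'M[R]_2) (s e x : R).

(** The inequalities say that s M maps the vectors (1, 1) and (1, -1) into the
    cone of all (u, v) with |v| <= u, hence that it maps this cone into itself. *)
Definition preserves_cone s M : Prop :=
  [/\ `|M 1 0 + M 1 1| <= s * (M 0 0 + M 0 1), `|M 1 0 - M 1 1| <= s * (M 0 0 - M 0 1),
      0 < s * (M 0 0 + M 0 1), 0 < s * (M 0 0 - M 0 1) & \det M = 1].

Lemma preserves_cone1 : preserves_cone 1 1%:M.
Proof.
by split; rewrite ?det1 // !mxE /= ?addr0 ?add0r ?subr0 ?sub0r ?normrN mul1r ?normr1 ?ltr01.
Qed.

(** A shear followed by a quarter turn, up to sign. *)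
Definition turn s x : 'M[R]_2 := s *: mx2 x (-1) 1 0.

Lemma turn_det s x : s ^+ 2 = 1 -> \det (turn s x) = 1.
Proof. by move=> s2; rewrite detZ mx2_det s2; lra. Qed.

Lemma sign_square s : s ^+ 2 = 1 -> s = 1 \/ s = -1.
Proof. by move=> /eqP; rewrite sqrf_eq1 => /orP[/eqP|/eqP]; [left|right]. Qed.

Lemma turn_mul s x M : turn s x *m M =
  mx2 (s * (x * M 0 0 - M 1 0)) (s * (x * M 0 1 - M 1 1)) (s * M 0 0) (s * M 0 1).
Proof.
rewrite {1}(mx2_E M) /turn -scalemxAl mx2_mul.
by apply/matrixP => i j; rewrite !mxE; case: (ord2P i) => ->; case: (ord2P j) => -> /=; ring.
Qed.

Let growth s e x u v : s ^+ 2 = 1 -> e ^+ 2 = 1 -> 2 < e * x -> 0 < s * u -> `|v| <= s * u ->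
  s * u < s * e * (x * u - v).
Proof.
move=> s2 e2 ex su; rewrite ler_norml => /andP[v1 v2].
have : (e * x - 2) * (s * u) > 0 by apply: mulr_gt0 => //; lra.
have : s * e * v <= s * u.
  by case: (sign_square s2) => s1; case: (sign_square e2) => e1; rewrite s1 e1 in v1 v2 *; lra.
by lra.
Qed.

Let norm_sign s t u : s ^+ 2 = 1 -> t ^+ 2 = 1 -> 0 < s * u -> `|t * u| = s * u.
Proof.
move=> s2 t2; have -> : `|t * u| = `|u|.
  by rewrite normrM; case: (sign_square t2) => ->; rewrite ?normrN normr1 mul1r.
case: (sign_square s2) => ->; rewrite ?mul1r ?mulN1r => u0; first by rewrite gtr0_norm.
by rewrite ltr0_norm //; lra.
Qed.

(** On the cone the first coordinate dominates, so a turn with |x| > 2 enlarges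
    it and moves its old value into the second coordinate: the image lies inside
    the open cone. Mapping the closed cone into the open one forces
    (a - d) ^ 2 > (c - b) ^ 2, and with determinant 1 this makes the
    discriminant of the characteristic polynomial positive. *)
Lemma preserves_cone_turn s t e x M : s ^+ 2 = 1 -> t ^+ 2 = 1 -> e ^+ 2 = 1 -> 2 < e * x ->
  preserves_cone s M -> preserves_cone (s * t * e) (turn t x *m M) /\
  2 < s * t * e * \tr (turn t x *m M).
Proof.
move=> s2 t2 e2 ex [h1 h2 p1 p2 dM].
have g1 := growth s2 e2 ex p1 h1; have g2 := growth s2 e2 ex p2 h2.
have dN : \det (turn t x *m M) = 1 by rewrite det_mulmx turn_det // mul1r.
move: dN; rewrite turn_mul mx2_tr mx2_det => dN.
set A := t * (x * M 0 0 - M 1 0) in dN *; set B := t * (x * M 0 1 - M 1 1) in dN *.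
set C := t * M 0 0 in dN *; set D := t * M 0 1 in dN *.
have q1 : `|C + D| < s * t * e * (A + B).
  rewrite /C /D -mulrDr (norm_sign s2 t2 p1) (lt_le_trans g1) // /A /B.
  by rewrite le_eqVlt; apply/orP; left; apply/eqP; rewrite -[LHS]mul1r -t2; ring.
have q2 : `|C - D| < s * t * e * (A - B).
  rewrite /C /D -mulrBr (norm_sign s2 t2 p2) (lt_le_trans g2) // /A /B.
  by rewrite le_eqVlt; apply/orP; left; apply/eqP; rewrite -[LHS]mul1r -t2; ring.
split.
  have r1 := le_lt_trans (normr_ge0 _) q1; have r2 := le_lt_trans (normr_ge0 _) q2.
  by split; rewrite ?mx2_det ?mxE /= ?(ltW q1) ?(ltW q2).
have st2 : (s * t * e) ^+ 2 = 1 by rewrite !exprMn s2 t2 e2 !mul1r.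
move: q1 q2 dN; move: (s * t * e) (A) (B) (C) (D) st2 => u a b c d u2.
rewrite !ltr_norml => /andP[k1 k2] /andP[k3 k4] dN.
have T : (u * (a + d)) ^+ 2 > 4.
  rewrite exprMn u2 mul1r; have -> : (a + d) ^+ 2 = (a - d) ^+ 2 - (b - c) ^+ 2 + (b + c) ^+ 2 + 4 * (a * d - b * c) by ring.
  rewrite dN; have := sqr_ge0 (b + c).
  suff : (b - c) ^+ 2 < (a - d) ^+ 2 by lra.
  case: (sign_square u2) => u1; rewrite u1 in k1 k2 k3 k4.
    have : 0 < ((a - d) - (b - c)) * ((a - d) + (b - c)) by apply: mulr_gt0; lra.
    by lra.
  have : 0 < ((d - a) - (b - c)) * ((d - a) + (b - c)) by apply: mulr_gt0; lra.
  by lra.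
have pos : 0 < u * (a + d) by case: (sign_square u2) => u1; rewrite u1 in k1 k2 k3 k4 *; lra.
by move: T pos; move: (u * _) => v T pos; nra.
Qed.

End Cone.

(** * Rotation angles and their parity *)

Section Rotation.
Variable R : realType.

Lemma angle_exists (x y : R) : x ^+ 2 + y ^+ 2 = 1 -> exists phi, x = cos phi /\ y = sin phi.
Proof.
move=> xy; have x1 : -1 <= x <= 1 by have y0 := sqr_ge0 y; apply/andP; split; nra.
have cx : cos (acos x) = x by apply: acosK; rewrite in_itv.
have sx : sin (acos x) = `|y| by rewrite sin_acos // -sqrtr_sqr; congr Num.sqrt; lra.
have [y0|y0] := ger0P y; last first.
  by exists (- acos x); rewrite cosN sinN cx sx ltr0_norm // opprK.
by exists (acos x); rewrite cx sx ger0_norm.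
Qed.

(** A unit vector field (x, y) along an interval has a continuous angle: the
    integral of x y' - y x', shifted to have the right initial value. *)
Lemma angle_lift (x y x' y' : R -> R) (q0 q1 : R) : q0 <= q1 ->
  (forall q : R, is_derive q 1 x (x' q)) -> (forall q : R, is_derive q 1 y (y' q)) ->
  continuous x' -> continuous y' -> (forall q, x q ^+ 2 + y q ^+ 2 = 1) ->
  exists phi : R -> R, {within `[q0, q1], continuous phi} /\
    forall q, q0 <= q <= q1 -> x q = cos (phi q) /\ y q = sin (phi q).
Proof.
move=> q01 dx dy cx' cy' xy1.
have cx : continuous x.
  by move=> q; apply: differentiable_continuous; apply/derivable1_diffP; case: (dx q).
have cy : continuous y.
  by move=> q; apply: differentiable_continuous; apply/derivable1_diffP; case: (dy q).
have orth q : x q * x' q + y q * y' q = 0.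
  have dd : is_derive q 1 (x * x + y * y) (2 * (x q * x' q + y q * y' q)).
    apply: (is_derive_eq (is_deriveD (is_deriveM (dx q) (dx q)) (is_deriveM (dy q) (dy q)))).
    by rewrite /GRing.scale /=; ring.
  have d0 : is_derive q 1 (cst (1 : R)) 0 by exact: is_derive_cst.
  have := is_derive_near_unique dd d0 => /(_ _)/wrap[|]; last by lra.
  by near=> s; rewrite !fctE -!expr2 xy1.
pose g q := x q * y' q - y q * x' q.
have cg : continuous g by move=> q; apply: cvgB; apply: cvgM; [exact: cx|exact: cy'|exact: cy|exact: cx'].
have [phi0 [x0 y0]] := angle_exists (xy1 q0).
pose G q := \int[lebesgue_measure]_(t in `[q0 - 1, q]) g t.
have dG (q : R) : q0 - 1 < q -> q < q1 + 1 -> is_derive q 1 G (g q).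
  move=> h1 h2.
  have ig : lebesgue_measure.-integrable `[q0 - 1, q1 + 1] (EFin \o g).
    apply: continuous_compact_integrable; first exact: segment_compact.
    exact: continuous_subspaceT.
  have [//|dG1 <-] := @continuous_FTC1 R g (BLeft (q0 - 1)) q (q1 + 1) h2 ig _ (cg q).
  by rewrite derive1E; exact: derivableP.
pose phi q := phi0 - G q0 + G q.
have dphi (q : R) : q0 - 1 < q -> q < q1 + 1 -> is_derive q 1 phi (g q).
  move=> h1 h2; have d1 := dG q h1 h2.
  have -> : phi = cst (phi0 - G q0) + G by [].
  by apply: is_derive_eq; rewrite add0r.
pose u q := x q * cos (phi q) + y q * sin (phi q).
pose v q := y q * cos (phi q) - x q * sin (phi q).
have duv (q : R) : q0 - 1 < q -> q < q1 + 1 -> is_derive q 1 u 0 /\ is_derive q 1 v 0.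
  move=> h1 h2; have d1 := dphi q h1 h2; have d2 := dx q; have d3 := dy q.
  have dc : is_derive q 1 (cos \o phi) (- sin (phi q) * g q) by apply: is_derive1_comp.
  have ds : is_derive q 1 (sin \o phi) (cos (phi q) * g q) by apply: is_derive1_comp.
  have e1 : x' q + y q * g q = 0.
    transitivity (x' q * (1 - (x q ^+ 2 + y q ^+ 2)) + x q * (x q * x' q + y q * y' q)).
      by rewrite /g; ring.
    by rewrite xy1 orth subrr !mulr0 addr0.
  have e2 : y' q - x q * g q = 0.
    transitivity (y' q * (1 - (x q ^+ 2 + y q ^+ 2)) + y q * (x q * x' q + y q * y' q)).
      by rewrite /g; ring.
    by rewrite xy1 orth subrr !mulr0 addr0.
  split.
    have -> : u = x * (cos \o phi) + y * (sin \o phi) by [].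
    apply: (is_derive_eq (is_deriveD (is_deriveM d2 dc) (is_deriveM d3 ds))); rewrite /GRing.scale /=.
    transitivity (cos (phi q) * (x' q + y q * g q) + sin (phi q) * (y' q - x q * g q)); first by ring.
    by rewrite e1 e2 !mulr0 addr0.
  have -> : v = y * (cos \o phi) - x * (sin \o phi) by [].
  apply: (is_derive_eq (is_deriveB (is_deriveM d3 dc) (is_deriveM d2 ds))); rewrite /GRing.scale /=.
  transitivity (cos (phi q) * (y' q - x q * g q) - sin (phi q) * (x' q + y q * g q)); first by ring.
  by rewrite e1 e2 !mulr0 subrr.
have const (h : R -> R) : (forall q : R, q0 - 1 < q -> q < q1 + 1 -> is_derive q 1 h 0) ->
    forall q, q0 <= q <= q1 -> h q = h q0.
  move=> dh q /andP[qq0 qq1].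
  have [||c _] := @MVT_segment R h (fun=> 0) q0 q qq0.
  - by move=> s; rewrite in_itv /= => /andP[s1 s2]; apply: dh; lra.
  - apply: derivable_within_continuous => s; rewrite in_itv /= => /andP[s1 s2].
    by have [|| ? _] := dh s; [lra|lra|].
  by rewrite mul0r => /eqP; rewrite subr_eq0 => /eqP.
have phiq0 : phi q0 = phi0 by rewrite /phi subrK.
exists phi; split.
  apply: derivable_within_continuous => s; rewrite in_itv /= => /andP[s1 s2].
  by have [|| ? _] := dphi s; [lra|lra|].
move=> q qq; have cs := cos2Dsin2 (phi q).
have uq : u q = 1.
  rewrite (const u _ q qq); last by move=> s s1 s2; have [] := duv s s1 s2.
  by rewrite /u phiq0 -x0 -y0 -(xy1 q0); ring.
have vq : v q = 0.
  rewrite (const v _ q qq); last by move=> s s1 s2; have [] := duv s s1 s2.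
  by rewrite /v phiq0 -x0 -y0; ring.
split.
  transitivity (x q * (cos (phi q) ^+ 2 + sin (phi q) ^+ 2)); first by rewrite cs mulr1.
  transitivity (cos (phi q) * u q - sin (phi q) * v q); first by rewrite /u /v; ring.
  by rewrite uq vq mulr1 mulr0 subr0.
transitivity (y q * (cos (phi q) ^+ 2 + sin (phi q) ^+ 2)); first by rewrite cs mulr1.
transitivity (sin (phi q) * u q + cos (phi q) * v q); first by rewrite /u /v; ring.
by rewrite uq vq mulr1 mulr0 addr0.
Unshelve. all: by end_near. Qed.

Definition sign2 (m : 'Z_2) : R := (-1) ^+ (m : nat).

Lemma sign2D m m' : sign2 (m + m') = sign2 m * sign2 m'.
Proof.
rewrite /sign2; case: m m' => [[|[|//]] ?] [[|[|//]] ?];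
  by rewrite /= ?expr0 ?expr1 ?mul1r ?mulr1 // mulN1r opprK.
Qed.

Lemma sign2_square m : sign2 m * sign2 m = 1.
Proof. by rewrite /sign2 -expr2 sqrr_sign. Qed.

Lemma sign2_1 : sign2 1 = -1.
Proof. by rewrite /sign2 /= expr1. Qed.

Lemma sin_addpi (z : int) (r : R) : sin (r + z%:~R * pi) = sign2 z%:~R * sin r.
Proof.
have nat_case (n : nat) r' : sin (r' + n%:R * pi) = sign2 n%:R * sin r'.
  elim: n r' => [|n IH] r'; first by rewrite mul0r addr0 /sign2 mul1r.
  rewrite -natr1 mulrDl mul1r addrA sinDpi IH -[n.+1%:R]natr1 sign2D sign2_1; ring.
case: z => n; first exact: nat_case.
rewrite NegzE !rmorphN /= mulNr.
have -> : - n.+1%:~R = n.+1%:R :> 'Z_2.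
  have neg2 (m : 'Z_2) : - m = m by apply: val_inj; case: m => [[|[|//]] ?].
  by rewrite neg2 -pmulrn.
have := nat_case n.+1 (r - n.+1%:R * pi); rewrite subrK => ->.
by rewrite mulrA sign2_square mul1r.
Qed.

(** A half turn more or less changes the sign of the sine, so the parity of
    floor (th / pi) is read off from sin th when this is 1 or -1. *)
Lemma sign2_floor (th s : R) : s ^+ 2 = 1 -> sin th = s ->
  sign2 (Num.floor (th / pi))%:~R = s.
Proof.
move=> s2 ths; set z := Num.floor (th / pi); pose r := th - z%:~R * pi.
have pi0 := pi_gt0 R.
have /andP[f1 f2] := real_floor_itv (num_real (th / pi)).
rewrite -/z intrD ler_pdivlMr // ltr_pdivrMr // mulrDl mul1r in f1 f2.
have r0 : 0 <= sin r by apply: sin_ge0_pi; apply/andP; split; rewrite /r; lra.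
have E : s = sign2 z%:~R * sin r by rewrite -sin_addpi /r subrK.
have t2 := sign2_square z%:~R; move: E t2; set t := sign2 _; move: (sin r) r0 => c c0 E t2.
have c1 : c = 1.
  have : c ^+ 2 = 1 by move: s2; rewrite E exprMn [t ^+ 2]expr2 t2 mul1r.
  by move=> /eqP; rewrite sqrf_eq1 => /orP[/eqP|/eqP]; lra.
by rewrite E c1 mulr1.
Qed.

End Rotation.

(** * Return maps of closed orbits *)

Section ClosedOrbits.
Variables (R : realType) (N : nat) (S : surgery R N).
Hypothesis HS : surgery_setup S.
Variable eps : R.
Hypotheses (eps_gt0 : 0 < eps) (eps_lt : eps < eps0 S).
Local Notation fe := (f_ S eps).
Local Notation He := (H_ S eps).
Local Notation e0 := (eps0 S).
Local Notation glue := Defs.glue.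
Local Notation "x ~~ y" := (same_point S eps x y) (at level 70).
Local Notation ezN := (@ez R N None).
Local Notation sp_trans := (same_point_trans HS eps_gt0 eps_lt).
Ltac elra := (pose proof eps_gt0; pose proof eps_lt; lra).
Implicit Types (i : 'I_N) (w P : triple R) (k : option 'I_N) (x y : spoint R N) (s t z p q : R).

Implicit Types r : chord R N.
Let nbhds : standard_nbhds S. Proof. by case: HS. Qed.

Lemma closed_orbit_periodZ gam T t (n : int) : closed_orbit S eps gam T ->
  gam (t + n%:~R * T) ~~ gam t.
Proof.
move=> [_ hr per].
have pern (n' : nat) u : gam (u + n'%:R * T) ~~ gam u.
  elim: n' u => [|n' IH] u.
    rewrite mul0r addr0; have [k [a /nbhs_singleton h]] := (reeb_at_straight S eps gam u).1 (hr u).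
    exact: sp_trans h (same_point_sym h).
  by rewrite -natr1 mulrDl mul1r addrA; apply: sp_trans (per _) (IH u).
case: n => n; first exact: pern.
have := pern n.+1 (t + (Negz n)%:~R * T); rewrite NegzE rmorphN /= mulNr -pmulrn subrK.
exact: same_point_sym.
Qed.

(** The return map may be based at any point of the orbit: moving the base point
    replaces B A by A B, with the same trace and determinant. *)
Lemma return_from_flow_along gam T tau i i' w w' (M : 'M[R]_2) :
  closed_orbit S eps gam T -> gam tau ~~ (Some i, w) -> gam (tau + T) ~~ (Some i', w') ->
  flow_along S eps gam tau (tau + T) (Some i, w) (Some i', w') M ->
  exists A, [/\ linearized_return S eps gam T A, \tr A = \tr M & \det A = \det M].
Proof.
move=> cl g0 g1 fl; have [T0 hr per] := cl.
(* n T is the first multiple of the period after tau *)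
pose n := Num.floor (tau / T) + 1.
have /andP[f1 f2] := real_floor_itv (num_real (tau / T)).
rewrite -/n ler_pdivlMr // in f1; rewrite -/n ltr_pdivrMr // in f2.
have nE : (Num.floor (tau / T))%:~R = n%:~R - 1 :> R by rewrite /n intrD; lra.
rewrite nE mulrBl mul1r in f1.
have [|x [A [B [gx fA fB <-]]]] := fl (n%:~R * T); first by apply/andP; split; lra.
have g0x : gam 0 ~~ x.
  apply: sp_trans gx; apply: same_point_sym.
  by have := closed_orbit_periodZ 0 n cl; rewrite add0r.
have [_ [dw' [ii e1 e2]]] := sp_trans (same_point_sym g0) (sp_trans (same_point_sym (per tau)) g1).
rewrite -{}ii in fl g1 fB dw' *.
have fJ : contact_flow S eps 0 (Some i, w') (Some i, w) 1%:M.
  by apply: (contact_flow_mod1 HS eps_gt0 eps_lt) => //; exact: eq_mod1_sym.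
exists (A *m (1%:M *m B)); split; last first.
- by rewrite mul1mx !det_mulmx mulrC.
- by rewrite mul1mx mxtrace_mulC.
apply: (contact_flow_return g0x).
have -> : T = tau + T - n%:~R * T + 0 + (n%:~R * T - tau) by lra.
have l1 : 0 <= tau + T - n%:~R * T by lra.
have l2 : 0 <= n%:~R * T - tau by lra.
apply: (contact_flow_trans HS eps_gt0 eps_lt) _ fA => //; first by rewrite addr0.
exact: (contact_flow_trans HS eps_gt0 eps_lt l1 (lexx _) fB fJ).
Qed.

(** The strands over a rectangle are perpendicular, so that crossing it exchanges
    the two transverse coordinates; the sign compares the orientations of the
    strands. *)
Lemma crossing_turn r i : is_chord S r ->
  crossing_mx S r *m shear_mx S eps i =
  turn (2 * (tangent S (tip_comp r) (tip_par r)).1 * (tangent S (tail_comp r) (tail_par r)).1)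
    (- (coef S i / eps)).
Proof.
move=> hr; have [a a2 aE] := tip_tangent HS hr; have [b b2 bE] := tail_tangent HS hr.
rewrite /crossing_mx /shear_mx aE bE /frame_inv /frame !mx2_mul /turn /=.
by apply/matrixP => j l; rewrite !mxE; case: (ord2P j) => ->; case: (ord2P l) => -> /=; ring.
Qed.

(** For r = r' this is the sign of a crossing. When r' follows r it is the sine
    of the angle by which the tangent turns from the tip of r to the tail of
    r'. Every factor is a component 1 / sqrt 2 of a unit tangent, up to
    sign. *)
Definition crossing_sign r r' : R :=
  2 * (tangent S (tip_comp r) (tip_par r)).1 * (tangent S (tail_comp r') (tail_par r')).1.

Lemma crossing_sign_square r r' : is_chord S r -> is_chord S r' -> crossing_sign r r' ^+ 2 = 1.
Proof.
move=> hr hr'; have [a a2 aE] := tip_tangent HS hr; have [b b2 bE] := tail_tangent HS hr'.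
rewrite /crossing_sign aE bE /=.
have -> : (2 * a * b) ^+ 2 = (2 * a ^+ 2) * (2 * b ^+ 2) by ring.
by rewrite a2 b2 mulr1.
Qed.

Lemma coef_square i : coef S i ^+ 2 = 1.
Proof. by case: (coef_pm1 S i) => ->; rewrite ?sqrrN expr1n. Qed.

(** A passage composes the shear of the handle with the quarter turn of the
    crossing. As eps < 1 / 2, the slope 1 / eps of the shear exceeds 2. *)
Lemma passage_cone s (M : 'M[R]_2) r i : eps < 1 / 2 -> is_chord S r -> s ^+ 2 = 1 ->
  preserves_cone s M ->
  let s' := s * crossing_sign r r * - coef S i in
  let M' := crossing_mx S r *m shear_mx S eps i *m M in
  [/\ s' ^+ 2 = 1, preserves_cone s' M' & 2 < s' * \tr M'].
Proof.
move=> e2 hr s2 cM s' M'; rewrite /s' /M' crossing_turn //.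
have t2 := crossing_sign_square hr hr; have c2 : (- coef S i) ^+ 2 = 1 by rewrite sqrrN coef_square.
have ex : 2 < - coef S i * - (coef S i / eps).
  rewrite mulrNN mulrA -expr2 coef_square ltr_pdivlMr //; lra.
have [p1 p2] := preserves_cone_turn s2 t2 c2 ex cM.
by split=> //; rewrite exprMn [(s * _) ^+ 2]exprMn s2 t2 c2 !mul1r.
Qed.

Lemma hyperbolic_of_flow_along gam T tau i i' w w' (M : 'M[R]_2) s :
  closed_orbit S eps gam T -> gam tau ~~ (Some i, w) -> gam (tau + T) ~~ (Some i', w') ->
  flow_along S eps gam tau (tau + T) (Some i, w) (Some i', w') M ->
  s ^+ 2 = 1 -> preserves_cone s M -> 2 < s * \tr M ->
  hyperbolic S eps gam T /\ exists A, linearized_return S eps gam T A /\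
    Num.sg (\det (A - 1%:M)) = - s.
Proof.
move=> cl g0 g1 fl s2 [_ _ _ _ dM] sM.
have [A [lA tA dA]] := return_from_flow_along cl g0 g1 fl.
rewrite -tA in sM; rewrite {}dM in dA.
split; exists A; split=> //.
  by case: (sign_square s2) sM => ->; rewrite ?mul1r ?mulN1r => sM;
    [apply: lt_le_trans sM (ler_norm _)|rewrite -normrN; apply: lt_le_trans sM (ler_norm _)].
have -> : \det (A - 1%:M) = 2 - \tr A.
  move: dA; rewrite (mx2_E A) mx2_tr -mx2_1.
  have -> (a b c d : R) : mx2 a b c d - mx2 1 0 0 1 = mx2 (a - 1) b c (d - 1).
    by apply/matrixP => j l; rewrite !mxE; case: ifP => _; case: ifP => _; rewrite ?subr0.
  by rewrite !mx2_det; lra.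
by case: (sign_square s2) sM => ->; rewrite ?mul1r ?mulN1r => sM;
  [rewrite ltr0_sg //; lra|rewrite opprK gtr0_sg //; lra].
Qed.

(** The tangent at a point of a strand tells whether it runs above or below a
    crossing strand. If the two strands were different, they would cross over a
    rectangle, and one of them would be both an upper and a lower strand. *)
Lemma same_tip r r' i i' p p' q q' : is_chord S r -> is_chord S r' ->
  `|p| <= eps -> `|p'| <= eps -> near_tip eps r i q -> near_tip eps r' i' q' ->
  xy (Phi S i (0, p, q)) = xy (Phi S i' (0, p', q')) ->
  tangent S i q = tangent S (tip_comp r') (tip_par r').
Proof.
move=> hr hr' pe pe' n1 n2 E.
have pe0 := le_trans pe (ltW eps_lt); have pe0' := le_trans pe' (ltW eps_lt).
rewrite -(near_tip_tangent HS eps_gt0 eps_lt hr' n2).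
have [[ii _ qq]|ne] := EM [/\ i = i', p = p' & eq_mod1 q q'].
  by rewrite (tangent_mod1 HS i qq) ii.
case: nbhds => _ [_ [_ [_ [_ [_ [_ [_ [_ overlap]]]]]]]].
have [r'' [hr'' [[m1 m2]|[m1 m2]]]] := overlap i i' p p' q q' pe0 pe0' E ne.
  have [_ m2' _] := strand_order HS eps_gt0 eps_lt hr'' pe pe' m1 m2 E.
  case: (not_near_tip_tail HS eps_gt0 eps_lt hr' hr'' n2 m2' (eq_mod1_refl q')).
have [_ m1' _] := strand_order HS eps_gt0 eps_lt hr'' pe' pe m2 m1 (esym E).
case: (not_near_tip_tail HS eps_gt0 eps_lt hr hr'' n1 m1' (eq_mod1_refl q)).
Qed.

Lemma same_tail r r' i i' p p' q q' : is_chord S r -> is_chord S r' ->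
  `|p| <= eps -> `|p'| <= eps -> near_tail eps r i q -> near_tail eps r' i' q' ->
  xy (Phi S i (0, p, q)) = xy (Phi S i' (0, p', q')) ->
  tangent S i q = tangent S (tail_comp r') (tail_par r').
Proof.
move=> hr hr' pe pe' n1 n2 E.
have pe0 := le_trans pe (ltW eps_lt); have pe0' := le_trans pe' (ltW eps_lt).
rewrite -(near_tail_tangent HS eps_gt0 eps_lt hr' n2).
have [[ii _ qq]|ne] := EM [/\ i = i', p = p' & eq_mod1 q q'].
  by rewrite (tangent_mod1 HS i qq) ii.
case: nbhds => _ [_ [_ [_ [_ [_ [_ [_ [_ overlap]]]]]]]].
have [r'' [hr'' [[m1 m2]|[m1 m2]]]] := overlap i i' p p' q q' pe0 pe0' E ne.
  have [m1' _ _] := strand_order HS eps_gt0 eps_lt hr'' pe pe' m1 m2 E.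
  case: (not_near_tip_tail HS eps_gt0 eps_lt hr'' hr m1' n1 (eq_mod1_refl q)).
have [m2' _ _] := strand_order HS eps_gt0 eps_lt hr'' pe' pe m2 m1 (esym E).
case: (not_near_tip_tail HS eps_gt0 eps_lt hr'' hr' m2' n2 (eq_mod1_refl q')).
Qed.

End ClosedOrbits.

(** * Every closed orbit is hyperbolic *)

Section Passages.
Variables (R : realType) (N : nat) (S : surgery R N).
Hypothesis HS : surgery_setup S.
Variable eps : R.
Hypotheses (eps_gt0 : 0 < eps) (eps_lt : eps < eps0 S).
Local Notation fe := (f_ S eps).
Local Notation He := (H_ S eps).
Local Notation e0 := (eps0 S).
Local Notation glue := Defs.glue.
Local Notation "x ~~ y" := (same_point S eps x y) (at level 70).
Local Notation ezN := (@ez R N None).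
Local Notation sp_trans := (same_point_trans HS eps_gt0 eps_lt).
Ltac elra := (pose proof eps_gt0; pose proof eps_lt; lra).
Implicit Types (i : 'I_N) (w P : triple R) (k : option 'I_N) (x y : spoint R N) (s t z p q : R).

Implicit Types r : chord R N.

Definition entry gam t r w : Prop :=
  [/\ is_chord S r, near_tip eps r (tip_comp r) w.2, gam t ~~ (Some (tip_comp r), w),
      handle S eps (tip_comp r) w & w.1.1 = - eps].

Section Orbit.
Variable gam : R -> spoint R N.
Hypothesis hr : forall t, reeb_at S eps gam t.

Lemma inside_or_outside t : (exists i, inside S eps gam i t) \/ outside S eps gam t.
Proof.
have [k [a /nbhs_singleton]] := (reeb_at_straight S eps gam t).1 (hr t).
rewrite subrr ez0 addr0; case: k => [i|] ga; last by right; exists a.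
have [ha|ha] := EM (handle S eps i a); first by left; exists i, a.
right; exists (Phi S i (glue S eps i a)).
exact: sp_trans ga (same_point_chart HS eps_gt0 eps_lt (same_point_dom ga).2 ha).
Qed.

Lemma outside_near t : outside S eps gam t ->
  exists2 e : R, 0 < e & forall d, `|d| < e -> outside S eps gam (t + d).
Proof.
move=> [P gP]; have [e e0 he] := reeb_ball HS eps_gt0 eps_lt hr gP.
by exists e => // d /he gd; exists (P + ezN d).
Qed.

(** A handle is disjoint from the outside chart, so that an orbit cannot leave it
    before its vertical line does. *)
Lemma stay_in_handle t0 t1 i w0 : t0 <= t1 -> gam t0 ~~ (Some i, w0) ->
  (forall t, t0 <= t <= t1 -> handle S eps i (w0 + ez (Some i) (t - t0))) ->
  forall t, t0 <= t <= t1 -> gam t ~~ (Some i, w0 + ez (Some i) (t - t0)).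
Proof.
move=> t0a g0 inh.
apply: (reeb_propagate HS eps_gt0 eps_lt t0a) => // s /andP[s1 s2] hs.
have [k [c hc]] := (reeb_at_straight S eps gam s).1 (hr s).
have := nbhs_singleton hc; rewrite subrr ez0 addr0 => gc.
have [e ee he] := reeb_ball HS eps_gt0 eps_lt hr gc.
pose d := Num.min (e / 2) (s - t0).
have d1 : d <= e / 2 by rewrite /d ge_min lexx.
have d2 : d <= s - t0 by rewrite /d ge_min lexx orbT.
have d0 : 0 < d by rewrite /d lt_min divr_gt0 // subr_gt0.
have gd := he (- d); rewrite normrN gtr0_norm // in gd.
have de : d < e by lra.
have tsd : t0 <= s - d < s by apply/andP; split; lra.
have gs := hs (s - d) tsd.
have same := sp_trans (same_point_sym gs) (gd de).
have hh : handle S eps i (w0 + ez (Some i) (s - d - t0)) by apply: inh; apply/andP; split; lra.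
case: k {hc gd he} c gc same => [i''|] c gc same; last by case: (not_handle_out same).
by move: same => [_ [_ [ii _ _]]]; rewrite ii; exists c.
Qed.

(** The next entry is the infimum of the later times spent in handles. It is
    attained because being outside is an open condition, and it is later than
    the exit because a collar above the top is outside. *)
Lemma next_entry t0 i w0 t1 i1 : gam t0 ~~ (Some i, w0) -> handle S eps i w0 ->
  inside S eps gam i1 t1 -> t0 + (eps + coef S i * He w0.1.2 - w0.1.1) < t1 ->
  exists ta tb i' w', [/\ t0 <= ta, ta < tb & tb <= t1] /\
    [/\ ta = t0 + (eps + coef S i * He w0.1.2 - w0.1.1),
     forall t, t0 <= t <= ta -> inside S eps gam i t,
     forall t, ta < t < tb -> outside S eps gam t,
     gam tb ~~ (Some i', w') & handle S eps i' w'].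
Proof.
move=> g0 h0; set ta := t0 + _ => in1 tat1.
have [pe z0 z1] := h0; have t0a : t0 <= ta by rewrite /ta; lra.
have inh t : t0 <= t <= ta -> handle S eps i (w0 + ez (Some i) (t - t0)).
  by rewrite /ta => /andP[h1 h2]; split; rewrite /= ?addr0 //; lra.
have stay := stay_in_handle t0a g0 inh.
have ta' : t0 <= ta <= ta by rewrite t0a lexx.
pose B := [set t | ta < t /\ exists i', inside S eps gam i' t].
have B1 : B t1 by split=> //; exists i1.
have lB : has_inf B by split; [exists t1|exists ta => t [/ltW]].
pose tb := inf B.
have tab0 : ta <= tb by apply: lb_le_inf; [exists t1|move=> t [/ltW]].
have tbt1 : tb <= t1 by apply: ge_inf => //; case: lB.
have [e ee he] := reeb_ball HS eps_gt0 eps_lt hr (stay ta ta').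
have notin d : 0 < d -> d < e -> d < e0 - eps -> outside S eps gam (ta + d).
  move=> d0 de d1; have := he d; rewrite gtr0_norm // => /(_ de) gd.
  have pu : `|(w0 + ez (Some i) (ta - t0)).1.2| <= eps by rewrite /= addr0.
  have tu : (w0 + ez (Some i) (ta - t0)).1.1 - coef S i * He (w0 + ez (Some i) (ta - t0)).1.2 = eps.
    by rewrite /= addr0 /ta; lra.
  have [a1 a2 _] := above_handle HS eps_gt0 eps_lt pu tu d0 d1.
  exists (Phi S i (glue S eps i (w0 + ez (Some i) (ta - t0) + ez (Some i) d))).
  exact: sp_trans gd (same_point_chart HS eps_gt0 eps_lt a1 a2).
have tab : ta < tb.
  pose d := Num.min (e / 2) ((e0 - eps) / 2).
  have d1 : d <= e / 2 by rewrite /d ge_min lexx.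
  have d2 : d <= (e0 - eps) / 2 by rewrite /d ge_min lexx orbT.
  have d0 : 0 < d by rewrite /d lt_min !divr_gt0 ?subr_gt0.
  suff : ta + d <= tb by lra.
  apply: lb_le_inf; first by exists t1.
  move=> t [tat [i' it]]; rewrite leNgt; apply/negP => td.
  apply: (inside_not_outside HS eps_gt0 eps_lt it).
  have -> : t = ta + (t - ta) by lra.
  by apply: notin; elra.
have out t : ta < t < tb -> outside S eps gam t.
  move=> /andP[tt1 tt2]; case: (inside_or_outside t) => // -[i' it].
  suff : tb <= t by rewrite leNgt tt2.
  by apply: ge_inf; [case: lB|split=> //; exists i'].
have [[i' [w' [gb hb]]]|ob] := inside_or_outside tb; last first.
  have [e' ee' he'] := outside_near ob.
  have [t [tat [i' it]] te] := inf_adherent ee' lB.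
  have tbt : tb <= t by apply: ge_inf; [case: lB|split=> //; exists i'].
  case: (inside_not_outside HS eps_gt0 eps_lt it).
  have -> : t = tb + (t - tb) by lra.
  by apply: he'; rewrite ger0_norm ?subr_ge0 //; move: te; rewrite -/tb; lra.
exists ta, tb, i', w'; split; first by split.
by split=> // t tt; exists (w0 + ez (Some i) (t - t0)); split; [exact: stay|exact: inh].
Qed.

(** Inside a handle the height increases, so the orbit cannot be at the bottom
    again before it has left through the top. *)
Lemma entry_entry t t' r w r' w' : entry gam t r w -> entry gam t' r' w' ->
  t < t' -> t + (2 * eps + coef S (tip_comp r) * He w.1.2) < t'.
Proof.
move=> [_ _ g0 h0 z0] [_ _ g1 h1 z1] tt; rewrite ltNge; apply/negP => le.
have [pe y0 y1] := h0.
have inh s : t <= s <= t' -> handle S eps (tip_comp r) (w + ez (Some (tip_comp r)) (s - t)).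
  by move=> /andP[s1 s2]; split; rewrite /= ?addr0 //; lra.
have tt' : t <= t' <= t' by rewrite lexx ltW.
have g1' := stay_in_handle (ltW tt) g0 inh tt'.
have [_ [_ [_ + _]]] := sp_trans (same_point_sym g1) g1'.
by move=> /(congr1 fst) /=; rewrite z0 z1; lra.
Qed.

End Orbit.

Lemma entry_next gam T t t1 r w r1 w1 : closed_orbit S eps gam T ->
  entry gam t r w -> entry gam t1 r1 w1 -> t < t1 ->
  exists t' r' w', [/\ t + eps <= t', t' <= t1, entry gam t' r' w' &
    flow_along S eps gam t t' (Some (tip_comp r), w) (Some (tip_comp r'), w')
      (crossing_mx S r' *m shear_mx S eps (tip_comp r))].
Proof.
move=> cl E E1 tt1; have [T0 hr per] := cl.
have [hcr nt g0 h0 z0] := E; have [_ _ g1 h1 _] := E1.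
have in1 : inside S eps gam (tip_comp r1) t1 by exists w1.
have := entry_entry hr E E1 tt1.
have cb := coefH_bounds HS eps_gt0 eps_lt (tip_comp r) w.1.2.
set X := coef S _ * _ in cb *; move=> le1.
have [|ta [tb [i' [w' [[l1 l2 l3] [taE inn out gb hb]]]]]] := next_entry hr g0 h0 in1.
  by rewrite z0 -/X; lra.
have [r' [w'' [[hr' nt1 nt2] [gb' hb' z'] _ fl]]] := passage HS eps_gt0 eps_lt hr l1 l2 g0 inn out gb hb.
have ii : i' = tip_comp r' by case: nt2.
rewrite ii in gb' hb' nt2 fl; exists tb, r', w''; split=> //.
  by move: taE; rewrite z0 -/X; case/andP: cb; elra.
exact: fl hcr nt.
Qed.

(** By periodicity an entry recurs after one period. Successive entries are at
    least eps apart, so that finitely many passages lead to it, and each of them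
    preserves the cone. *)
Lemma cone_along_entries gam T t r w : eps < 1 / 2 -> closed_orbit S eps gam T ->
  entry gam t r w ->
  exists r' w' M s, [/\ gam (t + T) ~~ (Some (tip_comp r'), w'),
    flow_along S eps gam t (t + T) (Some (tip_comp r), w) (Some (tip_comp r'), w') M,
    s ^+ 2 = 1, preserves_cone s M & 2 < s * \tr M].
Proof.
move=> e2 cl E; have [T0 hr per] := cl.
have [hcr nt g0 h0 z0] := E.
have E1 : entry gam (t + T) r w by split=> //; exact: sp_trans (per t) g0.
have step (n : nat) : exists t' r' w' M s, [/\ t <= t' <= t + T, t' = t + T \/ t + n%:R * eps <= t',
    entry gam t' r' w',
    flow_along S eps gam t t' (Some (tip_comp r), w) (Some (tip_comp r'), w') M &
    [/\ s ^+ 2 = 1, preserves_cone s M & t < t' -> 2 < s * \tr M]].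
  elim: n => [|n [t' [r' [w' [M [s [/andP[tt1 tt2] alt E' fl [s2 cM trM]]]]]]]].
    exists t, r, w, 1%:M, 1; split=> //; first by rewrite lexx; lra.
    - by right; rewrite mul0r addr0.
    - have dx : chart_dom S eps (Some (tip_comp r), w) by exact: handle_chart.
      apply: (flow_along_jump HS eps_gt0 eps_lt g0).
      exact: (contact_flow_mod1 HS eps_gt0 eps_lt dx erefl (eq_mod1_refl _)).
    - by split; [rewrite expr1n|exact: preserves_cone1|rewrite ltxx].
  have [t'E|t'E] := eqVneq t' (t + T).
    by exists t', r', w', M, s; split=> //; [rewrite tt1|left].
  have lt' : t' < t + T by rewrite lt_neqAle t'E.
  have [t'' [r'' [w'' [l1 l2 E'' fl'']]]] := entry_next cl E' E1 lt'.
  have [hr'' _ _ _ _] := E''.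
  have [s2' cM' trM'] := passage_cone HS eps_gt0 (tip_comp r') e2 hr'' s2 cM.
  have l3 : t' <= t'' by elra.
  exists t'', r'', w'', (crossing_mx S r'' *m shear_mx S eps (tip_comp r') *m M),
    (s * crossing_sign S r'' r'' * - coef S (tip_comp r')); split=> //.
  - by rewrite l2 andbT; lra.
  - right; case: alt => [/eqP|alt]; first by rewrite (negPf t'E).
    by rewrite -natr1 mulrDl mul1r; lra.
  - exact: (flow_along_trans HS eps_gt0 eps_lt tt1 l3 fl fl'').
have [n nT] : exists n : nat, T < n%:R * eps.
  have h := archi_boundP (divr_ge0 (ltW T0) (ltW eps_gt0)).
  by rewrite ltr_pdivrMr // in h; exists (Num.bound (T / eps)).
have [t' [r' [w' [M [s [tt alt E' fl [s2 cM trM]]]]]]] := step n.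
have t'E : t' = t + T by case: alt => // alt; move: tt => /andP[]; lra.
rewrite {}t'E in E' fl trM; exists r', w', M, s; split=> //; first by case: E'.
by apply: trM; rewrite ltrDl.
Qed.

(** A closed orbit meets a handle, since otherwise it would be a vertical line in
    R^3; hence it has an entry, and the return map based there is a product of
    passages. *)
Theorem closed_orbit_hyperbolic gam T : eps < 1 / 2 -> closed_orbit S eps gam T ->
  hyperbolic S eps gam T.
Proof.
move=> e2 cl; have [T0 hr per] := cl.
have [[t0 [i0 in0]]|never] := EM (exists t i, inside S eps gam i t); last first.
  have out t : outside S eps gam t.
    by case: (inside_or_outside hr t) => // -[i it]; case: never; exists t, i.
  have [P0 g0] := out 0.
  have := reeb_propagate HS eps_gt0 eps_lt (ltW T0) (fun t _ => hr t) g0 (fun t _ _ => out t) (t := T).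
  rewrite lexx ltW // => /(_ isT) gT.
  have := per 0; rewrite add0r => gT0.
  have := same_outside (sp_trans (same_point_sym gT) (sp_trans gT0 g0)).
  by move=> /(congr1 snd) /=; lra.
have [w0 [g0 h0]] := in0.
have periodic n := closed_orbit_periodZ HS eps_gt0 eps_lt t0 n cl.
pose X := eps + coef S i0 * He w0.1.2 - w0.1.1.
have [n nX] : exists n : nat, X < n%:R * T.
  have h := archi_boundP (divr_ge0 (normr_ge0 X) (ltW T0)); rewrite ltr_pdivrMr // in h.
  by exists (Num.bound (`|X| / T)); exact: le_lt_trans (ler_norm X) h.
have in1 : inside S eps gam i0 (t0 + n%:R * T) by exists w0; split=> //; exact: sp_trans (periodic n) g0.
have [|ta [tb [i' [w' [[l1 l2 l3] [taE inn out gb hb]]]]]] := next_entry hr g0 h0 in1.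
  by rewrite ltrD2l.
have [r' [w'' [[hr' nt1 nt2] [gb' hb' z'] _ _]]] := passage HS eps_gt0 eps_lt hr l1 l2 g0 inn out gb hb.
have ii : i' = tip_comp r' by case: nt2.
rewrite ii in gb' hb' nt2.
have E : entry gam tb r' w'' by [].
have [r1 [w1 [M [s [g1 fl s2 cM sM]]]]] := cone_along_entries e2 cl E.
by have [] := hyperbolic_of_flow_along HS eps_gt0 eps_lt cl gb' g1 fl s2 cM sM.
Qed.

End Passages.

(** * The index of an orbit with a given word *)

Section RotationOfChords.
Variables (R : realType) (N : nat) (S : surgery R N).
Hypothesis HS : surgery_setup S.
Variable eps : R.
Hypotheses (eps_gt0 : 0 < eps) (eps_lt : eps < eps0 S).
Local Notation fe := (f_ S eps).
Local Notation He := (H_ S eps).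
Local Notation e0 := (eps0 S).
Local Notation glue := Defs.glue.
Local Notation "x ~~ y" := (same_point S eps x y) (at level 70).
Local Notation ezN := (@ez R N None).
Local Notation sp_trans := (same_point_trans HS eps_gt0 eps_lt).
Ltac elra := (pose proof eps_gt0; pose proof eps_lt; lra).
Implicit Types (i : 'I_N) (w P : triple R) (k : option 'I_N) (x y : spoint R N) (s t z p q : R).

Implicit Types r : chord R N.
Let link : legendrian_link S. Proof. by case: HS. Qed.

Lemma tangent_angle i q0 q1 : q0 <= q1 -> exists phi : R -> R,
  {within `[q0, q1], continuous phi} /\
  forall q, q0 <= q <= q1 -> tangent S i q = (cos (phi q), sin (phi q)).
Proof.
move=> q01; have [/(_ i) sm _] := link.
have E : (fun s : R => derive1 (lam S i) s) = 'D_1 (lam S i).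
  by apply/funext => s; rewrite derive1E.
have sm1 : smooth_on setT (fun s : R => derive1 (lam S i) s).
  by rewrite E => k; exact: (sm k.+1).2.
have [d2 c2] := smooth_derivable sm1.
have [k1 k2 _] := coord_continuous R.
have der (s : R) : is_derive s 1 (fun s : R => derive1 (lam S i) s) (derive1 (fun s : R => derive1 (lam S i) s) s).
  by rewrite [X in is_derive _ _ _ X]derive1E; exact: derivableP.
have [phi [cphi hphi]] := @angle_lift R (fun q => (tangent S i q).1) (fun q => (tangent S i q).2)
  (fun q => (derive1 (fun s : R => derive1 (lam S i) s) q).1.1)
  (fun q => (derive1 (fun s : R => derive1 (lam S i) s) q).1.2) q0 q1 q01
  (fun q => is_derive_linear (L := fst \o fst) k1 (der q))
  (fun q => is_derive_linear (L := snd \o fst) k2 (der q))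
  (fun q => cvg_comp _ _ (c2 q) (k1 _)) (fun q => cvg_comp _ _ (c2 q) (k2 _)) (tangent_unit HS i).
exists phi; split; first exact: cphi.
move=> q qq; have [h1 h2] := hphi q qq.
by rewrite -h1 -h2; case: (tangent S i q).
Qed.

(** The sine of the rotation angle is the cross product of the two tangents. *)
Lemma sin_theta r r' : is_chord S r -> is_chord S r' -> tip_comp r = tail_comp r' ->
  sin (theta S r r') = crossing_sign S r r'.
Proof.
move=> hr hr' cc; rewrite /theta; set q1 := if _ then _ else _.
have [t0 t1 _ _] := hr; have [t0' t1' _ _] := hr'.
have q01 : tip_par r <= q1 by rewrite /q1; case: ltP => [/ltW//|_]; lra.
have Tq : tangent S (tip_comp r) q1 = tangent S (tail_comp r') (tail_par r').
  rewrite cc /q1; case: ifP => _; first by [].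
  exact: (tangent_periodZ HS (tail_comp r') (tail_par r') 1).
have ex : exists th, total_rotation S (tip_comp r) (tip_par r) q1 th.
  have [phi [h1 h2]] := tangent_angle (tip_comp r) q01.
  by exists (phi q1 - phi (tip_par r)), phi.
have [phi [_ h2 ->]] := xgetPex 0 ex.
have e1 := h2 q1; rewrite q01 lexx Tq in e1; have {}e1 := e1 isT.
have e2 := h2 (tip_par r); rewrite q01 lexx in e2; have {}e2 := e2 isT.
rewrite sinB /crossing_sign.
have [a a2 aE] := tip_tangent HS hr; have [b b2 bE] := tail_tangent HS hr'.
rewrite aE bE /= in e1 e2 *.
case: e1 => <- <-; case: e2 => <- <-; ring.
Qed.

(** The tangents at a tip and at a tail are perpendicular, so that the rotation
    angle is an odd multiple of pi / 2 and its sine is 1 or -1. *)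
Lemma sign2_rot r r' : is_chord S r -> is_chord S r' -> tip_comp r = tail_comp r' ->
  sign2 R (rot_angle S r r')%:~R = crossing_sign S r r'.
Proof.
move=> hr hr' cc; apply: sign2_floor; last exact: sin_theta.
exact: crossing_sign_square.
Qed.

End RotationOfChords.

Section Words.
Variables (R : realType) (N : nat) (S : surgery R N).
Hypothesis HS : surgery_setup S.
Variable eps : R.
Hypotheses (eps_gt0 : 0 < eps) (eps_lt : eps < eps0 S).
Local Notation fe := (f_ S eps).
Local Notation He := (H_ S eps).
Local Notation e0 := (eps0 S).
Local Notation glue := Defs.glue.
Local Notation "x ~~ y" := (same_point S eps x y) (at level 70).
Local Notation ezN := (@ez R N None).
Local Notation sp_trans := (same_point_trans HS eps_gt0 eps_lt).
Ltac elra := (pose proof eps_gt0; pose proof eps_lt; lra).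
Implicit Types (i : 'I_N) (w P : triple R) (k : option 'I_N) (x y : spoint R N) (s t z p q : R).

Implicit Types r : chord R N.
Variables (gam : R -> spoint R N) (T : R) (m' : nat).
Local Notation m := m'.+1.
Variable w : 'I_m -> chord R N.
Hypotheses (cl : closed_orbit S eps gam T).
Hypotheses (hc : forall k : 'I_m, is_chord S (w k)) (hcomp : forall k : 'I_m, tip_comp (w k) = tail_comp (w (ordS k))).
Variables (a b : nat -> R).
Hypotheses (aT : a m = a 0%N + T).
Hypothesis hw : forall k : 'I_m,
  [/\ a k < b k, b k < a k.+1,
      forall t, a k < t < b k -> exists P,
        gam t ~~ (None, P) /\ rectangle S eps (w k) (xy P)
    & forall t, b k <= t <= a k.+1 -> exists u,
        gam t ~~ (Some (tip_comp (w k)), u) /\ handle S eps (tip_comp (w k)) u].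

(* the word and the entry times, extended to one further passage *)
Let wk (k : nat) := w (inord (k %% m)).
Let tau (k : nat) := if (k < m)%N then b k else b 0%N + T.

Let wkE (k : 'I_m) : wk k = w k.
Proof. by rewrite /wk modn_small // inord_val. Qed.

Let wkS (k : 'I_m) : wk k.+1 = w (ordS k).
Proof. by congr w; apply: val_inj; rewrite /= inordK // ltn_pmod. Qed.

Let after (k : nat) : (k < m)%N -> [/\ a k.+1 < tau k.+1,
   forall t, a k.+1 < t < tau k.+1 -> exists P,
        gam t ~~ (None, P) /\ rectangle S eps (wk k.+1) (xy P)
    & exists u, gam (tau k.+1) ~~ (Some (tip_comp (wk k.+1)), u) /\ handle S eps (tip_comp (wk k.+1)) u].
Proof.
move=> km; rewrite /tau; case: ltnP => km1.
  have [h1 h2 h3 h4] := hw (Ordinal km1); rewrite -[w _](wkE (Ordinal km1)) /= in h3 h4.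
  by split=> //; apply: h4; rewrite lexx ltW.
have -> : k.+1 = m by apply/eqP; rewrite eqn_leq km km1.
have [h1 h2 h3 h4] := hw ord0; have [T0 hr per] := cl.
have wm : wk m = w ord0 by rewrite /wk modnn; congr w; apply: val_inj; rewrite /= inordK.
have back t u : gam t ~~ u -> gam (t + T) ~~ u by exact: sp_trans (per t).
rewrite aT wm /= in h1 h3 h4 *; split; first by rewrite ltrD2r.
  move=> t /andP[t1 t2]; have [|P [gP rP]] := h3 (t - T); first by apply/andP; split; lra.
  by exists P; split=> //; have := back _ _ gP; rewrite subrK.
have [|u [gu hu]] := h4 (b 0%N); first by rewrite lexx ltW.
by exists u; split=> //; exact: back.
Qed.

(* The chord found by the analysis of a passage may a priori differ from the
   letter of the word; over the rectangle of the letter both have the same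
   strands, hence the same tangents. *)
Let word_step (k : nat) w0 : (k < m)%N -> gam (b k) ~~ (Some (tip_comp (wk k)), w0) ->
  exists r w1, [/\ entry S eps gam (tau k.+1) r w1, tip_comp r = tip_comp (wk k.+1),
    crossing_sign S r r = crossing_sign S (wk k.+1) (wk k.+1) &
    forall r0, is_chord S r0 -> near_tip eps r0 (tip_comp (wk k)) w0.2 ->
      flow_along S eps gam (b k) (tau k.+1) (Some (tip_comp (wk k)), w0) (Some (tip_comp r), w1)
        (crossing_mx S r *m shear_mx S eps (tip_comp (wk k)))].
Proof.
move=> km g0; have [T0 hr per] := cl.
have [h1 h2 [u [gu hu]]] := after km.
have [_ k2 _ k4] := hw (Ordinal km); rewrite -[w _](wkE (Ordinal km)) /= in k2 k4.
have out t : a k.+1 < t < tau k.+1 -> outside S eps gam t by move=> /h2[P [gP _]]; exists P.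
have [r [w1 [[hcr nt1 nt2] [g1 hh z1] [pe xyE over] fl]]] :=
  passage HS eps_gt0 eps_lt hr (ltW k2) h1 g0 k4 out gu hu.
have ii : tip_comp (wk k.+1) = tip_comp r by case: nt2.
have hck : is_chord S (wk k.+1) by exact: hc.
have [|P [gP [[p1 [q1 [pe1 qe1 X1]]] [p2 [q2 [pe2 qe2 X2]]]]]] := h2 ((a k.+1 + tau k.+1) / 2).
  by apply/andP; split; lra.
have Pt : xy P = _ := over _ P _ gP.
rewrite {}Pt in X1 X2; last by apply/andP; split; lra.
have pe' : `|w1.1.2| <= eps by case: hh.
have n1 : near_tip eps (wk k.+1) (tip_comp (wk k.+1)) q1 by split=> //; exists 0; rewrite addr0.
have n2 : near_tail eps (wk k.+1) (tail_comp (wk k.+1)) q2 by split=> //; exists 0; rewrite addr0.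
have e1 := same_tip HS eps_gt0 eps_lt hcr hck pe' pe1 nt2 n1 (etrans (esym xyE) X1).
have e2 := same_tail HS eps_gt0 eps_lt hcr hck pe pe2 nt1 n2 X2.
rewrite (near_tip_tangent HS eps_gt0 eps_lt hcr nt2) in e1.
rewrite (near_tail_tangent HS eps_gt0 eps_lt hcr nt1) in e2.
exists r, w1; split.
- by split; rewrite -?ii.
- by [].
- by rewrite /crossing_sign e1 e2.
- by rewrite -ii.
Qed.

Definition word_sign (k : nat) : R :=
  \prod_(l < k) (crossing_sign S (wk l.+1) (wk l.+1) * - coef S (tip_comp (wk l))).

Let word_chain : eps < 1 / 2 -> exists r0 w0, entry S eps gam (b 0%N) r0 w0 /\
  exists r1 w1 M, [/\ entry S eps gam (b 0%N + T) r1 w1,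
    flow_along S eps gam (b 0%N) (b 0%N + T) (Some (tip_comp r0), w0) (Some (tip_comp r1), w1) M,
    word_sign m ^+ 2 = 1, preserves_cone (word_sign m) M & 2 < word_sign m * \tr M].
Proof.
move=> e2; have [T0 hr per] := cl.
have bin (k : nat) : (k < m)%N -> exists u, gam (b k) ~~ (Some (tip_comp (wk k)), u).
  move=> km; have [_ k2 _ k4] := hw (Ordinal km); rewrite -[w _](wkE (Ordinal km)) /= in k2 k4.
  by have [|u [gu _]] := k4 (b k); [rewrite lexx ltW|exists u].
have tauE (k : nat) : (k < m)%N -> tau k = b k by rewrite /tau => ->.
have taum : tau m = b 0%N + T by rewrite /tau ltnn.
have wm : wk m = wk 0 by rewrite /wk modnn mod0n.
have [u gu] := bin m' (ltnSn _).
have [r0 [w0 [E0 i0 _ _]]] := word_step (ltnSn _) gu.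
rewrite taum wm in E0 i0.
have {}E0 : entry S eps gam (b 0%N) r0 w0.
  by case: E0 => *; split=> //; apply: sp_trans (same_point_sym (per _)) _.
exists r0, w0; split=> //.
suff : forall k : nat, (k <= m)%N -> exists r1 w1 M, [/\ entry S eps gam (tau k) r1 w1,
    tip_comp r1 = tip_comp (wk k) /\ b 0%N <= tau k,
    flow_along S eps gam (b 0%N) (tau k) (Some (tip_comp r0), w0) (Some (tip_comp r1), w1) M,
    word_sign k ^+ 2 = 1 /\ preserves_cone (word_sign k) M & (0 < k)%N -> 2 < word_sign k * \tr M].
  move=> /(_ m (leqnn _))[r1 [w1 [M [E1 _ fl [s2 cM] sM]]]].
  by rewrite taum in E1 fl; exists r1, w1, M; split=> //; exact: sM.
elim=> [_|k IH km].
  have [_ _ g0 h0 _] := E0; exists r0, w0, 1%:M; rewrite tauE // /word_sign big_ord0.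
  split=> //; last by split; [rewrite expr1n|exact: preserves_cone1].
  have dx : chart_dom S eps (Some (tip_comp r0), w0) by exact: handle_chart.
  apply: (flow_along_jump HS eps_gt0 eps_lt g0).
  exact: (contact_flow_mod1 HS eps_gt0 eps_lt dx erefl (eq_mod1_refl _)).
have [r1 [w1 [M [E1 [i1 l1] fl [s2 cM] _]]]] := IH (ltnW km).
rewrite tauE // in E1 fl l1; have [hc1 nt1 g1 _ _] := E1; rewrite i1 in g1 nt1.
have [r2 [w2 [E2 i2 sgn fl2]]] := word_step km g1.
have hc2 : is_chord S r2 by case: E2.
have {}fl2 := fl2 r1 hc1 nt1; rewrite -i1 in fl2.
have [s2' cM' sM'] := passage_cone HS eps_gt0 (tip_comp r1) e2 hc2 s2 cM.
have sE : word_sign k * crossing_sign S r2 r2 * - coef S (tip_comp r1) = word_sign k.+1.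
  by rewrite {2}/word_sign big_ord_recr /= -sgn -i1 mulrA.
rewrite sE in s2' cM' sM'.
have l2 : b k <= tau k.+1.
  have [k1 k2 _ _] := hw (Ordinal km); have [h1 _ _] := after km.
  by apply: ltW; apply: lt_trans k2 h1.
exists r2, w2, (crossing_mx S r2 *m shear_mx S eps (tip_comp r1) *m M); split.
- exact: E2.
- by split; [exact: i2|exact: le_trans l1 l2].
- exact: (flow_along_trans HS eps_gt0 eps_lt l1 l2 fl fl2).
- by split; [exact: s2'|exact: cM'].
- by move=> _; exact: sM'.
Qed.

(** The orientation of the strand at the tip of each letter enters once with the
    preceding tail and once with the following one; shifting the index of these
    factors turns crossing signs into rotation signs. *)
Lemma word_signE : word_sign m =
  sign2 R (\sum_(k < m) ((rot_angle S (w k) (w (ordS k)))%:~R + (coef S (tip_comp (w k)) == 1)%:R)).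
Proof.
have sumE (n : nat) (F : 'I_n -> 'Z_2) : sign2 R (\sum_(k < n) F k) = \prod_(k < n) sign2 R (F k).
  by apply: (big_morph _ (@sign2D R)).
rewrite sumE /word_sign.
transitivity ((\prod_(k < m) (2 * (tangent S (tip_comp (w k)) (tip_par (w k))).1)) *
  \prod_(k < m) ((tangent S (tail_comp (w (ordS k))) (tail_par (w (ordS k)))).1 * - coef S (tip_comp (w k)))).
  rewrite [X in X * _](reindex_inj (@ordS_inj m)) -big_split /=; apply: eq_bigr => k _.
  by rewrite wkE wkS /crossing_sign -[LHS]mulrA.
rewrite -big_split /=; apply: eq_bigr => k _.
rewrite sign2D (sign2_rot HS (hc k) (hc _) (hcomp k)) /crossing_sign [LHS]mulrA; congr (_ * _).
case: (coef_pm1 S (tip_comp (w k))) => ->; first by rewrite eqxx sign2_1.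
by rewrite opprK (_ : (-1 == 1 :> R) = false) ?/sign2 //; apply/negbTE; rewrite lt_eqF //; lra.
Qed.

(** Both the sign of the trace and the parity of the index are given by the
    product of the signs of the passages. *)
Theorem word_orbit_hyperbolic : eps < 1 / 2 -> hyperbolic S eps gam T /\
  has_CZ2 S eps gam T
    (\sum_(k < m) ((rot_angle S (w k) (w (ordS k)))%:~R + (coef S (tip_comp (w k)) == 1)%:R)).
Proof.
move=> e2; have [r0 [w0 [E0 [r1 [w1 [M [E1 fl s2 cM sM]]]]]]] := word_chain e2.
have [_ _ g0 _ _] := E0; have [_ _ g1 _ _] := E1.
have [hyp [A [lA sA]]] := hyperbolic_of_flow_along HS eps_gt0 eps_lt cl g0 g1 fl s2 cM sM.
by split=> //; exists A; split=> //; rewrite sA word_signE /sign2 exprS mulN1r.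
Qed.

End Words.

(** * The theorem *)

Theorem theorem5p3 (R : realType) (N : nat) (S : surgery R N)
    (HS : surgery_setup S) :
  (forall n : nat, (0 < n)%N ->
     exists eps_n : R, 0 < eps_n /\
       forall eps : R, 0 < eps -> eps < eps0 S -> eps <= eps_n ->
       forall (gam : R -> spoint R N) (T : R) (m : nat) (w : 'I_m -> chord R N),
         closed_orbit S eps gam T -> orbit_word S eps gam T w -> (m <= n)%N ->
         hyperbolic S eps gam T /\
         has_CZ2 S eps gam T
           (\sum_(k < m) ((rot_angle S (w k) (w (ordS k)))%:~R
                          + (coef S (tip_comp (w k)) == 1)%:R)))
  /\
  ((Lpos S = finset.set0 \/ finset.setC (Lpos S) = finset.set0) ->
     forall eps : R, 0 < eps -> eps < Num.min (1 / 2) (eps0 S) ->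
     forall (gam : R -> spoint R N) (T : R),
       closed_orbit S eps gam T -> hyperbolic S eps gam T).
Proof.
split=> [n _|_ eps e0 em gam T cl]; last first.
  move: em; rewrite lt_min => /andP[e2 el].
  exact: closed_orbit_hyperbolic HS eps e0 el gam T e2 cl.
exists (1 / 4); split; first by lra.
move=> eps e0 el e4 gam T [|m] w cl [hc [hcomp [a [b [aT hw]]]]] _.
  by case: cl => T0 _ _; move: aT; lra.
have e2 : eps < 1 / 2 by lra.
have := word_orbit_hyperbolic HS e0 el cl hc hcomp aT hw e2; exact.
Qed.
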